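(* Let $\alpha>0$ and let $p$ and $q$ be two positive real numbers such that $p>q$. There exists a sequence $\Lambda$ in $\mathbb{C}$ satisfying $$\mathcal{D}^+(\Lambda)=\mathcal{D}^-(\Lambda)=\frac{\alpha}{\pi},$$ and such that $\Lambda$ is a zero set for $\mathcal{F}^p_\alpha$ but $\Lambda$ is not a zero set for $\mathcal{F}^q_\alpha$.
   Context: For $\alpha>0$ and $p>0$, the Fock space $\mathcal{F}^p_\alpha$ consists of all entire functions $f:\mathbb{C}\to\mathbb{C}$ satisfying $$\|f\|_{p,\alpha}^p:=\frac{p\alpha}{2\pi}\int_{\mathbb{C}}|f(z)|^p e^{-\frac{p\alpha}{2}|z|^2}\,dA(z)<\infty,$$ where $A$ is the Lebesgue area measure on $\mathbb{C}$. A sequence $\Lambda$ of complex numbers is called a zero set for $\mathcal{F}^p_\alpha$ if there exists $f\in\mathcal{F}^p_\alpha\setminus\{0\}$ such that the zero set $\{z\in\mathbb{C}: f(z)=0\}$ of $f$, counted with multiplicities, coincides with $\Lambda$. For a sequence $\Lambda\subset\mathbb{C}$, let $N_\Lambda(z,\rho)$ be the number of elements of $\Lambda$ in the open Euclidean disk of center $z\in\mathbb{C}$ and radius $\rho>0$. The upper and lower Beurling-Landau densities of $\Lambda$ are $$\mathcal{D}^+(\Lambda):=\limsup_{\rho\to\infty}\sup_{z\in\mathbb{C}}\frac{N_\Lambda(z,\rho)}{\pi\rho^2},\qquad \mathcal{D}^-(\Lambda):=\liminf_{\rho\to\infty}\inf_{z\in\mathbb{C}}\frac{N_\Lambda(z,\rho)}{\pi\rho^2}.$$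 *)

(* Defs.v *)
From HB Require Import structures.
From mathcomp Require Import all_boot all_order all_algebra.
From mathcomp Require Import complex.
From mathcomp Require Import all_classical all_reals all_analysis.

Set Implicit Arguments.
Unset Strict Implicit.
Unset Printing Implicit Defensive.

Import Order.TTheory GRing.Theory Num.Theory.
Import numFieldNormedType.Exports.

Local Open Scope classical_set_scope.
Local Open Scope ring_scope.
Local Open Scope complex_scope.

(* On [R[i]^o] the scalar field is [R[i]] itself, so [derivable f z 1] is
   complex differentiability. *)
Definition entire (R : realType) (f : R[i]^o -> R[i]^o) : Prop :=
  forall z : R[i]^o, derivable f z 1.

Definition cmod (R : realType) (z : R[i]) : R := ComplexField.Normc.normc z.

Definition fock_norm_pow (R : realType) (alpha p : R) (f : R[i]^o -> R[i]^o)
    : \bar R :=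
  ((p * alpha / (2 * pi))%:E *
   \int[(@lebesgue_measure R) \x (@lebesgue_measure R)]_(xy in setT)
     ((cmod (f (xy.1 +i* xy.2))) `^ p *
      expR (- (p * alpha / 2) * (cmod (xy.1 +i* xy.2)) ^+ 2))%:E)%E.

Definition fock_space (R : realType) (alpha p : R)
    : set (R[i]^o -> R[i]^o) :=
  [set f | entire f /\ (fock_norm_pow alpha p f < +oo)%E].

(* Order [m = 0] means that [f] is holomorphic near [z] and [f z != 0]. *)
Definition zero_order (R : realType) (f : R[i]^o -> R[i]^o) (z : R[i]^o)
    (m : nat) : Prop :=
  exists g : R[i]^o -> R[i]^o,
    [/\ \forall w \near z, derivable g w 1,
        g z != 0 &
        \forall w \near z, f w = (w - z) ^+ m * g w].

(* Points may repeat in a sequence: the multiplicity of [z] in [Lambda] is the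
   number of indices [n] with [Lambda n = z]. *)
Definition zeros_are (R : realType) (f : R[i]^o -> R[i]^o)
    (Lambda : nat -> R[i]) : Prop :=
  forall z : R[i],
    exists2 m : nat, zero_order f z m & ([set n | Lambda n = z] #= `I_m)%card.

Definition is_zero_set (R : realType) (alpha p : R) (Lambda : nat -> R[i])
    : Prop :=
  exists2 f : R[i]^o -> R[i]^o,
    (fock_space alpha p `\ cst 0) f & zeros_are f Lambda.

Definition disk_count (R : realType) (Lambda : nat -> R[i]) (z : R[i])
    (rho : R) : \bar R :=
  counting [set n | cmod (Lambda n - z) < rho].

Definition disk_density (R : realType) (Lambda : nat -> R[i]) (z : R[i])
    (rho : R) : \bar R :=
  (disk_count Lambda z rho * ((pi * rho ^+ 2)^-1)%:E)%E.

Definition upper_density (R : realType) (Lambda : nat -> R[i]) : \bar R :=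
  limf_esup
    (fun rho : R => ereal_sup (range (fun z => disk_density Lambda z rho)))
    (pinfty_nbhs R).

Definition lower_density (R : realType) (Lambda : nat -> R[i]) : \bar R :=
  limf_einf
    (fun rho : R => ereal_inf (range (fun z => disk_density Lambda z rho)))
    (pinfty_nbhs R).

(* Main.v *)
From HB Require Import structures.
From Stdlib Require PeanoNat.
Require Import Defs.
From mathcomp Require Import all_boot all_order all_algebra.
From mathcomp Require Import complex.
From mathcomp Require Import all_classical all_reals all_analysis.
From mathcomp Require Import ring lra zify measurable_realfun.

(* Put s = 2 / q, so that s q = 2 < s p.  The zeros are placed on concentric
   circles: the j-th one carries 2 j + 1 equispaced points, and its radius r_j,
   of size about j / sqrt alpha, is chosen so that the monomial of degree n^2 of
   the product f(z) = prod_j (1 - (z / r_j)^(2 j + 1)) is tangent, on the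
   logarithmic scale, to the weight alpha |z|^2 / 2 - s log |z|.

   The product then satisfies |f(z)| e^(- alpha |z|^2 / 2) <= C (1 + |z|)^(- s),
   and f is in F^p since s p > 2.  Rotating an annulus of area proportional to
   2 j + 1 by the roots of unity spreads the j-th circle uniformly, at bounded
   distance, over it, and both densities are alpha / pi.

   If an entire F has the same zeros, divide it by the n-th partial product P_n:
   the quotient H is entire and H(0) = F(0) != 0.  On an annulus of radius
   about n / sqrt alpha and area of order n, P_n has the opposite lower bound
   |P_n| e^(- alpha |z|^2 / 2) >= k |z|^(- s), and the circular means of |H|^q
   are at least |F(0)|^q / 2 by Jensen's inequality.  As s q = 2, this annulus
   contributes at least a multiple of 1 / n to the norm of F in F^q, so the norm
   diverges like the harmonic series.

   Jensen's inequality is used without path integrals: the maximum principle is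
   read off Riemann sums along circles, by Goursat's bisection of rectangles in
   logarithmic coordinates, and applied to the product of the rotates of H. *)

Set Implicit Arguments.
Unset Strict Implicit.
Unset Printing Implicit Defensive.

Import Order.TTheory GRing.Theory Num.Theory.
Import numFieldNormedType.Exports.

Local Open Scope classical_set_scope.
Local Open Scope ring_scope.
Local Open Scope complex_scope.

(** * Modulus and derivatives of complex functions *)

(** An F with the given zeros is f times the exponential of an arbitrary entire function, so
    non-membership has to be uniform over such factors. What survives is one value: P_n 0 = 1, hence
    H 0 = F 0 for every n, and Jensen's inequality uses nothing else about H. Dividing by P_n rather
    than by f keeps the lower bound away from zeros: ring n may meet the n-th annulus, but its zeros
    then stay in H.

    With 2 j + 1 points on ring j the dominant monomials have degrees n^2. They touch the weight at
    a |z|^2 = n^2 + s, and r_j is the radius where the monomials of degrees j^2 and (j + 1)^2 have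
    equal modulus. Consecutive contact points differ in a |z|^2 by about 2 |z| sqrt a, so the
    defect, of order (a |z|^2 - n^2 - s)^2 / (a |z|^2), stays bounded: both bounds on the product
    lose only constants. The shift by s moves each r_j by a bounded amount, which the densities do
    not see. Any s with 2 / p < s <= 2 / q would serve; the endpoint turns |z|^(- s q) into |z|^(-
    2). *)

Section ComplexModulus.
Variable R : realType.
Implicit Types (z w : R[i]) (x y t : R).

Lemma normC_cmod z : `|z| = (cmod z)%:C.
Proof. by case: z => a b; rewrite normc_def. Qed.

Lemma cmodM z w : cmod (z * w) = cmod z * cmod w.
Proof. exact: ComplexField.Normc.normcM. Qed.

Lemma cmod0 : cmod (0 : R[i]) = 0.
Proof. exact: ComplexField.Normc.normc0. Qed.

Lemma cmod1 : cmod (1 : R[i]) = 1.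
Proof. exact: ComplexField.Normc.normc1. Qed.

Lemma cmodN z : cmod (- z) = cmod z.
Proof. exact: normcN. Qed.

Lemma cmodD z w : cmod (z + w) <= cmod z + cmod w.
Proof. exact: le_normcD. Qed.

Lemma cmodB z w : cmod (z - w) = cmod (w - z).
Proof. by rewrite -cmodN opprB. Qed.

Lemma cmod_leB z w : cmod z - cmod w <= cmod (z - w).
Proof. by rewrite lerBlDr (le_trans _ (cmodD _ _))// subrK. Qed.

Lemma cmod_distB z w : `|cmod z - cmod w| <= cmod (z - w).
Proof.
rewrite ler_norml cmod_leB andbT lerNl opprB cmodB; exact: cmod_leB.
Qed.

Lemma cmod_dist_trans z w v : cmod (z - v) <= cmod (z - w) + cmod (w - v).
Proof. by rewrite (le_trans _ (cmodD _ _))// addrA subrK. Qed.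

Lemma cmod_ge0 z : 0 <= cmod z.
Proof. by case: z => a b; exact: sqrtr_ge0. Qed.

Lemma cmod_eq0 z : (cmod z == 0) = (z == 0).
Proof.
apply/eqP/eqP => [|->]; [exact: ComplexField.Normc.eq0_normc|exact: cmod0].
Qed.

Lemma cmod_gt0 z : (0 < cmod z) = (z != 0).
Proof. by rewrite lt_neqAle cmod_ge0 andbT eq_sym cmod_eq0. Qed.

Lemma cmodX z n : cmod (z ^+ n) = cmod z ^+ n.
Proof. by elim: n => [|n IH]; rewrite ?expr0 ?cmod1// !exprS cmodM IH. Qed.

Lemma cmod_prod I (r : seq I) (F : I -> R[i]) :
  cmod (\prod_(i <- r) F i) = \prod_(i <- r) cmod (F i).
Proof. exact: (big_morph _ cmodM cmod1). Qed.

Lemma cmod_sum I (r : seq I) (P : pred I) (F : I -> R[i]) :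
  cmod (\sum_(i <- r | P i) F i) <= \sum_(i <- r | P i) cmod (F i).
Proof.
elim/big_ind2 : _ => //; first by rewrite cmod0.
by move=> x a y b xa yb; rewrite (le_trans (cmodD _ _))// lerD.
Qed.

Lemma cmodR x : cmod x%:C = `|x|.
Proof. by rewrite /cmod /= expr0n addr0 sqrtr_sqr. Qed.

Lemma cmodi : cmod ('i : R[i]) = 1.
Proof. by rewrite /cmod /= expr0n expr1n add0r sqrtr1. Qed.

Lemma cmod_sqr z : cmod z ^+ 2 = complex.Re z ^+ 2 + complex.Im z ^+ 2.
Proof. by case: z => a b; rewrite /cmod /= sqr_sqrtr// addr_ge0 ?sqr_ge0. Qed.

Lemma Re_le_cmod z : `|complex.Re z| <= cmod z.
Proof.
by rewrite -ler_sqr ?nnegrE ?cmod_ge0// cmod_sqr real_normK ?num_real// lerDl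
  sqr_ge0.
Qed.

Lemma Im_le_cmod z : `|complex.Im z| <= cmod z.
Proof.
by rewrite -ler_sqr ?nnegrE ?cmod_ge0// cmod_sqr real_normK ?num_real// lerDr
  sqr_ge0.
Qed.

Lemma cmod_le_ReIm z : cmod z <= `|complex.Re z| + `|complex.Im z|.
Proof.
rewrite -ler_sqr ?nnegrE ?cmod_ge0 ?addr_ge0// cmod_sqr.
rewrite sqrrD !real_normK ?num_real// lerD2r lerDl.
by rewrite mulrn_wge0// mulr_ge0.
Qed.

Lemma complexDi x y : x +i* y = x%:C + 'i * y%:C :> R[i].
Proof. by congr (_ +i* _); ring. Qed.

End ComplexModulus.

Section ComplexTopology.
Variable R : realType.
Implicit Types (f g : R[i]^o -> R[i]^o) (z w : R[i]^o).

(** Balls of R[i] have their radius in R[i] itself; a positive element for the order of that field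
    is real, so real radii give the same neighbourhoods. *)
Lemma near_complexP (P : R[i]^o -> Prop) z :
  (\forall w \near z, P w) <->
  exists2 d : R, 0 < d & forall w, cmod (w - z) < d -> P w.
Proof.
split.
  case/nbhs_ballP => e /= e0 he.
  have [d ed] : exists d : R, e = d%:C.
    by apply/complex_realP; apply: gtr0_real.
  exists d; first by move: e0; rewrite ed ltcR.
  move=> w wd; apply: he; rewrite -ball_normE /= ed.
  by rewrite normC_cmod ltcR cmodB.
move=> [d d0 hd]; apply/nbhs_ballP; exists d%:C => /=; first by rewrite ltcR.
move=> w; rewrite -ball_normE /= normC_cmod ltcR cmodB; exact: hd.
Qed.

(** The derivative as a remainder bound with real constants, meaningful at h = 0 as well, so that
    estimates need neither difference quotients nor the punctured filter. *)
Definition cderiv f z (D : R[i]) := forall e : R, 0 < e ->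
  exists2 d : R, 0 < d & forall h : R[i], cmod h < d ->
    cmod (f (z + h) - f z - D * h) <= e * cmod h.

Lemma derivable_cderiv f z : derivable f z 1 <-> exists D, cderiv f z D.
Proof.
split.
  move=> /cvg_ex[/= D]; rewrite /cderiv => hD; exists D => e e0.
  have /cvgrPdist_le/(_ e%:C) : (fun h : R[i]^o => h^-1 *: (f (h *: (1 : R[i]^o) + z) - f z))
     @ 0^' --> (D : R[i]^o) by exact: hD.
  rewrite ltcR => /(_ e0); rewrite near_withinE => /near_complexP[d d0 hd].
  exists d => // h hd'.
  have [->|h0] := eqVneq h 0.
    by rewrite addr0 subrr mulr0 subr0 cmod0 mulr0.
  have := hd h; rewrite subr0 => /(_ hd' h0).
  rewrite normC_cmod lecR => he.
  have -> : f (z + h) - f z - D * h =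
    - ((D - h^-1 *: (f (h *: (1 : R[i]^o) + z) - f z)) * h).
    have -> : h *: (1 : R[i]^o) = h by rewrite /GRing.scale /= mulr1.
    rewrite /GRing.scale /= [h + z]addrC mulrBl mulrAC mulVf// mul1r.
    by rewrite opprB.
  by rewrite cmodN cmodM ler_wpM2r// cmod_ge0.
move=> [D hD]; apply/cvg_ex; exists (D : R[i]^o).
apply/cvgrPdist_le => e e0.
have [d ed] : exists d : R, e = d%:C.
  by apply/complex_realP; apply: gtr0_real.
move: e0; rewrite ed ltcR => d0.
have [d' d'0 hd'] := hD _ d0.
rewrite near_withinE; apply/near_complexP; exists d' => // h.
rewrite subr0 => hd h0; have := hd' h hd.
rewrite normC_cmod lecR /=.
have -> : h *: (1 : R[i]^o) = h by rewrite /GRing.scale /= mulr1.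
have -> : f (z + h) - f z - D * h = - ((D - h^-1 *: (f (h + z) - f z)) * h).
    rewrite /GRing.scale /= [h + z]addrC mulrBl mulrAC mulVf// mul1r.
    by rewrite opprB.
by rewrite cmodN cmodM ler_pM2r// cmod_gt0.
Qed.

Definition ccontinuous f z := forall e : R, 0 < e ->
  exists2 d : R, 0 < d & forall w, cmod (w - z) < d -> cmod (f w - f z) < e.

Lemma cderiv_ccontinuous f z D : cderiv f z D -> ccontinuous f z.
Proof.
move=> hD e e0.
have [d d0 hd] := hD _ (@ltr01 R).
have D1 : 0 < cmod D + 2 by rewrite ltr_wpDl// cmod_ge0.
exists (Num.min d (e / (cmod D + 2))); first by rewrite lt_min d0 divr_gt0.
move=> w; rewrite lt_min => /andP[wd we].
have h1 := hd _ wd; rewrite mul1r [z + _]addrC subrK in h1.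
have h2 : cmod (f w - f z) <= cmod (w - z) * (cmod D + 1).
  have -> : f w - f z = (f w - f z - D * (w - z)) + D * (w - z) by rewrite subrK.
  have -> : cmod (w - z) * (cmod D + 1) = cmod (w - z) + cmod D * cmod (w - z).
    by ring.
  by rewrite (le_trans (cmodD _ _))// cmodM lerD2r.
rewrite (le_lt_trans h2)//.
rewrite ltr_pdivlMr// in we.
by rewrite (le_lt_trans _ we)// ler_wpM2l ?cmod_ge0// lerD2l ler1n.
Qed.

Lemma entire_ccontinuous f z : entire f -> ccontinuous f z.
Proof. by move=> /(_ z)/derivable_cderiv[D /cderiv_ccontinuous]. Qed.

Lemma entireM f g : entire f -> entire g -> entire (fun z => f z * g z).
Proof. by move=> hf hg z; apply: (@derivableM _ R[i]^o). Qed.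

Lemma entire_cst c : entire (fun _ : R[i]^o => c).
Proof. by move=> z; exact: derivable_cst. Qed.

Lemma entire_prod n (f : nat -> R[i]^o -> R[i]^o) : (forall k, entire (f k)) ->
  entire (fun z => \prod_(k < n) f k z).
Proof.
move=> hf; elim: n => [|n IH].
  have -> : (fun z => \prod_(k < 0) f k z) = fun _ : R[i]^o => 1 :> R[i].
    by apply/funext => z; rewrite big_ord0.
  exact: entire_cst.
have -> : (fun z => \prod_(k < n.+1) f k z) = fun z => \prod_(k < n) f k z * f n z.
  by apply/funext => z; rewrite big_ord_recr.
exact: (entireM IH (hf n)).
Qed.

Lemma entire_scale f (c : R[i]) : entire f -> entire (fun z => f (c * z)).
Proof.
move=> hf z; have /derivable_cderiv[D hD] := hf (c * z).
apply/derivable_cderiv; exists (c * D) => e e0.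
have c1 : 0 < cmod c + 1 by rewrite ltr_wpDl// cmod_ge0.
have [d d0 hd] := hD (e / (cmod c + 1)) (divr_gt0 e0 c1).
exists (d / (cmod c + 1)); first exact: divr_gt0.
move=> h hh; rewrite mulrDr -mulrA [D * h]mulrC mulrA [c * h * D]mulrC.
have cle : cmod (c * h) <= (cmod c + 1) * cmod h.
  by rewrite cmodM ler_wpM2r ?cmod_ge0// lerDl.
apply: (le_trans (hd _ _)).
  by rewrite (le_lt_trans cle)// mulrC -ltr_pdivlMr.
rewrite -mulrA ler_wpM2l ?(ltW e0)//.
by rewrite ler_pdivrMl.
Qed.

End ComplexTopology.

Section Cis.
Variable R : realType.
Implicit Types t u : R.

Definition cis t : R[i] := cos t +i* sin t.

Lemma cis0 : cis 0 = 1.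
Proof. by rewrite /cis cos0 sin0. Qed.

Lemma cisD t u : cis (t + u) = cis t * cis u.
Proof. by rewrite /cis cosD sinD; congr (_ +i* _); ring. Qed.

Lemma cmod_cis t : cmod (cis t) = 1.
Proof. by rewrite /cmod /= cos2Dsin2 sqrtr1. Qed.

Lemma cis2pi : cis (2 * pi) = 1.
Proof. by rewrite /cis mulrC mulr_natr cos2pi sin2pi. Qed.

Lemma cisMn t n : cis (n%:R * t) = cis t ^+ n.
Proof.
elim: n => [|n IH]; first by rewrite mul0r cis0 expr0.
by rewrite -natr1 mulrDl mul1r cisD IH exprSr.
Qed.

End Cis.

(** * Goursat's lemma by bisection *)

Section Bisection.
Variable R : realType.

Lemma nested_intervals (a : nat -> R) (W : R) : 0 <= W ->
  (forall m, a m <= a m.+1 <= a m + W / 2 ^+ m.+1) ->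
  exists u, forall m, a m <= u <= a m + W / 2 ^+ m.
Proof.
move=> W0 ha.
have a_nd : {homo a : m n / (m <= n)%N >-> m <= n}.
  by apply: homo_leq => [x//|y x z|m]; [exact: le_trans|case/andP: (ha m)].
have b_ni m n : (m <= n)%N -> a n + W / 2 ^+ n <= a m + W / 2 ^+ m.
  move=> /subnK <-; elim: (n - m)%N => [//|k IH]; rewrite addSn.
  apply: le_trans IH; case/andP: (ha (k + m)%N) => _ h.
  have -> : W / 2 ^+ (k + m) = W / 2 ^+ (k + m).+1 + W / 2 ^+ (k + m).+1.
    by rewrite exprS invfM; field; rewrite expf_neq0.
  by rewrite addrA lerD2r.
have ab m n : a n <= a m + W / 2 ^+ m.
  have b_ge k : a k <= a k + W / 2 ^+ k by rewrite lerDl divr_ge0// exprn_ge0.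
  have [mn|/ltnW nm] := leqP m n.
    exact: le_trans (b_ge n) (b_ni _ _ mn).
  exact: le_trans (a_nd _ _ nm) (b_ge m).
exists (sup (range a)) => m; apply/andP; split.
  apply: ub_le_sup; last by exists m.
  by exists (a 0%N + W / 2 ^+ 0) => _ [n _ <-].
by apply: ge_sup => [|_ [n _ <-]//]; exists (a 0%N), 0%N.
Qed.

(** If P failed on the rectangle it would fail on some quarter, then on a quarter of that one, and
    so on; these shrink to a point (u, v), where the local hypothesis is contradicted. Serves both
    for Goursat's lemma and for uniform continuity. *)
Lemma rect_bisection (W H : R) (P : R -> R -> nat -> Prop) :
  0 <= W -> 0 <= H ->
  (forall x y m, P x y m.+1 -> P (x + W / 2 ^+ m.+1) y m.+1 ->
     P x (y + H / 2 ^+ m.+1) m.+1 ->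
     P (x + W / 2 ^+ m.+1) (y + H / 2 ^+ m.+1) m.+1 -> P x y m) ->
  (forall u v, exists M, forall x y m, (M <= m)%N ->
     x <= u <= x + W / 2 ^+ m -> y <= v <= y + H / 2 ^+ m -> P x y m) ->
  forall x y, P x y 0.
Proof.
move=> W0 H0 hunion hloc x0 y0; apply: contrapT => nP0.
(* Failure is passed on by an implication, so that a quarter can be chosen for every rectangle,
   failing or not. *)
pose good m (p p' : R * R) := (~ P p.1 p.2 m -> ~ P p'.1 p'.2 m.+1) /\
  (p.1 <= p'.1 <= p.1 + W / 2 ^+ m.+1) /\ (p.2 <= p'.2 <= p.2 + H / 2 ^+ m.+1).
have /choice[nx hnx] : forall mp : nat * (R * R), exists p', good mp.1 mp.2 p'.
  move=> [m [x y]] /=.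
  have dW : 0 <= W / 2 ^+ m.+1 by rewrite divr_ge0// exprn_ge0.
  have dH : 0 <= H / 2 ^+ m.+1 by rewrite divr_ge0// exprn_ge0.
  have [h1|h1] := pselect (P x y m.+1); last first.
    by exists (x, y); split => //=; rewrite !lexx !lerDl dW dH.
  have [h2|h2] := pselect (P (x + W / 2 ^+ m.+1) y m.+1); last first.
    by exists (x + W / 2 ^+ m.+1, y); split => //=; rewrite !lexx !lerDl dW dH.
  have [h3|h3] := pselect (P x (y + H / 2 ^+ m.+1) m.+1); last first.
    by exists (x, y + H / 2 ^+ m.+1); split => //=; rewrite !lexx !lerDl dW dH.
  exists (x + W / 2 ^+ m.+1, y + H / 2 ^+ m.+1); split => /=; last first.
    by rewrite !lexx !lerDl dW dH.
  by move=> nP h4; apply: nP; exact: hunion.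
pose s := fix s m := if m is k.+1 then nx (k, s k) else (x0, y0).
have hs m : good m (s m) (s m.+1) by exact: (hnx (m, s m)).
have nP m : ~ P (s m).1 (s m).2 m by elim: m => [//|m IH]; exact: (hs m).1.
have [u hu] := @nested_intervals (fun m => (s m).1) W W0 (fun m => (hs m).2.1).
have [v hv] := @nested_intervals (fun m => (s m).2) H H0 (fun m => (hs m).2.2).
have [M hM] := hloc u v.
by apply: (nP M); exact: hM.
Qed.

End Bisection.

Section Goursat.
Variable R : realType.
Variable K : R -> R -> R[i].

(** Real differentiability with the complex-linear differential D (a + i b), that is, holomorphy in
    w = u + i v. *)
Definition pderiv u v (D : R[i]) := forall e : R, 0 < e ->
  exists2 d : R, 0 < d & forall a b : R, `|a| < d -> `|b| < d ->
    cmod (K (u + a) (v + b) - K u v - D * (a +i* b)) <= e * (`|a| + `|b|).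

Let Vs dy x y n : R[i] := \sum_(0 <= k < n) K x (y + k%:R * dy).
Let Hs dx x y n : R[i] := \sum_(0 <= k < n) K (x + k%:R * dx) y.

(* A left Riemann sum for the integral of K dw along the boundary of the
   rectangle of corner (x, y) and sides n dx, n dy. *)
Definition boundary_sum (x y dx dy : R) n : R[i] :=
  'i * dy%:C * (Vs dy (x + n%:R * dx) y n - Vs dy x y n)
  - dx%:C * (Hs dx x (y + n%:R * dy) n - Hs dx x y n).

Let VsD dy x y n m : Vs dy x y (n + m) = Vs dy x y n + Vs dy x (y + n%:R * dy) m.
Proof.
rewrite /Vs (@big_cat_nat _ _ _ n)//= ?leq_addr//; congr (_ + _).
rewrite -{1}(addn0 n) addnC big_addn addKn.
by apply: eq_bigr => k _; rewrite natrD mulrDl addrA addrAC.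
Qed.

Let HsD dx x y n m : Hs dx x y (n + m) = Hs dx x y n + Hs dx (x + n%:R * dx) y m.
Proof.
rewrite /Hs (@big_cat_nat _ _ _ n)//= ?leq_addr//; congr (_ + _).
rewrite -{1}(addn0 n) addnC big_addn addKn.
by apply: eq_bigr => k _; rewrite natrD mulrDl addrA addrAC.
Qed.

(** The quarters keep the mesh of the whole, so the sums along the inner sides cancel exactly and
    not only in the limit. *)
Lemma boundary_sum_split x y dx dy n :
  boundary_sum x y dx dy (n + n) =
    boundary_sum x y dx dy n + boundary_sum (x + n%:R * dx) y dx dy n +
    boundary_sum x (y + n%:R * dy) dx dy n +
    boundary_sum (x + n%:R * dx) (y + n%:R * dy) dx dy n.
Proof.
rewrite /boundary_sum !VsD !HsD natrD !mulrDl !addrA.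
ring.
Qed.

(** The affine part of K cancels between the two pairs of opposite sides, since n dy W = n dx H;
    only the remainder E is left, at most e (W + H) at each node. *)
Lemma boundary_sum_le x y dx dy n u v D e : 0 <= dx -> 0 <= dy -> 0 <= e ->
  x <= u <= x + n%:R * dx -> y <= v <= y + n%:R * dy ->
  (forall x' y', x <= x' <= x + n%:R * dx -> y <= y' <= y + n%:R * dy ->
    cmod (K x' y' - K u v - D * ((x' - u) +i* (y' - v))) <=
      e * (`|x' - u| + `|y' - v|)) ->
  cmod (boundary_sum x y dx dy n) <= 2 * e * (n%:R * dx + n%:R * dy) ^+ 2.
Proof.
move=> dx0 dy0 e0 hu hv hK.
pose W := n%:R * dx; pose H := n%:R * dy.
have W0 : 0 <= W by rewrite mulr_ge0.
have H0 : 0 <= H by rewrite mulr_ge0.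
pose E x' y' := K x' y' - K u v - D * ((x' - u) +i* (y' - v)).
have hE x' y' : x <= x' <= x + W -> y <= y' <= y + H ->
    cmod (E x' y') <= e * (W + H).
  move=> hx hy; apply: (le_trans (hK _ _ hx hy)); rewrite ler_wpM2l//.
  move: hu hv hx hy; rewrite -/W -/H => hu hv hx hy.
  by rewrite lerD// ler_norml; apply/andP; split; lra.
have hk k : (k < n)%N -> 0 <= k%:R * dx <= W /\ 0 <= k%:R * dy <= H.
  by move=> kn; rewrite !mulr_ge0//= !ler_wpM2r// ler_nat ltnW.
have hVs : Vs dy (x + W) y n - Vs dy x y n =
   n%:R * (D * W%:C) + \sum_(0 <= k < n) (E (x + W) (y + k%:R * dy) - E x (y + k%:R * dy)).
  rewrite -sumrB mulr_natl -[in n in _ *+ n](subn0 n) -sumr_const_nat -big_split.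
  apply: eq_bigr => k _ /=; rewrite /E !complexDi !rmorphB !rmorphD /=; ring.
have hHs : Hs dx x (y + H) n - Hs dx x y n =
   n%:R * (D * ('i * H%:C)) + \sum_(0 <= k < n) (E (x + k%:R * dx) (y + H) - E (x + k%:R * dx) y).
  rewrite -sumrB mulr_natl -[in n in _ *+ n](subn0 n) -sumr_const_nat -big_split.
  apply: eq_bigr => k _ /=; rewrite /E !complexDi !rmorphB !rmorphD /=; ring.
rewrite /boundary_sum -/W -/H hVs hHs.
set S1 := \sum_(0 <= k < n) _; set S2 := \sum_(0 <= k < n) _.
have -> : 'i * dy%:C * (n%:R * (D * W%:C) + S1) - dx%:C * (n%:R * (D * ('i * H%:C)) + S2)
   = 'i * dy%:C * S1 - dx%:C * S2.
  rewrite /W /H !rmorphM /= !rmorph_nat; ring.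
have hS (F : nat -> R[i]) : (forall k, (k < n)%N -> cmod (F k) <= 2 * (e * (W + H))) ->
    cmod (\sum_(0 <= k < n) F k) <= n%:R * (2 * (e * (W + H))).
  move=> hF; rewrite big_mkord (le_trans (cmod_sum _ _ _))//.
  rewrite mulr_natl -[X in _ *+ X]card_ord -sumr_const.
  by apply: ler_sum => i _; exact: hF.
have hS1 : cmod S1 <= n%:R * (2 * (e * (W + H))).
  apply: hS => k kn; rewrite (le_trans (cmodD _ _))// cmodN mulr2n mulrDl mul1r.
  have [_ /andP[k1 k2]] := hk _ kn.
  by rewrite lerD// hE// ?lexx ?lerDl ?lerD2l ?W0 ?k1 ?k2.
have hS2 : cmod S2 <= n%:R * (2 * (e * (W + H))).
  apply: hS => k kn; rewrite (le_trans (cmodD _ _))// cmodN mulr2n mulrDl mul1r.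
  have [/andP[k1 k2] _] := hk _ kn.
  by rewrite lerD// hE// ?lexx ?lerDl ?lerD2l ?H0 ?k1 ?k2.
rewrite (le_trans (cmodD _ _))// cmodN !cmodM cmodi mul1r !cmodR !ger0_norm//.
rewrite (le_trans (lerD (ler_wpM2l dy0 hS1) (ler_wpM2l dx0 hS2)))//.
by rewrite le_eqVlt /W /H; apply/orP; left; apply/eqP; ring.
Qed.

Hypothesis Kdiff : forall u v, exists D, pderiv u v D.

Lemma boundary_sum_small W H x y e : 0 <= W -> 0 <= H -> 0 < e ->
  exists l0, forall l, (l0 <= l)%N ->
    cmod (boundary_sum x y (W / 2 ^+ l) (H / 2 ^+ l) (2 ^ l)) <=
      e * (W + H) ^+ 2.
Proof.
move=> W0 H0 e0.
(* The bound scales like an area, so four quarters add up to exactly the bound of the whole. The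
   mesh depends on m + l only, which makes sums over the quarters compatible. *)
pose P x y m := exists l0, forall l, (l0 <= l)%N ->
  cmod (boundary_sum x y (W / 2 ^+ (m + l)) (H / 2 ^+ (m + l)) (2 ^ l)) <=
      e * ((W + H) / 2 ^+ m) ^+ 2.
suff [l0 hl0] : P x y 0%N.
  by exists l0 => l ll0; have := hl0 l ll0; rewrite add0n expr0 divr1.
have e2 m l (w : R) : (2 ^ l)%:R * (w / 2 ^+ (m + l)) = w / 2 ^+ m.
  by rewrite natrX exprD invfM mulrCA; congr (w * _); rewrite mulrCA mulfV ?mulr1 ?expf_neq0.
apply: (@rect_bisection R W H P) => //.
  move=> {}x {}y m [l1 h1] [l2 h2] [l3 h3] [l4 h4].
  (* At equal mesh a side of a quarter carries half as many nodes, so the threshold for the whole is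
     one above those of the quarters. *)
  exists (maxn (maxn l1 l2) (maxn l3 l4)).+1 => -[//|l].
  rewrite ltnS !geq_max => /andP[/andP[k1 k2] /andP[k3 k4]].
  have := h1 l k1; have := h2 l k2; have := h3 l k3; have := h4 l k4.
  rewrite expnS mul2n -addnn boundary_sum_split addnS -addSn !e2.
  move=> b4 b3 b2 b1; have -> : e * ((W + H) / 2 ^+ m) ^+ 2 =
    e * ((W + H) / 2 ^+ m.+1) ^+ 2 + e * ((W + H) / 2 ^+ m.+1) ^+ 2 +
    e * ((W + H) / 2 ^+ m.+1) ^+ 2 + e * ((W + H) / 2 ^+ m.+1) ^+ 2.
    by rewrite [2 ^+ m.+1]exprS; field; rewrite expf_neq0.
  rewrite (le_trans (cmodD _ _))// lerD// (le_trans (cmodD _ _))// lerD//.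
  by rewrite (le_trans (cmodD _ _))// lerD.
move=> u v; have [D hD] := Kdiff u v.
have [d d0 hd] := hD (e / 2) (divr_gt0 e0 (ltr0Sn _ _)).
have [M hM] : exists M, forall m, (M <= m)%N -> (W + H) / 2 ^+ m < d.
  have [M hM] : exists M : nat, (W + H) / d < M%:R.
    by exists (Num.truncn ((W + H) / d)).+1; exact: truncnS_gt.
  exists M => m Mm; rewrite ltr_pdivrMr ?exprn_gt0//.
  rewrite mulrC -ltr_pdivrMr// (lt_le_trans hM)// -natrX ler_nat.
  by rewrite (leq_trans Mm)// ltnW// ltn_expl.
exists M => {}x {}y m Mm hx hy; exists 0%N => l _.
have -> : e * ((W + H) / 2 ^+ m) ^+ 2 = 2 * (e / 2) *
   ((2 ^ l)%:R * (W / 2 ^+ (m + l)) + (2 ^ l)%:R * (H / 2 ^+ (m + l))) ^+ 2.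
  by rewrite !e2; field; rewrite expf_neq0.
apply: (@boundary_sum_le _ _ _ _ _ u v D); rewrite ?e2 ?divr_ge0 ?exprn_ge0 ?(ltW e0)//.
have := hM _ Mm; rewrite mulrDl => hWH.
have Wm : 0 <= W / 2 ^+ m by rewrite divr_ge0// exprn_ge0.
have Hm : 0 <= H / 2 ^+ m by rewrite divr_ge0// exprn_ge0.
move=> x' y' hx' hy'.
have := hd (x' - u) (y' - v); rewrite ![u + _]addrC ![v + _]addrC !subrK; apply.
  by rewrite ltr_norml; apply/andP; split; lra.
by rewrite ltr_norml; apply/andP; split; lra.
Qed.

(** Over a full period the two horizontal sides cancel; dividing the boundary sum by i H leaves the
    difference of the averages over the vertical sides. *)
Lemma periodic_vertical_sum H W x e : 0 < H -> 0 <= W -> 0 < e ->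
  (forall x y, K x (y + H) = K x y) ->
  exists l0, forall l, (l0 <= l)%N ->
    cmod ((2 ^+ l)^-1%:C * \sum_(k < 2 ^ l)
      (K (x + W) (k%:R * (H / 2 ^+ l)) - K x (k%:R * (H / 2 ^+ l)))) <= e.
Proof.
move=> H0 W0 e0 hper.
have WH0 : 0 < (W + H) ^+ 2 by rewrite exprn_gt0// ltr_wpDl.
have [l0 hl0] := @boundary_sum_small W H x 0 (e * H / (W + H) ^+ 2) W0 (ltW H0)
  (divr_gt0 (mulr_gt0 e0 H0) WH0).
exists l0 => l /hl0; rewrite divfK ?gt_eqF//.
rewrite /boundary_sum natrX ![2 ^+ l * _]mulrC !divfK ?expf_neq0//.
have -> : Hs (W / 2 ^+ l) x (0 + H) (2 ^ l) = Hs (W / 2 ^+ l) x 0 (2 ^ l).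
  by apply: eq_bigr => k _; rewrite hper.
rewrite subrr mulr0 subr0 /Vs !big_mkord -sumrB.
under eq_bigr do rewrite !add0r.
rewrite !cmodM cmodi mul1r !cmodR !ger0_norm ?invr_ge0 ?divr_ge0 ?exprn_ge0// ?(ltW H0)//.
by rewrite -mulrA [e * H]mulrC ler_pM2l.
Qed.

End Goursat.

(** * Mean values and the maximum principle *)

Section MeanValue.
Variable R : realType.

Lemma cmod_sum_le n (F : 'I_n -> R[i]) c : (forall k, cmod (F k) <= c) ->
  cmod (\sum_(k < n) F k) <= n%:R * c.
Proof.
move=> hF; rewrite (le_trans (cmod_sum _ _ _))// mulr_natl.
rewrite -[in leRHS](card_ord n) -sumr_const.
by apply: ler_sum => k _.
Qed.

Lemma is_derive_eps (f : R -> R) (x l e : R) : is_derive x 1 f l -> 0 < e ->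
  exists2 d : R, 0 < d & forall h : R, `|h| < d ->
    `|f (x + h) - f x - l * h| <= e * `|h|.
Proof.
move=> [df dfl] e0.
have /cvgrPdist_le/(_ e e0) : (fun h : R => h^-1 *: (f (h *: (1 : R) + x) - f x))
    @ 0^' --> l by rewrite -dfl; exact: df.
rewrite near_withinE => /nbhs_ballP[d /= d0 hd]; exists d => // h hdh.
have [->|h0] := eqVneq h 0; first by rewrite addr0 subrr mulr0 subr0 normr0 mulr0.
have hb : ball (0 : R) d h by rewrite -ball_normE /= sub0r normrN.
have := hd h hb h0; rewrite /GRing.scale /= mulr1 [h + x]addrC => he.
have -> : f (x + h) - f x - l * h = - ((l - h^-1 * (f (x + h) - f x)) * h).
  by field.
by rewrite normrN normrM ler_wpM2r.
Qed.

Lemma expi_eps (e : R) : 0 < e ->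
  exists2 d : R, 0 < d & forall a b : R, `|a| < d -> `|b| < d ->
    cmod ((expR a)%:C * cis b - 1 - (a +i* b)) <= e * (`|a| + `|b|).
Proof.
move=> e0.
(* The three terms of the decomposition below cost e' |a|, 4 e' |b| and e' |b|: the sine and cosine
   remainders count once each, and |1 + a| is at most 2. *)
pose e' := Num.min 1 (e / 5).
have e'0 : 0 < e' by rewrite lt_min ltr01 divr_gt0.
have e'1 : e' <= 1 by rewrite ge_min lexx.
have e'e : 5 * e' <= e by rewrite mulrC -ler_pdivlMr// ge_min lexx orbT.
clearbody e'.
have [d1 d10 h1] := is_derive_eps (is_derive_expR (0 : R)) e'0.
have [d2 d20 h2] := is_derive_eps (is_derive_cos (0 : R)) e'0.
have [d3 d30 h3] := is_derive_eps (is_derive_sin (0 : R)) e'0.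
exists (Num.min (Num.min d1 e') (Num.min d2 d3)).
  by rewrite !lt_min d10 e'0 d20 d30.
move=> a b; rewrite !lt_min => /andP[/andP[a1 ae] _] /andP[_ /andP[b2 b3]].
have := h1 a a1; have := h2 b b2; have := h3 b b3.
rewrite !add0r expR0 sin0 cos0 oppr0 !(mul0r, subr0, addr0, mul1r) => k3 k2 k1.
have kc : cmod (cis b - 1 - 'i * b%:C) <= 2 * e' * `|b|.
  have -> : cis b - 1 - 'i * b%:C = (cos b - 1) +i* (sin b - b).
    by rewrite /cis; apply/eqP; rewrite eq_complex /=; apply/andP; split;
      apply/eqP; ring.
  rewrite (le_trans (cmod_le_ReIm _))//=.
  by rewrite -mulrA mulr2n mulrDl mul1r lerD.
have -> : (expR a)%:C * cis b - 1 - (a +i* b) = (expR a - 1 - a)%:C * cis b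
   + (1 + a)%:C * (cis b - 1 - 'i * b%:C) + (a * b)%:C * 'i.
  by rewrite complexDi !rmorphB !rmorphD !rmorphM /= rmorph1; ring.
rewrite (le_trans (cmodD _ _))// (le_trans (lerD (cmodD _ _) (lexx _)))//.
rewrite !cmodM cmod_cis cmodi !mulr1 !cmodR.
have a0 := normr_ge0 a; have b0 := normr_ge0 b.
have t1 : `|1 + a| * cmod (cis b - 1 - 'i * b%:C) <= 2 * (2 * e' * `|b|).
  apply: ler_pM => //; first exact: cmod_ge0.
  by rewrite (le_trans (ler_normD _ _))// normr1; lra.
have t2 : `|a * b| <= e' * `|b| by rewrite normrM ler_wpM2r// ltW.
apply: (le_trans (lerD (lerD k1 t1) t2)).
have t3 : e' * `|a| <= 5 * e' * `|a| by rewrite ler_wpM2r//; lra.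
have t4 : 5 * e' * (`|a| + `|b|) <= e * (`|a| + `|b|).
  by rewrite ler_wpM2r// addr_ge0.
by apply: le_trans t4; lra.
Qed.

(* In the coordinate z = e^(u + iv) an entire function is periodic in v, so
   Goursat's lemma compares its vertical Riemann sums. *)
Lemma logpolar_pderiv (G : R[i]^o -> R[i]^o) u v : entire G ->
  exists D, pderiv (fun x y => G ((expR x)%:C * cis y)) u v D.
Proof.
move=> hG; set w := (expR u)%:C * cis v.
have [D hD] := (derivable_cderiv G w).1 (hG w).
exists (D * w) => e e0.
have w0 : 0 <= cmod w := cmod_ge0 w; have D0 : 0 <= cmod D := cmod_ge0 D.
(* [e1] and [e2] share e between the two errors of the chain rule: that of G at an increment of size
   at most 2 |w| s, with s = |a| + |b|, and that of the exponential multiplied by |D| |w|. *)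
pose e1 := e / (2 * (2 * cmod w + 1)).
have e10 : 0 < e1 by rewrite divr_gt0// mulr_gt0// ltr_wpDl// mulr_ge0.
pose e2 := Num.min 1 (e / (2 * (cmod D * cmod w + 1))).
have e20 : 0 < e2 by rewrite lt_min ltr01 divr_gt0// mulr_gt0// ltr_wpDl// mulr_ge0.
have [d1 d10 h1] := hD e1 e10.
have [d2 d20 h2] := expi_eps e20.
exists (Num.min d2 (d1 / (4 * (cmod w + 1)))).
  by rewrite lt_min d20 divr_gt0// mulr_gt0// ltr_wpDl.
move=> a b; rewrite !lt_min => /andP[a2 a1] /andP[b2 b1].
have hab := h2 a b a2 b2.
have a0 := normr_ge0 a; have b0 := normr_ge0 b.
set s := `|a| + `|b| in hab *.
have s0 : 0 <= s by rewrite addr_ge0.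
pose h := w * ((expR a)%:C * cis b - 1).
have ehw : (expR (u + a))%:C * cis (v + b) = w + h.
  by rewrite expRD cisD rmorphM /= /h /w; ring.
have hq : cmod ((expR a)%:C * cis b - 1) <= 2 * s.
  rewrite -[X in cmod X](subrK (a +i* b)) (le_trans (cmodD _ _))//.
  have : cmod (a +i* b) <= s by exact: (cmod_le_ReIm (a +i* b)).
  have : e2 * s <= s by rewrite ler_piMl// ge_min lexx.
  by lra.
have hh : cmod h <= 2 * cmod w * s.
  by rewrite cmodM -mulrA [2 * _]mulrCA ler_wpM2l.
have hd1 : cmod h < d1.
  have : s < d1 / (2 * (cmod w + 1)).
    have -> : d1 / (2 * (cmod w + 1)) = d1 / (4 * (cmod w + 1)) + d1 / (4 * (cmod w + 1)).
      by field; rewrite gt_eqF// ltr_wpDl.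
    exact: ltrD.
  rewrite ltr_pdivlMr ?mulr_gt0// ?ltr_wpDl// => hs; apply: le_lt_trans hs.
  by apply: (le_trans hh); rewrite mulrC ler_wpM2l// ler_wpM2l// lerDl.
rewrite ehw.
have -> : G (w + h) - G w - D * w * (a +i* b) = (G (w + h) - G w - D * h) +
    D * w * ((expR a)%:C * cis b - 1 - (a +i* b)).
  by rewrite /h; ring.
rewrite (le_trans (cmodD _ _))// [cmod (D * w * _)]cmodM [cmod (D * w)]cmodM.
have t1 : cmod (G (w + h) - G w - D * h) <= e / 2 * s.
  apply: (le_trans (h1 _ hd1)); apply: (le_trans (ler_wpM2l (ltW e10) hh)).
  rewrite mulrA ler_wpM2r//.
  have -> : e / 2 = e1 * (2 * cmod w + 1).
    by rewrite /e1; field; rewrite gt_eqF// ltr_wpDl// mulr_ge0.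
  by rewrite ler_wpM2l ?(ltW e10)// lerDl.
have t2 : cmod D * cmod w * cmod ((expR a)%:C * cis b - 1 - (a +i* b)) <= e / 2 * s.
  apply: (le_trans (ler_wpM2l (mulr_ge0 D0 w0) hab)).
  rewrite mulrA ler_wpM2r//.
  have Dw : 0 <= cmod D * cmod w by rewrite mulr_ge0.
  have -> : e / 2 = (cmod D * cmod w + 1) * (e / (2 * (cmod D * cmod w + 1))).
    by field; rewrite gt_eqF// ltr_wpDl.
  apply: ler_pM => //; first exact: ltW.
    by rewrite lerDl.
  by rewrite ge_min lexx orbT.
apply: (le_trans (lerD t1 t2)); lra.
Qed.

(** Goursat's lemma compares the averages over the unit circle and over a circle of radius e^(- W),
    so small that G is there within e / 2 of G 0. *)
Lemma mean_roots_of_unity (G : R[i]^o -> R[i]^o) e : entire G -> 0 < e ->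
  exists l0, forall l, (l0 <= l)%N ->
    cmod ((2 ^+ l)^-1%:C * (\sum_(k < 2 ^ l) G (cis (k%:R * (2 * pi / 2 ^+ l)))) - G 0)
      <= e.
Proof.
move=> hG e0.
have e20 : 0 < e / 2 by rewrite divr_gt0.
have [d d0 hd] := entire_ccontinuous 0 hG e20.
have [W W0 hW] : exists2 W, 0 <= W & expR (- W) < d.
  exists (Num.max 0 (1 - ln d)); first by rewrite le_max lexx.
  rewrite -[ltRHS]lnK ?posrE// ltr_expR ltrNl lt_max; apply/orP; right; lra.
have H0 : 0 < 2 * pi :> R by rewrite mulr_gt0// pi_gt0.
have hper x y : G ((expR x)%:C * cis (y + 2 * pi)) = G ((expR x)%:C * cis y).
  by rewrite cisD cis2pi mulr1.
have [l0 hl0] := periodic_vertical_sum (fun u v => logpolar_pderiv u v hG)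
  (- W) H0 W0 e20 hper.
exists l0 => l /hl0; rewrite addNr expR0.
under eq_bigr do rewrite mul1r.
rewrite sumrB; set S := \sum_(k < _) _; set T := \sum_(k < _) _.
move=> h1.
have P0 : (2 ^+ l : R) != 0 by rewrite expf_neq0.
have sG0 : (2 ^+ l)^-1%:C * (\sum_(k < 2 ^ l) G 0) = G 0.
  rewrite sumr_const card_ord -[G 0 *+ _]mulr_natl natrX mulrA.
  have -> : 2 ^+ l = (2 ^+ l)%:C :> R[i] by rewrite rmorphXn /= rmorph_nat.
  by rewrite -rmorphM mulVf// rmorph1 mul1r.
have h2 : cmod ((2 ^+ l)^-1%:C * T - G 0) <= e / 2.
  rewrite -{1}sG0 -mulrBr -sumrB cmodM cmodR ger0_norm ?invr_ge0 ?exprn_ge0//.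
  rewrite ler_pdivrMl ?exprn_gt0// -natrX.
  apply: cmod_sum_le => k; apply/ltW/hd.
  by rewrite subr0 cmodM cmod_cis mulr1 cmodR ger0_norm ?expR_ge0.
have -> : (2 ^+ l)^-1%:C * S - G 0 =
   (2 ^+ l)^-1%:C * (S - T) + ((2 ^+ l)^-1%:C * T - G 0) by ring.
by rewrite (le_trans (cmodD _ _))// [leRHS]splitr lerD.
Qed.

(** If |G| were at most |G 0| - e on the whole circle, so would its averages over equispaced points,
    yet these come within e / 2 of G 0. The loss e takes the place of a compactness argument for the
    maximum. *)
Lemma maximum_principle (G : R[i]^o -> R[i]^o) e : entire G -> 0 < e ->
  exists2 t, 0 <= t & cmod (G 0) - e < cmod (G (cis t)).
Proof.
move=> hG e0; apply: contrapT => hn.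
have [l0 hl0] := mean_roots_of_unity hG (divr_gt0 e0 (ltr0Sn _ 1)).
have := hl0 l0 (leqnn _); set S := \sum_(k < _) _ => hS.
have P0 : (0 < 2 ^+ l0 :> R) by rewrite exprn_gt0.
have : cmod ((2 ^+ l0)^-1%:C * S) <= cmod (G 0) - e.
  rewrite cmodM cmodR ger0_norm ?invr_ge0 ?(ltW P0)//.
  rewrite ler_pdivrMl// -natrX.
  by apply: cmod_sum_le => k; rewrite leNgt; apply/negP => hk; apply: hn;
    exists (k%:R * (2 * pi / 2 ^+ l0)) => //;
    rewrite mulr_ge0// divr_ge0// ?mulr_ge0 ?pi_ge0// exprn_ge0.
have := cmod_leB (G 0) ((2 ^+ l0)^-1%:C * S); rewrite cmodB.
by move: hS; lra.
Qed.

End MeanValue.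

Section AngularApproximation.
Variable R : realType.

Lemma cmod_cis_sub1 (t : R) : 0 <= t -> cmod (cis t - 1) <= 2 * t.
Proof.
move=> t0.
have hc : `|cos t - 1| <= t.
  have [c _] := MVT_segment t0 (fun x _ => is_derive_cos x)
    (continuous_subspaceT (@continuous_cos R)).
  rewrite cos0 subr0 => ->.
  by rewrite normrM normrN (ger0_norm t0) ler_piMl// sin_max.
have hs : `|sin t| <= t.
  have [c _] := MVT_segment t0 (fun x _ => is_derive_sin x)
    (continuous_subspaceT (@continuous_sin R)).
  rewrite sin0 !subr0 => ->.
  by rewrite normrM (ger0_norm t0) ler_piMl// cos_max.
have -> : cis t - 1 = (cos t - 1) +i* sin t.
  by rewrite /cis; apply/eqP; rewrite eq_complex /= subr0 !eqxx.
by rewrite (le_trans (cmod_le_ReIm _))//= mulr2n mulrDl mul1r lerD.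
Qed.

Definition unity_root (N : nat) : R[i] := cis (2 * pi / N%:R).

Lemma unity_root_expr N : (0 < N)%N -> unity_root N ^+ N = 1.
Proof.
move=> N0; rewrite /unity_root -cisMn mulrC divfK ?cis2pi//.
by rewrite pnatr_eq0 -lt0n.
Qed.

Lemma cmod_unity_root N k : cmod (unity_root N ^+ k) = 1.
Proof. by rewrite cmodX cmod_cis expr1n. Qed.

Lemma cis_factor N (t : R) : (0 < N)%N -> 0 <= t ->
  exists m t', [/\ cis t = unity_root N ^+ m * cis t', 0 <= t' & t' <= 2 * pi / N%:R].
Proof.
move=> N0 t0; set a := 2 * pi / N%:R.
have a0 : 0 < a by rewrite divr_gt0 ?mulr_gt0 ?pi_gt0// ltr0n.
have ta : 0 <= t / a by rewrite divr_ge0// ltW.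
have /andP[h1 h2] := truncn_itv ta.
exists (Num.truncn (t / a)), (t - (Num.truncn (t / a))%:R * a); split.
- by rewrite -cisMn -cisD addrC subrK.
- by rewrite subr_ge0 -ler_pdivlMr.
- move: h2; rewrite ltr_pdivrMr// -natr1 mulrDl mul1r; lra.
Qed.

Lemma sum_unity_root_shift N m (psi : R[i] -> R) : (0 < N)%N ->
  \sum_(k < N) psi (unity_root N ^+ k * unity_root N ^+ m) =
  \sum_(k < N) psi (unity_root N ^+ k).
Proof.
move=> N0; elim: m => [|m IH]; first by under eq_bigr do rewrite expr0 mulr1.
rewrite -IH; case: N N0 IH => // N _ _.
rewrite big_ord_recr [RHS]big_ord_recl /= [LHS]addrC; congr (_ + _).
  by rewrite expr0 mul1r exprSr mulrCA -exprSr unity_root_expr// mulr1.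
by apply: eq_bigr => k _; rewrite /bump /= add1n exprSr mulrCA -exprSr mulrC.
Qed.

End AngularApproximation.

Section UniformContinuity.
Variable R : realType.

(** Bisection of the square of side 2 r. Only z is confined to the square, so moduli of continuity
    of the quarters are glued by taking their minimum. *)
Lemma uniform_continuity (psi : R[i] -> R) (r e : R) : 0 <= r -> 0 < e ->
  (forall (z : R[i]) (e' : R), 0 < e' -> exists2 d : R, 0 < d &
     forall w : R[i], cmod (w - z) < d -> `|psi w - psi z| < e') ->
  exists2 d : R, 0 < d & forall z w : R[i], cmod z <= r -> cmod (w - z) < d ->
    `|psi w - psi z| <= e.
Proof.
move=> r0 e0 hpsi.
pose W := 2 * r.
have W0 : 0 <= W by rewrite mulr_ge0.
pose P (x y : R) m := exists2 d : R, 0 < d & forall (a b : R) (w : R[i]),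
  x <= a <= x + W / 2 ^+ m -> y <= b <= y + W / 2 ^+ m ->
  cmod (w - (a +i* b)) < d -> `|psi w - psi (a +i* b)| <= e.
suff [d d0 hd] : P (- r) (- r) 0%N.
  exists d => // z w zr zw; case: z zr zw => a b zr zw.
  have := Re_le_cmod (a +i* b); have := Im_le_cmod (a +i* b) => /= hb ha.
  have /ler_normlP[a1 a2] := le_trans ha zr.
  have /ler_normlP[b1 b2] := le_trans hb zr.
  by apply: (hd a b w _ _ zw); rewrite expr0 divr1 /W; apply/andP; split; lra.
apply: (@rect_bisection R W W P) => //.
  move=> x y m [d1 d10 h1] [d2 d20 h2] [d3 d30 h3] [d4 d40 h4].
  exists (Num.min (Num.min d1 d2) (Num.min d3 d4)).
    by rewrite !lt_min d10 d20 d30 d40.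
  move=> a b w /andP[a1 a2] /andP[b1 b2].
  rewrite !lt_min => /andP[/andP[k1 k2] /andP[k3 k4]].
  have eW : W / 2 ^+ m = W / 2 ^+ m.+1 + W / 2 ^+ m.+1.
    by rewrite [2 ^+ m.+1]exprS; field; rewrite expf_neq0.
  rewrite eW in a2 b2.
  have [ax|ax] := leP a (x + W / 2 ^+ m.+1); have [bx|bx] := leP b (y + W / 2 ^+ m.+1).
  - by apply: h1 => //; apply/andP; split; lra.
  - by apply: h3 => //; apply/andP; split; lra.
  - by apply: h2 => //; apply/andP; split; lra.
  - by apply: h4 => //; apply/andP; split; lra.
move=> u v.
have [d d0 hd] := hpsi (u +i* v) (e / 2) (divr_gt0 e0 (ltr0Sn _ _)).
have [M hM] : exists M, forall m, (M <= m)%N -> W / 2 ^+ m < d / 4.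
  have [M hM] : exists M : nat, W / (d / 4) < M%:R.
    by exists (Num.truncn (W / (d / 4))).+1; exact: truncnS_gt.
  exists M => m Mm; rewrite ltr_pdivrMr ?exprn_gt0//.
  rewrite mulrC -ltr_pdivrMr ?divr_gt0// (lt_le_trans hM)// -natrX ler_nat.
  by rewrite (leq_trans Mm)// ltnW// ltn_expl.
exists M => x y m Mm /andP[u1 u2] /andP[v1 v2].
have hm := hM _ Mm.
exists (d / 2); first by rewrite divr_gt0.
move=> a b w /andP[a1 a2] /andP[b1 b2] hw.
have hab : cmod ((a +i* b) - (u +i* v)) < d / 2.
  apply: le_lt_trans (cmod_le_ReIm _) _ => /=.
  have : `|a - u| < d / 4 by rewrite ltr_norml; apply/andP; split; lra.
  have : `|b - v| < d / 4 by rewrite ltr_norml; apply/andP; split; lra.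
  lra.
have k1 : `|psi (a +i* b) - psi (u +i* v)| < e / 2 by apply: hd; lra.
have k2 : `|psi w - psi (u +i* v)| < e / 2.
  by apply: hd; apply: (le_lt_trans (cmod_dist_trans _ (a +i* b) _)); lra.
rewrite -(subrK (psi (u +i* v)) (psi w)) -addrA.
by rewrite (le_trans (ler_normD _ _))// [`|psi (u +i* v) - _|]distrC; lra.
Qed.

(** The point 0 is apart: the power need not be derivable there when q < 1, and the modulus is found
    by inverting the power. *)
Lemma powR_continuous_ge0 (q x e : R) : 0 < q -> 0 <= x -> 0 < e ->
  exists2 d : R, 0 < d & forall y : R, 0 <= y -> `|y - x| < d -> `|y `^ q - x `^ q| < e.
Proof.
move=> q0; rewrite le_eqVlt => /orP[/eqP <-|x0] e0.
  exists (e `^ q^-1); first exact: powR_gt0.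
  move=> y y0; rewrite powR0 ?gt_eqF// !subr0 (ger0_norm y0) ger0_norm ?powR_ge0//.
  move=> hy; rewrite -[ltRHS]powRr1 ?(ltW e0)// -(@mulVf _ q) ?gt_eqF// powRrM.
  by apply: gt0_ltr_powR; rewrite ?nnegrE ?powR_ge0.
have /derivable1_diffP/differentiable_continuous : derivable (@powR R ^~ q) x 1.
  by apply: derivable_powR; rewrite in_itv /= x0.
move=> /cvgrPdist_lt/(_ e e0)/nbhs_ballP[d /= d0 hd]; exists d => // y y0 hy.
have := hd y; rewrite -ball_normE /= distrC => /(_ hy).
by rewrite distrC.
Qed.

End UniformContinuity.

Section CircleMean.
Variable R : realType.

Lemma powR_prod n (F : 'I_n -> R) (q : R) : (forall k, 0 <= F k) ->
  (\prod_(k < n) F k) `^ q = \prod_(k < n) F k `^ q.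
Proof.
elim: n F => [|n IH] F F0; first by rewrite !big_ord0 powR1.
by rewrite !big_ord_recl powRM ?IH ?prodr_ge0.
Qed.

(* A discrete Jensen inequality: the maximum principle for the product of the
   rotates of H, together with the arithmetic-geometric inequality. *)
Lemma circle_mean_ge (H : R[i]^o -> R[i]^o) (q r : R) : entire H -> 0 < q ->
  0 <= r -> H 0 != 0 ->
  exists2 N, (0 < N)%N & forall z, cmod z <= r ->
    N%:R * (cmod (H 0) `^ q / 2) <=
      \sum_(k < N) cmod (H (unity_root R N ^+ k * z)) `^ q.
Proof.
move=> hH q0 r0 H00.
pose psi z := cmod (H z) `^ q.
have h0 : 0 < cmod (H 0) by rewrite cmod_gt0.
pose A := cmod (H 0) `^ q.
have A0 : 0 < A by exact: powR_gt0.
have [d d0 hd] : exists2 d : R, 0 < d & forall z w : R[i], cmod z <= r -> cmod (w - z) < d ->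
    `|psi w - psi z| <= A / 4.
  apply: uniform_continuity => //; first by rewrite divr_gt0.
  move=> z e' e'0; have [d1 d10 h1] := powR_continuous_ge0 q0 (cmod_ge0 (H z)) e'0.
  have [d2 d20 h2] := entire_ccontinuous z hH d10.
  exists d2 => // w hw; apply: h1; first exact: cmod_ge0.
  exact: le_lt_trans (cmod_distB _ _) (h2 _ hw).
(* N is fixed before z, so that it is common to all circles of radius at most r. *)
have [N N0 hN] : exists2 N, (0 < N)%N & r * (2 * (2 * pi / N%:R)) < d.
  pose x := r * (2 * (2 * pi)) / d.
  exists (Num.truncn x).+1 => //.
  have -> : r * (2 * (2 * pi / (Num.truncn x).+1%:R)) =
    r * (2 * (2 * pi)) / (Num.truncn x).+1%:R by ring.
  by rewrite ltr_pdivrMr ?ltr0n// [d * _]mulrC -ltr_pdivrMr//; exact: truncnS_gt.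
exists N => // z zr.
pose w := unity_root R N.
pose G u := \prod_(k < N) H (w ^+ k * z * u).
have hG : entire G.
  apply: (@entire_prod _ N (fun k u => H (w ^+ k * z * u))) => k.
  exact: entire_scale.
have G0 : cmod (G 0) = cmod (H 0) ^+ N.
  rewrite /G cmod_prod; under eq_bigr do rewrite mulr0.
  by rewrite prodr_const card_ord.
(* Chosen so that (|H 0|^N eta)^q = (3 A / 4)^N. The maximum principle thus costs a quarter of A in
   the mean, the displacement by t' costs another, and A / 2 remains. *)
pose eta : R := (3 / 4) `^ (N%:R / q).
have eta1 : eta < 1.
  have <- : 1 `^ (N%:R / q) = 1 :> R by rewrite powR1.
  apply: gt0_ltr_powR; rewrite ?nnegrE ?divr_gt0 ?ltr0n//; lra.
have eta0 : 0 <= eta by exact: powR_ge0.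
have HN0 : 0 < cmod (H 0) ^+ N by rewrite exprn_gt0.
have e0 : 0 < cmod (H 0) ^+ N * (1 - eta) by rewrite mulr_gt0// subr_gt0.
have [t t0 ht] := maximum_principle hG e0.
rewrite G0 mulrBr mulr1 opprB addrC subrK in ht.
(* Nothing is known of the angle t, but a multiple of 2 pi / N only permutes the factors, and the
   remainder t' moves each point by less than d. *)
have [m [t' [et t'0 t'1]]] := cis_factor N0 t0.
have h1 : A / 4 * 3 <= N%:R^-1 * \sum_(k < N) psi (w ^+ k * z * cis t).
  have Nn0 : (N%:R : R) != 0 by rewrite pnatr_eq0 -lt0n.
  rewrite -(@ler_pXn2r _ N)// ?nnegrE; last 2 first.
  - by rewrite mulr_ge0// divr_ge0// ltW.
  - by rewrite mulr_ge0 ?invr_ge0// sumr_ge0// => k _; exact: powR_ge0.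
  have := (@leif_AGM _ _ [pred i : 'I_N | true] (fun k => psi (w ^+ k * z * cis t))
     (fun k _ => powR_ge0 _ _)).1.
  rewrite /= cardT size_enum_ord [X in (_ <= X ^+ _)]mulrC; apply: le_trans.
  have -> : \prod_(i < N) psi (w ^+ i * z * cis t) = cmod (G (cis t)) `^ q.
    by rewrite /G cmod_prod powR_prod// => k; exact: cmod_ge0.
  have -> : (A / 4 * 3) ^+ N = (cmod (H 0) ^+ N * eta) `^ q.
    rewrite powRM ?(ltW HN0)// /eta -powRrM divfK ?gt_eqF// powR_mulrn//.
    rewrite -[cmod (H 0) ^+ N]powR_mulrn ?(ltW h0)// powRAC powR_mulrn ?powR_ge0//.
    by rewrite -exprMn; congr (_ ^+ _); rewrite mulrAC mulrA.
  by apply: ge0_ler_powR; rewrite ?nnegrE ?(ltW q0) ?(ltW ht) ?cmod_ge0 ?mulr_ge0 ?(ltW HN0).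
have h2 : \sum_(k < N) psi (w ^+ k * z * cis t) = \sum_(k < N) psi (w ^+ k * z * cis t').
  rewrite et -(sum_unity_root_shift m (fun u => psi (u * z * cis t')) N0).
  by apply: eq_bigr => k _; congr psi; rewrite -/w; ring.
have h3 : \sum_(k < N) psi (w ^+ k * z * cis t') <=
    \sum_(k < N) psi (w ^+ k * z) + N%:R * (A / 4).
  have -> : N%:R * (A / 4) = \sum_(k < N) (A / 4).
    by rewrite sumr_const card_ord mulr_natl.
  rewrite -big_split /=.
  apply: ler_sum => k _.
  rewrite -lerBlDl; apply: (le_trans (ler_norm _)); apply: hd.
    by rewrite cmodM cmod_unity_root mul1r.
  apply: le_lt_trans hN.
  have -> : w ^+ k * z * cis t' - w ^+ k * z = w ^+ k * (z * (cis t' - 1)) by ring.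
  rewrite cmodM cmod_unity_root mul1r cmodM.
  apply: ler_pM; rewrite ?cmod_ge0//.
  by apply: (le_trans (cmod_cis_sub1 t'0)); rewrite ler_wpM2l.
have Nr0 : 0 < N%:R :> R by rewrite ltr0n.
rewrite h2 ler_pdivlMl// in h1.
have := le_trans h1 h3; rewrite -/A /psi -/w.
set S := \sum_(k < N) _; lra.
Qed.

End CircleMean.

(** * Entire functions as sums of polynomial series *)

Section ComplexLimits.
Variable R : realType.
Implicit Types (u : nat -> R[i]) (l : R[i]).

Definition clim u l := forall e : R, 0 < e ->
  exists N0, forall n, (N0 <= n)%N -> cmod (u n - l) <= e.

Definition clim_val u : R[i] := xget 0 [set l | clim u l].

Lemma clim_valP u l : clim u l -> clim u (clim_val u).
Proof. by move=> ul; rewrite /clim_val; case: xgetP => [_ -> //|/(_ l)]. Qed.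

Lemma clim_ext u v l : (exists N0, forall n, (N0 <= n)%N -> u n = v n) ->
  clim u l -> clim v l.
Proof.
move=> [N0 h] hu e e0; have [N1 hN1] := hu e e0.
exists (maxn N0 N1) => n; rewrite geq_max => /andP[n0 n1].
by rewrite -h// hN1.
Qed.

Lemma clim_cmod_le u l (B : R) : clim u l -> (forall n, cmod (u n) <= B) ->
  cmod l <= B.
Proof.
move=> ul uB; apply/ler_addgt0Pr => e e0; have [N hN] := ul e e0.
have := hN N (leqnn _); have := uB N; have := cmod_leB l (u N).
by rewrite cmodB; lra.
Qed.

Lemma clim_cmod_ge u l (b : R) N : clim u l ->
  (forall n, (N <= n)%N -> b <= cmod (u n)) -> b <= cmod l.
Proof.
move=> ul ub; apply/ler_addgt0Pr => e e0; have [N1 hN1] := ul e e0.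
have := hN1 _ (leq_maxl N1 N); have := ub _ (leq_maxr N1 N).
have := cmod_leB (u (maxn N1 N)) l; lra.
Qed.

Lemma clim_unique u l l' : clim u l -> clim u l' -> l = l'.
Proof.
move=> ul ul'; apply/eqP; rewrite -subr_eq0 -cmod_eq0 eq_le cmod_ge0 andbT.
apply/ler_addgt0Pr => e e0; rewrite add0r.
have e20 : 0 < e / 2 by rewrite divr_gt0.
have [N hN] := ul _ e20; have [N' hN'] := ul' _ e20.
have := hN _ (leq_maxl N N'); have := hN' _ (leq_maxr N N').
have := cmod_dist_trans l (u (maxn N N')) l'.
by rewrite (cmodB l (u _)); lra.
Qed.

Lemma climMl u l (a : R[i]) : clim u l -> clim (fun n => a * u n) (a * l).
Proof.
move=> ul e e0; have a0 : 0 < cmod a + 1 by rewrite ltr_wpDl ?cmod_ge0.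
have [N hN] := ul _ (divr_gt0 e0 a0); exists N => n /hN.
rewrite ler_pdivlMr// -mulrBr cmodM => h; apply: le_trans h.
by rewrite mulrC ler_wpM2l ?cmod_ge0// lerDl.
Qed.

Lemma climD u v l l' : clim u l -> clim v l' -> clim (fun n => u n + v n) (l + l').
Proof.
move=> ul vl e e0; have e20 : 0 < e / 2 by rewrite divr_gt0.
have [N hN] := ul _ e20; have [N' hN'] := vl _ e20.
exists (maxn N N') => n; rewrite geq_max => /andP[/hN h1 /hN' h2].
rewrite opprD addrACA (le_trans (cmodD _ _))//; lra.
Qed.

Lemma real_series_cvg (a v : nat -> R) : (forall n, `|a n| <= v n) ->
  (exists B : R, forall N, \sum_(n < N) v n <= B) ->
  exists l : R, forall e : R, 0 < e -> exists N0, forall N, (N0 <= N)%N ->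
    `|\sum_(n < N) a n - l| <= e.
Proof.
move=> av [B hB].
have v0 n : 0 <= v n by apply: le_trans (av n).
have cv : cvgn (series v).
  apply: nondecreasing_is_cvgn.
    by apply/nondecreasing_seqP => n; rewrite /series /= big_nat_recr//= lerDl.
  by exists B => _ [n _ <-]; rewrite /series /= big_mkord.
have cn : cvgn [normed series a].
  by apply: (series_le_cvg _ v0 av cv) => n; exact: normr_ge0.
have /cvg_ex[l /cvgrPdist_le hl] := normed_cvg cn.
exists l => e e0; have [N0 _ hN0] := hl e e0.
by exists N0 => N NN; have := hN0 N NN; rewrite /series /= big_mkord distrC.
Qed.

Lemma clim_series u (v : nat -> R) : (forall n, cmod (u n) <= v n) ->
  (exists B : R, forall N, \sum_(n < N) v n <= B) ->
  exists l, clim (fun N => \sum_(n < N) u n) l.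
Proof.
move=> uv hB.
have [l1 hl1] := real_series_cvg (fun n => le_trans (Re_le_cmod (u n)) (uv n)) hB.
have [l2 hl2] := real_series_cvg (fun n => le_trans (Im_le_cmod (u n)) (uv n)) hB.
exists (l1 +i* l2) => e e0; have e20 : 0 < e / 2 by rewrite divr_gt0.
have [N1 hN1] := hl1 _ e20; have [N2 hN2] := hl2 _ e20.
exists (maxn N1 N2) => N; rewrite geq_max => /andP[/hN1 h1 /hN2 h2].
apply: (le_trans (cmod_le_ReIm _)).
have -> : \sum_(n < N) u n - (l1 +i* l2) =
  (\sum_(n < N) complex.Re (u n) - l1) +i* (\sum_(n < N) complex.Im (u n) - l2).
  transitivity ((\sum_(n < N) complex.Re (u n)) +i* (\sum_(n < N) complex.Im (u n))
     - (l1 +i* l2)) => //; congr (_ - _).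
  elim: N {h1 h2} => [|N IH]; first by rewrite !big_ord0.
  by rewrite !big_ord_recr /= IH; case: (u N).
by move: h1 h2 => /=; lra.
Qed.

End ComplexLimits.

Section DominatedPolynomials.
Variable R : realType.
Implicit Types (p : {poly R[i]}) (q : {poly R}).

(** Majorants in Cauchy's sense: they are stable under products, and a single value of q bounds p,
    its derivative and its second-order remainder. *)
Definition dominated p q := forall i, cmod p`_i <= q`_i.

Lemma dominatedM p p' q q' : dominated p q -> dominated p' q' ->
  dominated (p * p') (q * q').
Proof.
move=> hp hp' i; rewrite !coefM (le_trans (cmod_sum _ _ _))//.
by apply: ler_sum => j _; rewrite cmodM ler_pM ?cmod_ge0.
Qed.

Lemma dominatedB p p' q q' : dominated p q -> dominated p' q' ->
  dominated (p - p') (q + q').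
Proof.
move=> hp hp' i; rewrite coefB coefD (le_trans (cmodD _ _))// cmodN.
exact: lerD.
Qed.

Lemma dominated_cst (a : R[i]) : dominated a%:P (cmod a)%:P.
Proof. by move=> i; rewrite !coefC; case: eqP => //; rewrite cmod0. Qed.

Lemma dominatedXn n : dominated 'X^n 'X^n.
Proof.
by move=> i; rewrite !coefXn; case: eqP; rewrite ?cmod1 ?cmod0.
Qed.

Lemma horner_common p q (z : R[i]) (x : R) n : (size p <= n)%N -> (size q <= n)%N ->
  p.[z] = \sum_(i < n) p`_i * z ^+ i /\ q.[x] = \sum_(i < n) q`_i * x ^+ i.
Proof. by move=> pn qn; split; exact: horner_coef_wide. Qed.

Lemma dominated_horner p q (z : R[i]) : dominated p q -> cmod p.[z] <= q.[cmod z].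
Proof.
move=> h; have [-> ->] := horner_common z (cmod z) (leq_maxl (size p) (size q))
  (leq_maxr _ _).
rewrite (le_trans (cmod_sum _ _ _))//; apply: ler_sum => i _.
by rewrite cmodM cmodX ler_wpM2r// exprn_ge0// cmod_ge0.
Qed.

(** A term of the binomial expansion of (x + 1)^k. It trades the derivative of a majorant for its
    value at a larger point. *)
Lemma mulrn_expr_le (x : R) k : 0 <= x -> k%:R * x ^+ k.-1 <= (x + 1) ^+ k.
Proof.
move=> x0; elim: k => [|k IH]; first by rewrite mul0r expr0.
case: k IH => [_|k IH]; first by rewrite expr0 mulr1 expr1 lerDr.
have -> : k.+2%:R * x ^+ k.+2.-1 = x * (k.+1%:R * x ^+ k) + x ^+ k.+1.
  by rewrite -[k.+2%:R]natr1 /= exprS; ring.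
rewrite [_ ^+ k.+2]exprS mulrDl mul1r lerD ?ler_wpM2l//.
by rewrite lerXn2r ?nnegrE ?addr_ge0// lerDl.
Qed.

Lemma deriv_horner_coef p (z : R[i]) :
  p^`().[z] = \sum_(i < size p) p`_i * (i%:R * z ^+ i.-1).
Proof.
rewrite -{1}(coefK p) poly_def raddf_sum horner_sum.
apply: eq_bigr => i _; rewrite /= derivZ hornerZ derivXn hornerMn hornerXn.
by rewrite mulr_natl.
Qed.

Lemma deriv_horner_coef_wide p (z : R[i]) n : (size p <= n)%N ->
  p^`().[z] = \sum_(i < n) p`_i * (i%:R * z ^+ i.-1).
Proof.
move=> pn; rewrite deriv_horner_coef.
rewrite (big_ord_widen n (fun i => p`_i * (i%:R * z ^+ i.-1)))// big_mkcond /=.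
apply: eq_bigr => i _; case: ltnP => // h; by rewrite nth_default ?mul0r.
Qed.

Lemma dominated_deriv p q (z : R[i]) : dominated p q ->
  cmod p^`().[z] <= q.[cmod z + 2].
Proof.
move=> h; set n := maxn (size p) (size q).
have [_ ->] := horner_common z (cmod z + 2) (leq_maxl (size p) (size q)) (leq_maxr _ _).
rewrite (@deriv_horner_coef_wide _ _ n) ?leq_maxl//.
have z0 := cmod_ge0 z.
rewrite (le_trans (cmod_sum _ _ _))//; apply: ler_sum => i _.
rewrite cmodM ler_pM ?cmod_ge0// cmodM cmodX -(rmorph_nat (real_complex R)) cmodR ger0_norm//.
rewrite (le_trans (mulrn_expr_le _ z0))//.
by rewrite lerXn2r ?nnegrE ?addr_ge0// lerD2l ler1n.
Qed.

(** The remainder for k + 1 is z + h times the one for k, plus k z^(k - 1) h^2. Of the new factor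
    |z| + 2, the part |z| + 1 pays for the first term and 1 for the second. *)
Lemma expr_taylor2 (z h : R[i]) k : cmod h <= 1 ->
  cmod ((z + h) ^+ k - z ^+ k - k%:R * z ^+ k.-1 * h) <= cmod h ^+ 2 * (cmod z + 2) ^+ k.
Proof.
move=> h1; have z0 := cmod_ge0 z; have h0 := cmod_ge0 h.
elim: k => [|k IH].
  by rewrite !expr0 subrr mul0r mul0r subr0 cmod0 mulr1 exprn_ge0.
set D := _ - _ - _ in IH.
have -> : (z + h) ^+ k.+1 - z ^+ k.+1 - k.+1%:R * z ^+ k.+1.-1 * h =
    (z + h) * D + k%:R * z ^+ k.-1 * h ^+ 2.
  rewrite /D; case: k {IH D} => [|k]; first by rewrite /= !expr0; ring.
  by rewrite /= !exprS -!natr1; ring.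
rewrite (le_trans (cmodD _ _))// !cmodM !cmodX -(rmorph_nat (real_complex R)) cmodR.
rewrite ger0_norm// [(cmod z + 2) ^+ k.+1]exprS [_ * cmod h ^+ 2]mulrC.
have -> : cmod h ^+ 2 * ((cmod z + 2) * (cmod z + 2) ^+ k) =
  (cmod z + 1) * (cmod h ^+ 2 * (cmod z + 2) ^+ k) + cmod h ^+ 2 * (cmod z + 2) ^+ k.
  by ring.
apply: lerD.
  by apply: ler_pM; rewrite ?cmod_ge0// (le_trans (cmodD _ _))// lerD2l.
rewrite ler_wpM2l ?exprn_ge0// (le_trans (mulrn_expr_le _ z0))//.
by rewrite lerXn2r ?nnegrE ?addr_ge0// lerD2l ler1n.
Qed.

Lemma dominated_taylor2 p q (z h : R[i]) : dominated p q -> cmod h <= 1 ->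
  cmod (p.[z + h] - p.[z] - p^`().[z] * h) <= cmod h ^+ 2 * q.[cmod z + 2].
Proof.
move=> hpq h1; set n := maxn (size p) (size q).
have pn : (size p <= n)%N by exact: leq_maxl.
have [_ ->] := horner_common z (cmod z + 2) pn (leq_maxr _ _).
rewrite (@deriv_horner_coef_wide _ _ n)// !(horner_coef_wide _ pn).
rewrite -sumrB mulr_suml -sumrB mulr_sumr (le_trans (cmod_sum _ _ _))//.
apply: ler_sum => i _.
have -> : p`_i * (z + h) ^+ i - p`_i * z ^+ i - p`_i * (i%:R * z ^+ i.-1) * h =
  p`_i * ((z + h) ^+ i - z ^+ i - i%:R * z ^+ i.-1 * h) by ring.
rewrite cmodM mulrCA ler_pM ?cmod_ge0//; exact: expr_taylor2.
Qed.

(* The uniform second-order Taylor estimate passes to the limit. *)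
Lemma entire_series (p : nat -> {poly R[i]}) (q : nat -> {poly R}) :
  (forall n, dominated (p n) (q n)) ->
  (forall x : R, 0 <= x -> exists B : R, forall N, \sum_(n < N) (q n).[x] <= B) ->
  (forall z, exists l, clim (fun N => \sum_(n < N) (p n).[z]) l) /\
  forall f : R[i]^o -> R[i]^o,
    (forall z, clim (fun N => \sum_(n < N) (p n).[z]) (f z)) -> entire f.
Proof.
move=> hpq hB; split=> [z|f hf z].
  exact: (clim_series (fun n => dominated_horner z (hpq n)) (hB _ (cmod_ge0 z))).
have z2 : 0 <= cmod z + 2 by rewrite addr_ge0// cmod_ge0.
have [B0 hB0] := hB _ z2.
pose B := Num.max 1 B0.
have B1 : 0 < B by rewrite lt_max ltr01.
have [D hD] : exists D, clim (fun N => \sum_(n < N) (p n)^`().[z]) D.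
  exact: (clim_series (fun n => dominated_deriv z (hpq n)) (hB _ z2)).
apply/derivable_cderiv; exists D => e e0.
exists (Num.min 1 (e / B)); first by rewrite lt_min ltr01 divr_gt0.
move=> h; rewrite lt_min => /andP[h1 he].
have h0 := cmod_ge0 h.
apply: (@le_trans _ _ (cmod h ^+ 2 * B)); last first.
  rewrite expr2 mulrC mulrA ler_wpM2r// mulrC -ler_pdivlMr//; exact: ltW.
apply: (@clim_cmod_le _ (fun N => (\sum_(n < N) (p n).[z + h]) +
  ((-1) * (\sum_(n < N) (p n).[z]) + (- h) * (\sum_(n < N) (p n)^`().[z])))).
  have -> : f (z + h) - f z - D * h = f (z + h) + ((-1) * f z + (- h) * D) by ring.
  by apply: climD; [exact: hf|apply: climD; apply: climMl; [exact: hf|exact: hD]].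
move=> N.
have -> : (\sum_(n < N) (p n).[z + h]) +
  ((-1) * (\sum_(n < N) (p n).[z]) + (- h) * (\sum_(n < N) (p n)^`().[z])) =
  \sum_(n < N) ((p n).[z + h] - (p n).[z] - (p n)^`().[z] * h).
  rewrite !sumrB -mulr_suml; ring.
rewrite (le_trans (cmod_sum _ _ _))//.
apply: (@le_trans _ _ (\sum_(n < N) cmod h ^+ 2 * (q n).[cmod z + 2])).
  by apply: ler_sum => n _; apply: dominated_taylor2 => //; exact: ltW.
rewrite -mulr_sumr ler_wpM2l ?exprn_ge0// (le_trans (hB0 N))//.
by rewrite le_max lexx orbT.
Qed.

End DominatedPolynomials.

(** * Canonical products *)

Section CanonicalProduct.
Variable R : realType.
Implicit Types (c : nat -> R) (k : nat -> nat).

Definition partial_prod c k N (z : R[i]) : R[i] :=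
  \prod_(j < N) (1 - (c j)%:C * z ^+ k j).

Definition canonical_prod c k (z : R[i]^o) : R[i]^o :=
  clim_val (fun N => partial_prod c k N z).

(** For nonnegative c this amounts to summability of c j x^(k j); the product form is the one that
    telescopes into majorants. *)
Definition prod_bounded c k := forall x : R, 0 <= x ->
  exists B : R, forall N, \prod_(j < N) (1 + c j * x ^+ k j) <= B.

Let term c k j : {poly R[i]} := 1 - ((c j)%:C)%:P * 'X^(k j).
Let termR c k j : {poly R} := 1 + (c j)%:P * 'X^(k j).
Let Pp c k N := \prod_(j < N) term c k j.
Let Mp c k N := \prod_(j < N) termR c k j.

Let horner_term c k j (z : R[i]) : (term c k j).[z] = 1 - (c j)%:C * z ^+ k j.
Proof. by rewrite /term !hornerE. Qed.

Let horner_Pp c k N (z : R[i]) : (Pp c k N).[z] = partial_prod c k N z.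
Proof.
rewrite horner_prod; apply: eq_bigr => j _; exact: horner_term.
Qed.

Let horner_Mp c k N (x : R) : (Mp c k N).[x] = \prod_(j < N) (1 + c j * x ^+ k j).
Proof. by rewrite horner_prod; apply: eq_bigr => j _; rewrite /termR !hornerE. Qed.

Let dominated_cX c k j : 0 <= c j ->
  dominated (((c j)%:C)%:P * 'X^(k j)) ((c j)%:P * 'X^(k j)).
Proof.
move=> cj; apply: dominatedM; last exact: dominatedXn.
by have := dominated_cst (c j)%:C; rewrite cmodR ger0_norm.
Qed.

Let dominated_term c k j : 0 <= c j -> dominated (term c k j) (termR c k j).
Proof.
move=> cj; apply: dominatedB; last exact: dominated_cX.
by have := dominated_cst (1 : R[i]); rewrite cmod1.
Qed.

Let dominated_Pp c k N : (forall j, 0 <= c j) -> dominated (Pp c k N) (Mp c k N).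
Proof.
move=> c0; elim: N => [|N IH].
  by rewrite /Pp /Mp !big_ord0; have := dominated_cst (1 : R[i]); rewrite cmod1.
by rewrite /Pp /Mp !big_ord_recr; apply: dominatedM => //; exact: dominated_term.
Qed.

Let canonical_prod_aux c k : (forall j, 0 <= c j) -> prod_bounded c k ->
  (forall z, exists l, clim (fun N => partial_prod c k N z) l) /\
  forall f : R[i]^o -> R[i]^o,
    (forall z, clim (fun N => partial_prod c k N z) (f z)) -> entire f.
Proof.
move=> c0 hB.
(* The product is rewritten as the series of its increments; [q n] majorises the increment [p n] and
   telescopes in turn to the product of the 1 + c j x^(k j). *)
pose p n := if n is 0%N then Pp c k 1 else Pp c k n.+1 - Pp c k n.
pose q n := if n is 0%N then Mp c k 1 else (c n)%:P * 'X^(k n) * Mp c k n.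
have hp N (z : R[i]) : \sum_(n < N.+1) (p n).[z] = partial_prod c k N.+1 z.
  elim: N => [|N IH]; first by rewrite big_ord_recl big_ord0 addr0 horner_Pp.
  by rewrite big_ord_recr /= IH hornerD hornerN !horner_Pp addrC subrK.
have hq N (x : R) : \sum_(n < N.+1) (q n).[x] = (Mp c k N.+1).[x].
  elim: N => [|N IH]; first by rewrite big_ord_recl big_ord0 addr0.
  rewrite big_ord_recr [LHS]/= IH [in RHS]/Mp big_ord_recr /=.
  rewrite -/(Mp c k N.+1) /termR !hornerE; ring.
have hpq n : dominated (p n) (q n).
  case: n => [|n] /=; first exact: dominated_Pp.
  have -> : Pp c k n.+2 - Pp c k n.+1 = (0 - ((c n.+1)%:C)%:P * 'X^(k n.+1)) * Pp c k n.+1.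
    rewrite [in LHS]/Pp big_ord_recr /= -/(Pp c k n.+1) /term; ring.
  apply: dominatedM; last exact: dominated_Pp.
  rewrite -[X in dominated _ X]add0r; apply: dominatedB; last exact: dominated_cX.
  by move=> i; rewrite !coef0 cmod0.
have [|h1 h2] := entire_series hpq.
  move=> x x0; have [B hBx] := hB x x0; exists (Num.max 0 B) => -[|N].
    by rewrite big_ord0 le_max lexx.
  by rewrite hq horner_Mp le_max hBx orbT.
have shift (z : R[i]) l : clim (fun N => \sum_(n < N) (p n).[z]) l <->
    clim (fun N => partial_prod c k N z) l.
  by split; apply: clim_ext; exists 1%N => -[//|n] _; rewrite hp.
split; first by move=> z; have [l /shift hl] := h1 z; exists l.
by move=> f hf; apply: h2 => z; apply/shift.
Qed.

Section Fixed.
Variables (c : nat -> R) (k : nat -> nat).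
Hypotheses (c0 : forall j, 0 <= c j) (cB : prod_bounded c k).

Lemma clim_canonical_prod (z : R[i]) :
  clim (fun N => partial_prod c k N z) (canonical_prod c k z).
Proof. have [l hl] := (canonical_prod_aux c0 cB).1 z; exact: clim_valP hl. Qed.

Lemma entire_canonical_prod : entire (canonical_prod c k).
Proof. exact/(canonical_prod_aux c0 cB).2/clim_canonical_prod. Qed.

Lemma canonical_prod_le (z : R[i]) (B : R) :
  (forall N, \prod_(j < N) (1 + c j * cmod z ^+ k j) <= B) ->
  cmod (canonical_prod c k z) <= B.
Proof.
move=> hB; apply: (clim_cmod_le (clim_canonical_prod z)) => N.
apply: le_trans (hB N); rewrite cmod_prod.
apply: ler_prod => j _; rewrite cmod_ge0 /= (le_trans (cmodD _ _))//.
by rewrite cmodN cmod1 cmodM cmodX cmodR ger0_norm.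
Qed.

(** Weierstrass's product inequality; each step of the induction discards a nonnegative cross
    term. *)
Lemma prod_sub1_ge (y : nat -> R) m n : (forall j, 0 <= y j <= 1) ->
  1 - \sum_(m <= j < n) y j <= \prod_(m <= j < n) (1 - y j).
Proof.
move=> hy; have [mn|nm] := leqP m n; last by rewrite !big_geq ?subr0// ltnW.
rewrite -(subnKC mn); elim: (n - m)%N => [|d IH].
  by rewrite addn0 !big_geq// subr0.
rewrite addnS !big_nat_recr ?leq_addr//=.
have /andP[y0 y1] := hy (m + d)%N.
have h1 : 0 <= 1 - y (m + d)%N by rewrite subr_ge0.
have s0 : 0 <= \sum_(m <= j < m + d) y j.
  by apply: sumr_ge0 => j _; case/andP: (hy j).
have := ler_wpM2r h1 IH; apply: le_trans.
rewrite -subr_ge0.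
have -> : (1 - \sum_(m <= j < m + d) y j) * (1 - y (m + d)%N) -
  (1 - (\sum_(m <= j < m + d) y j + y (m + d)%N)) =
  (\sum_(m <= j < m + d) y j) * y (m + d)%N by ring.
exact: mulr_ge0.
Qed.

Lemma summable_tail (y : nat -> R) (e : R) : (forall j, 0 <= y j) -> 0 < e ->
  (exists B : R, forall N, \sum_(0 <= j < N) y j <= B) ->
  exists J, forall n, (J <= n)%N -> \sum_(J <= j < n) y j <= e.
Proof.
move=> y0 e0 [B hB].
pose S := [set \sum_(0 <= j < N) y j | N in setT].
have hS : has_sup S by split; [exists (\sum_(0 <= j < 0) y j), 0%N | exists B => _ [N _ <-]].
have [_ [J _ <-] hJ] := sup_adherent e0 hS.
exists J => n Jn.
have : \sum_(0 <= j < n) y j <= sup S by apply: ub_le_sup; [exact: hS.2|exists n].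
rewrite (@big_cat_nat _ _ _ J)//=; lra.
Qed.

(** Beyond some J the terms sum to at most 1/2, so the remaining factors multiply to at least 1/2 in
    modulus, while the first J are nonzero by hypothesis. *)
Lemma canonical_prod_neq0 (z : R[i]) :
  (forall j, (c j)%:C * z ^+ k j != 1) -> canonical_prod c k z != 0.
Proof.
move=> hz; pose y j := c j * cmod z ^+ k j.
have y0 j : 0 <= y j by rewrite mulr_ge0// exprn_ge0// cmod_ge0.
have half0 : 0 < 2^-1 :> R by rewrite invr_gt0.
have [|J hJ] := @summable_tail y (2^-1) y0 half0.
  have [B hB] := cB (cmod_ge0 z); exists B => N; apply: le_trans (hB N).
  elim: N => [|N IH]; first by rewrite big_nil big_ord0.
  rewrite big_nat_recr//= big_ord_recr /= mulrDr mulr1; apply: lerD => //.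
  apply: ler_peMl; first exact: y0.
  elim: N {IH} => [|N IH]; first by rewrite big_ord0.
  rewrite big_ord_recr /= -[leLHS]mulr1 ler_pM// lerDl; exact: y0.
have yJ j : (J <= j)%N -> y j <= 2^-1.
  move=> Jj; apply: le_trans (hJ j.+1 (leqW Jj)).
  by rewrite big_nat_recr//= lerDr sumr_ge0.
rewrite -cmod_gt0.
have PJ : 0 < cmod (partial_prod c k J z).
  rewrite cmod_gt0; apply/prodf_neq0 => j _; rewrite subr_eq0 eq_sym; exact: hz.
apply: (@lt_le_trans _ _ (cmod (partial_prod c k J z) / 2)); first by rewrite divr_gt0.
apply: (clim_cmod_ge (clim_canonical_prod z) (N := J)) => n Jn.
have -> : partial_prod c k n z = partial_prod c k J z *
    \prod_(J <= j < n) (1 - (c j)%:C * z ^+ k j).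
  by rewrite /partial_prod -!(big_mkord predT (fun j => 1 - (c j)%:C * z ^+ k j))
    -big_cat_nat.
rewrite cmodM ler_wpM2l ?cmod_ge0// cmod_prod.
(* [prod_sub1_ge] asks for terms at most 1 at every index, whereas [y j] is known to be small only
   from J on. *)
pose y' j := Num.min 1 (y j).
have e' : \sum_(J <= j < n) y j = \sum_(J <= j < n) y' j.
  rewrite !big_nat; apply: eq_bigr => j /andP[Jj _]; rewrite /y' min_r//.
  by rewrite (le_trans (yJ _ Jj))// invf_le1// ler1n.
have hy' j : 0 <= y' j <= 1 by rewrite /y' le_min ler01 y0 ge_min lexx.
have h1 : 2^-1 <= 1 - \sum_(J <= j < n) y' j by rewrite -e'; have := hJ n Jn; lra.
apply: (le_trans h1); apply: (le_trans (prod_sub1_ge _ _ hy')).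
rewrite !big_nat; apply: ler_prod => j /andP[Jj _].
rewrite subr_ge0; case/andP: (hy' j) => _ -> /=.
have -> : y' j = y j.
  by rewrite /y' min_r// (le_trans (yJ _ Jj))// invf_le1// ler1n.
have := cmod_leB 1 ((c j)%:C * z ^+ k j).
by rewrite cmod1 cmodM cmodX cmodR ger0_norm.
Qed.

End Fixed.

(** A zero coefficient turns the factor n into 1, which removes it without renumbering the
    others. *)
Lemma canonical_prod_factor c k n (z : R[i]) (c' := fun j => if j == n then 0 else c j) :
  (forall j, 0 <= c j) -> prod_bounded c k ->
  prod_bounded c' k /\
  canonical_prod c k z = (1 - (c n)%:C * z ^+ k n) * canonical_prod c' k z.
Proof.
move=> c0 cB.
have c'0 j : 0 <= c' j by rewrite /c'; case: ifP.
have c'B : prod_bounded c' k.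
  move=> x x0; have [B hB] := cB x x0; exists B => N; apply: le_trans (hB N).
  apply: ler_prod => j _; rewrite addr_ge0 ?mulr_ge0 ?exprn_ge0//=.
  by rewrite lerD2l ler_wpM2r ?exprn_ge0// /c'; case: ifP.
split => //.
apply: clim_unique (clim_canonical_prod c0 cB z) _.
apply: clim_ext (climMl _ (clim_canonical_prod c'0 c'B z)).
exists n.+1 => N nN; rewrite /partial_prod (bigD1 (Ordinal nN))//=.
rewrite [RHS](bigD1 (Ordinal nN))//= {1}/c' eqxx rmorph0 mul0r subr0 mul1r.
congr (_ * _); apply: eq_bigr => j; rewrite -val_eqE /= /c' => /negbTE -> //.
Qed.

Lemma entire_horner (p : {poly R[i]}) : entire (fun z => p.[z]).
Proof.
elim/poly_ind: p => [|p r IH].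
  by under eq_fun do rewrite horner0; exact: entire_cst.
have -> : (fun z => (p * 'X + r%:P).[z]) = (fun z => p.[z] * z) + cst r.
  by apply/funext => z; rewrite !hornerE.
move=> z; apply: derivableD; last exact: derivable_cst.
by apply: derivableM; [exact: IH|exact: derivable_id].
Qed.

Lemma near_complexW (P : R[i]^o -> Prop) (z : R[i]^o) : (forall w, P w) ->
  \forall w \near z, P w.
Proof. by move=> hP; apply/near_complexP; exists 1. Qed.

Lemma zero_order0 (f : R[i]^o -> R[i]^o) (z : R[i]) : entire f -> f z != 0 ->
  zero_order f z 0.
Proof.
move=> hf fz; exists f; split => //; apply: near_complexW => // w.
by rewrite expr0 mul1r.
Qed.

Lemma canonical_prod_zero_order1 c k n (z : R[i]) :
  (forall j, 0 <= c j) -> prod_bounded c k -> (0 < k n)%N ->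
  (c n)%:C * z ^+ k n = 1 -> (forall j, j != n -> (c j)%:C * z ^+ k j != 1) ->
  zero_order (canonical_prod c k) z 1.
Proof.
move=> c0 cB kn hz hj.
pose c' := fun j => if j == n then 0 else c j.
have c'0 j : 0 <= c' j by rewrite /c'; case: ifP.
have c'B : prod_bounded c' k := (@canonical_prod_factor c k n z c0 cB).1.
(* The cofactor of w - z in 1 - c_n w^(k n), read off w^k - z^k since c_n z^(k n) = 1. At w = z it
   is - c_n (k n) z^(k n - 1), which is not 0. *)
pose S : {poly R[i]} := \sum_(i < k n) (- (c n)%:C * z ^+ i) *: 'X^((k n).-1 - i).
have hS w : S.[w] = - (c n)%:C * \sum_(i < k n) w ^+ ((k n).-1 - i) * z ^+ i.
  rewrite horner_sum mulr_sumr; apply: eq_bigr => i _.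
  by rewrite hornerZ hornerXn; ring.
exists (fun w => S.[w] * canonical_prod c' k w); split.
- apply: near_complexW => w; apply: (entireM (@entire_horner S)).
  exact: entire_canonical_prod.
- rewrite mulf_neq0//; last first.
    apply: canonical_prod_neq0 => // j; rewrite /c'; case: ifPn => [_|/hj//].
    by rewrite rmorph0 mul0r eq_sym oner_neq0.
  rewrite hS.
  have -> : \sum_(i < k n) z ^+ ((k n).-1 - i) * z ^+ i = (k n)%:R * z ^+ (k n).-1.
    transitivity (\sum_(i < k n) z ^+ (k n).-1); last first.
      by rewrite sumr_const card_ord mulr_natl.
    by apply: eq_bigr => i _; rewrite -exprD subnK// -ltnS prednK.
  have cz : (c n)%:C != 0 /\ z != 0.
    split; apply/eqP => h0; move: hz; rewrite h0 ?mul0r ?expr0n ?(gtn_eqF kn) ?mulr0 => /esym/eqP.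
    - by rewrite oner_eq0.
    - by rewrite oner_eq0.
  by rewrite mulf_neq0 ?oppr_eq0 ?cz.1// mulf_neq0 ?expf_neq0 ?cz.2// pnatr_eq0 -lt0n.
- apply: near_complexW => w; rewrite (@canonical_prod_factor c k n w c0 cB).2 expr1 mulrA.
  congr (_ * _); rewrite hS mulrCA -subrXX -{1}hz; ring.
Qed.

End CanonicalProduct.

(** * Radii and growth of the product *)

Section Radii.
Variables (R : realType) (a s : R).
Hypotheses (a0 : 0 < a) (s0 : 0 < s).

Let Y (j : nat) : R := j%:R ^+ 2 + s.

(* Half the Legendre transform of t |-> a e^(2t) / 2 - s t at the slope y - s. *)
Definition legendre (y : R) : R := y / 2 * (ln (y / a) - 1).

Let Psi j := legendre (Y j).

(* Chosen so that [\prod_(j < n) prod_coef j] telescopes to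
   [expR (Psi 0 - Psi n)]. *)
Definition log_radius (j : nat) : R := (Psi j.+1 - Psi j) / (2 * j%:R + 1).
Definition ring_radius (j : nat) : R := expR (log_radius j).
Definition mult (j : nat) : nat := (2 * j).+1.
Definition prod_coef (j : nat) : R := (ring_radius j ^+ mult j)^-1.

Let Y0 j : 0 < Y j.
Proof. by rewrite ltr_wpDl// exprn_ge0. Qed.

Let YS j : Y j.+1 - Y j = 2 * j%:R + 1.
Proof. by rewrite /Y -natr1; ring. Qed.

(** The inequality 1 + u < e^u at u = ln x - ln y. All estimates on radii and terms of the product
    come from it. *)
Lemma ln_ratio_lt (x y : R) : 0 < x -> 0 < y -> x != y -> y * (ln x - ln y) < x - y.
Proof.
move=> x0 y0 xy.
have h : 1 + (ln x - ln y) < expR (ln x - ln y).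
  by apply: expR_gt1Dx; rewrite subr_eq0; apply: contra xy => /eqP/ln_inj ->;
    rewrite ?posrE.
rewrite expRB !lnK ?posrE// in h.
have := h; rewrite -(ltr_pM2l y0) [y * (x / y)]mulrC divfK ?gt_eqF//; lra.
Qed.

Lemma ln_ratio_le (x y : R) : 0 < x -> 0 < y -> y * (ln x - ln y) <= x - y.
Proof.
move=> x0 y0; have [->|xy] := eqVneq x y; first by rewrite !subrr mulr0.
exact/ltW/ln_ratio_lt.
Qed.

Let PsiE j : 2 * Psi j = Y j * (ln (Y j) - ln a - 1).
Proof. by rewrite /Psi /legendre ln_div ?posrE//; field. Qed.

(** As [legendre] has derivative (ln y - ln a) / 2 and Y j.+1 - Y j = 2 j + 1, twice [log_radius j]
    is the mean of ln y - ln a over [Y j, Y j.+1]: it lies strictly between the values at the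
    endpoints, here the left one and in [log_radius_lt] the right one. *)
Lemma log_radius_gt j : ln (Y j) - ln a < 2 * log_radius j.
Proof.
rewrite /log_radius mulrA ltr_pdivlMr// mulrBr !PsiE.
have := @ln_ratio_lt (Y j) (Y j.+1) (Y0 _) (Y0 _).
have -> : Y j != Y j.+1 by rewrite lt_eqF// -subr_gt0 YS.
move=> /(_ isT); rewrite -YS; set u := ln (Y j); set v := ln (Y j.+1); lra.
Qed.

Lemma log_radius_lt j : 2 * log_radius j < ln (Y j.+1) - ln a.
Proof.
rewrite /log_radius mulrA ltr_pdivrMr// mulrBr !PsiE.
have := @ln_ratio_lt (Y j.+1) (Y j) (Y0 _) (Y0 _).
have -> : Y j.+1 != Y j by rewrite gt_eqF// -subr_gt0 YS.
move=> /(_ isT); rewrite -YS; set u := ln (Y j); set v := ln (Y j.+1); lra.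
Qed.

Lemma ring_radius_gt0 j : 0 < ring_radius j.
Proof. exact: expR_gt0. Qed.

Lemma prod_coef_ge0 j : 0 <= prod_coef j.
Proof. by rewrite invr_ge0 exprn_ge0// ltW// ring_radius_gt0. Qed.

Lemma a_sqr_ring_radius j : a * ring_radius j ^+ 2 = expR (ln a + 2 * log_radius j).
Proof. by rewrite expRD lnK ?posrE// /ring_radius -expRM_natl. Qed.

Lemma ring_radius_sqr_gt j : j%:R ^+ 2 + s < a * ring_radius j ^+ 2.
Proof.
rewrite a_sqr_ring_radius -[ltLHS]lnK ?posrE ?Y0// ltr_expR.
have := log_radius_gt j; rewrite /Y; lra.
Qed.

Lemma ring_radius_sqr_lt j : a * ring_radius j ^+ 2 < j.+1%:R ^+ 2 + s.
Proof.
rewrite a_sqr_ring_radius -[ltRHS]lnK ?posrE ?Y0// ltr_expR.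
have := log_radius_lt j; rewrite /Y; lra.
Qed.

Lemma ring_radius_lt i j : (i < j)%N -> ring_radius i < ring_radius j.
Proof.
move=> ij; rewrite ltr_expR.
have h : ln (Y i.+1) <= ln (Y j).
  by rewrite ler_ln ?posrE// lerD2r lerXn2r ?nnegrE// ler_nat.
have := log_radius_lt i; have := log_radius_gt j; lra.
Qed.

Definition coef_term j (x : R) := prod_coef j * x ^+ mult j.

Lemma natr_mult j : (mult j)%:R = 2 * j%:R + 1 :> R.
Proof. by rewrite /mult -natr1 natrM. Qed.

Lemma coef_term_expR j x : 0 < x ->
  coef_term j x = expR ((2 * j%:R + 1) * (ln x - log_radius j)).
Proof.
move=> x0; rewrite /coef_term /prod_coef -exprVn -exprMn /ring_radius -expRN.
rewrite -{1}(lnK (x := x)) ?posrE// -expRD -expRM_natl addrC.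
by rewrite natr_mult.
Qed.

Lemma prod_coef_term n x : 0 < x ->
  \prod_(j < n) coef_term j x = expR (n%:R ^+ 2 * ln x - Psi n + Psi 0%N).
Proof.
move=> x0; elim: n => [|n IH].
  by rewrite big_ord0 expr0n mul0r sub0r addNr expR0.
rewrite big_ord_recr /= IH coef_term_expR// -expRD; congr expR.
have -> : (2 * n%:R + 1) * (ln x - log_radius n) =
    (2 * n%:R + 1) * ln x - (Psi n.+1 - Psi n).
  by rewrite mulrBr /log_radius mulrCA mulfV ?mulr1// gt_eqF.
by rewrite -natr1; ring.
Qed.

(** The Young-Fenchel inequality for the convex weight t |-> a e^(2 t) / 2 - s t at t = ln x. *)
Lemma fenchel_le n x : 0 < x ->
  n%:R ^+ 2 * ln x - Psi n <= a * x ^+ 2 / 2 - s * ln x.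
Proof.
move=> x0.
have X0 : 0 < a * x ^+ 2 by rewrite mulr_gt0// exprn_gt0.
have := ln_ratio_le X0 (Y0 n).
rewrite lnM ?posrE ?exprn_gt0// lnXn// => h.
have := PsiE n; rewrite {2}/Y in h *; rewrite mulr2n in h; move: h.
rewrite /Y; set u := ln _; set v := ln x; set w := ln a; lra.
Qed.

(** With X = a x^2 and Y = Y n, the defect in [fenchel_le] is half of X - Y + Y ln (Y / X); bounding
    the logarithm by Y / X - 1 gives (X - Y)^2 / (2 X), quadratic around the contact point X = Y. *)
Lemma fenchel_ge n x : 0 < x ->
  a * x ^+ 2 / 2 - s * ln x - (a * x ^+ 2 - Y n) ^+ 2 / (a * x ^+ 2) / 2 <=
    n%:R ^+ 2 * ln x - Psi n.
Proof.
move=> x0.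
have X0 : 0 < a * x ^+ 2 by rewrite mulr_gt0// exprn_gt0.
have h1 := ln_ratio_le (Y0 n) X0.
have eX : ln (a * x ^+ 2) = ln a + 2 * ln x.
  by rewrite lnM ?posrE ?exprn_gt0// lnXn// mulr2n; ring.
set X := a * x ^+ 2 in X0 h1 eX *.
have h2 : Y n * (ln (Y n) - ln X) <= Y n * (Y n - X) / X.
  rewrite ler_pdivlMr// -mulrA ler_wpM2l ?(ltW (Y0 n))//; rewrite mulrC; exact: h1.
have -> : (X - Y n) ^+ 2 / X = X - Y n + Y n * (Y n - X) / X.
  by field; rewrite gt_eqF.
have := PsiE n; rewrite eX in h2; move: h2.
set q := _ / X; rewrite /Y; set u := ln _; set v := ln x; set w := ln a; lra.
Qed.

Lemma coef_term_gt0 j x : 0 < x -> 0 < coef_term j x.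
Proof. by move=> x0; rewrite coef_term_expR// expR_gt0. Qed.

Let lnX x : 0 < x -> ln (a * x ^+ 2) = ln a + 2 * ln x.
Proof. by move=> x0; rewrite lnM ?posrE ?exprn_gt0// lnXn// mulr2n; ring. Qed.

Lemma coef_term_le j x : 0 < x ->
  coef_term j x <= expR ((j%:R + 2^-1) * ((a * x ^+ 2 - Y j) / Y j)).
Proof.
move=> x0; rewrite coef_term_expR// ler_expR.
have X0 : 0 < a * x ^+ 2 by rewrite mulr_gt0// exprn_gt0.
have h1 := ln_ratio_le X0 (Y0 j).
have h2 : ln (a * x ^+ 2) - ln (Y j) <= (a * x ^+ 2 - Y j) / Y j.
  by rewrite ler_pdivlMr// mulrC.
have -> : (2 * j%:R + 1) * (ln x - log_radius j) =
  (j%:R + 2^-1) * (2 * ln x - 2 * log_radius j) by field.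
apply: ler_wpM2l; first by rewrite addr_ge0// invr_ge0.
apply: le_trans h2; rewrite lnX//; have := log_radius_gt j; lra.
Qed.

Lemma coef_term_inv_le j x : 0 < x ->
  (coef_term j x)^-1 <= expR ((j%:R + 2^-1) * ((Y j.+1 - a * x ^+ 2) / (a * x ^+ 2))).
Proof.
move=> x0; rewrite coef_term_expR// -expRN ler_expR.
have X0 : 0 < a * x ^+ 2 by rewrite mulr_gt0// exprn_gt0.
have h1 := ln_ratio_le (Y0 j.+1) X0.
have h2 : ln (Y j.+1) - ln (a * x ^+ 2) <= (Y j.+1 - a * x ^+ 2) / (a * x ^+ 2).
  by rewrite ler_pdivlMr// mulrC.
have -> : - ((2 * j%:R + 1) * (ln x - log_radius j)) =
  (j%:R + 2^-1) * (2 * log_radius j - 2 * ln x) by field.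
apply: ler_wpM2l; first by rewrite addr_ge0// invr_ge0.
apply: le_trans h2; rewrite lnX//; have := log_radius_lt j; lra.
Qed.

Lemma geometric_sum_le (t : R) n : 0 <= t -> t < 1 ->
  \sum_(i < n) t ^+ i <= (1 - t)^-1.
Proof.
move=> t0 t1; rewrite -[leRHS]mul1r ler_pdivlMr ?subr_gt0//.
rewrite mulrC -opprB mulNr -subrX1 opprB lerBlDr lerDl; exact: exprn_ge0.
Qed.

Let tau := expR (- (1 + s)^-1).
Let kap := expR (s^-1 + 8).

(** For j = n + 1 + i with i >= 1 the exponent in [coef_term_le] is at most - i j^2 / (j^2 + s),
    hence at most - i / (1 + s). The constant [kap] absorbs the cases j = n and j = n + 1 and the
    shift from i to j - n; its part 1 / s is for n = 0, where Y 0 = s may be small. *)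
Lemma coef_term_up j n x : 0 < x -> (n <= j)%N ->
  a * x ^+ 2 < n.+1%:R * n.+2%:R + s -> coef_term j x <= kap * tau ^+ (j - n).
Proof.
move=> x0 nj hX; apply: (le_trans (coef_term_le _ x0)).
rewrite /tau /kap -expRM_natl -expRD ler_expR.
rewrite mulrA ler_pdivrMr//.
set X := a * x ^+ 2 in hX *; rewrite -(addn2 n) -(addn1 n) !natrD in hX.
have sw : 0 < s^-1 by rewrite invr_gt0.
have s1 : 0 < 1 + s by rewrite addr_gt0.
have sv : 0 < (1 + s)^-1 by rewrite invr_gt0.
have sv1 : (1 + s)^-1 <= 1 by rewrite invf_le1// lerDl ltW.
have esw : s^-1 * s = 1 by rewrite mulVf// gt_eqF.
have esv : (1 + s)^-1 * (1 + s) = 1 by rewrite mulVf// gt_eqF.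
move: (s^-1) ((1 + s)^-1) sw sv sv1 esw esv => w v sw sv sv1 esw esv.
have m0 : 0 <= n%:R :> R by [].
have mm : n%:R <= n%:R ^+ 2 :> R.
  by rewrite -natrX ler_nat; case: (n) => // k; rewrite leq_pmull.
have [->|nj1] := eqVneq j n.
  rewrite subnn mul0r addr0 /Y; move: n%:R m0 mm hX => m m0 mm hX.
  have : (m + 2^-1) * (X - (m ^+ 2 + s)) <= (m + 2^-1) * (3 * m + 2).
    by apply: ler_wpM2l; lra.
  have : 0 <= w * m ^+ 2 by rewrite mulr_ge0 ?sqr_ge0 ?ltW.
  nra.
have {}nj : (n < j)%N by rewrite ltn_neqAle eq_sym nj1.
have [i ji] : exists i, j = (n.+1 + i)%N by exists (j - n.+1)%N; rewrite subnKC.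
have jni : (j - n)%:R = 1 + i%:R :> R.
  by rewrite ji addSn -addnS addKn -natr1 addrC.
rewrite jni /Y; have -> : j%:R = n%:R + 1 + i%:R :> R.
  by rewrite ji natrD -natr1.
have i0 : 0 <= i%:R :> R by [].
case: i {ji jni} i0 => [_|i i0].
  rewrite addr0; move: n%:R m0 hX {mm} => m m0 hX.
  have : (m + 1 + 2^-1) * (X - ((m + 1) ^+ 2 + s)) <= (m + 1 + 2^-1) * (m + 1).
    by apply: ler_wpM2l; nra.
  have : 0 <= w * (m + 1) ^+ 2 by rewrite mulr_ge0 ?sqr_ge0 ?ltW.
  have : v * ((m + 1) ^+ 2 + s) <= (m + 1) ^+ 2 + s.
    by rewrite ler_piMl// addr_ge0 ?sqr_ge0 ?ltW.
  nra.
have i1 : 1 <= i.+1%:R :> R by rewrite ler1n.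
move: i.+1%:R i1 {i0} => {}i i1; move: n%:R m0 hX {mm} => m m0 hX.
have hJ : X - ((m + 1 + i) ^+ 2 + s) <= - (i * (m + 1 + i)) by nra.
set J := m + 1 + i in hJ *.
have J1 : 1 <= J by rewrite /J; lra.
have h1 : (J + 2^-1) * (X - (J ^+ 2 + s)) <= - (i * J ^+ 2).
  apply: (@le_trans _ _ ((J + 2^-1) * - (i * J))); first by apply: ler_wpM2l; lra.
  have : 0 <= i * J by rewrite mulr_ge0//; lra.
  nra.
apply: (le_trans h1).
have h2 : v * (J ^+ 2 + s) <= J ^+ 2.
  rewrite -[leRHS]mul1r -esv -mulrA; apply: ler_wpM2l; first exact: ltW.
  rewrite mulrDl mul1r lerD2l ler_peMr ?(ltW s0)// expr_ge1//; lra.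
have h3 : i * (v * (J ^+ 2 + s)) <= i * J ^+ 2 by apply: ler_wpM2l => //; lra.
have h4 : v * (J ^+ 2 + s) <= J ^+ 2 + s.
  by rewrite ler_piMl// addr_ge0 ?sqr_ge0 ?ltW.
have : 0 <= w * (J ^+ 2 + s) by rewrite mulr_ge0 ?addr_ge0 ?sqr_ge0 ?ltW.
nra.
Qed.

Let c := (2 * (2 + s))^-1.
Let rho := expR (- c).

(** The exponent is at least of order u w / n, where u = j + 1/2 is half the multiplicity and w = n
    - j the distance to ring n. Since u + w = n + 1/2, the larger of the two is at least n / 2, so
    the decay is geometric in the smaller: hence one geometric term from each end. The uniform bound
    keeps the factors 1 - (coef_term j x)^-1 away from 0. *)
Lemma coef_term_down j n x : 0 < x -> (j < n)%N ->
  n%:R * n.+1%:R + s <= a * x ^+ 2 ->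
  (coef_term j x)^-1 <= expR (- (c / 2)) /\
  (coef_term j x)^-1 <= rho ^+ j + rho ^+ (n.-1 - j).
Proof.
move=> x0 jn hX.
have c0 : 0 < c by rewrite invr_gt0 mulr_gt0// addr_gt0.
pose w : R := (n - j)%:R; pose u : R := j%:R + 2^-1; pose m : R := n%:R.
have w1 : 1 <= w by rewrite /w ler1n subn_gt0.
have jE : j%:R = m - w by rewrite /m /w natrB ?(ltnW jn)// subKr.
have j0 : 0 <= m - w by rewrite -jE.
have m1 : 1 <= m by lra.
have u0 : 2^-1 <= u by rewrite /u lerDr.
have key : (coef_term j x)^-1 <= expR (- (2 * c * (u * w / m))).
  apply: (le_trans (coef_term_inv_le _ x0)); rewrite ler_expR.
  have X0 : 0 < a * x ^+ 2 by rewrite mulr_gt0// exprn_gt0.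
  have -> : - (2 * c * (u * w / m)) = u * (- (w / (m * (2 + s)))).
    rewrite /c; field; rewrite !gt_eqF ?addr_gt0//; lra.
  apply: ler_wpM2l; first lra.
  set X := a * x ^+ 2 in X0 hX *.
  have D0 : 0 < m * (2 + s) by rewrite mulr_gt0 ?addr_gt0//; lra.
  rewrite ler_pdivrMr//.
  have -> : - (w / (m * (2 + s))) * X = - (w * X) / (m * (2 + s)) by rewrite !mulNr mulrAC.
  rewrite ler_pdivlMr//.
  rewrite /Y -[j.+1%:R]natr1 jE; rewrite -natr1 -/m in hX.
  have hA : m * w <= m * (m + 1) + s - ((m - w + 1) ^+ 2 + s).
    have : 0 <= (w - 1) * (m - w + 1) by rewrite mulr_ge0; lra.
    lra.
  have hB : m * (m + 1) + s <= m ^+ 2 * (2 + s).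
    have m21 : 0 <= m ^+ 2 - m by rewrite subr_ge0 expr2 ler_peMl//; lra.
    have : 0 <= s * (m ^+ 2 - 1) by rewrite mulr_ge0 ?(ltW s0)//; lra.
    lra.
  set X0' := m * (m + 1) + s in hX hA hB.
  set Z := (m - w + 1) ^+ 2 + s in hA *.
  have h1 : w * X0' <= (X0' - Z) * (m * (2 + s)).
    apply: (@le_trans _ _ (w * (m ^+ 2 * (2 + s)))); first by apply: ler_wpM2l => //; lra.
    have : m * w * (m * (2 + s)) <= (X0' - Z) * (m * (2 + s)).
      by apply: ler_wpM2r => //; rewrite mulr_ge0 ?addr_ge0 ?(ltW s0)//; lra.
    by apply: le_trans; rewrite le_eqVlt; apply/orP; left; apply/eqP; ring.
  have h2 : 0 <= (X - X0') * (m * (2 + s) - w).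
    have ms : 0 <= m * s by rewrite mulr_ge0 ?(ltW s0)//; lra.
    by rewrite mulr_ge0 ?subr_ge0//; lra.
  lra.
have h : (coef_term j x)^-1 <= expR (- (c * u)) \/ (coef_term j x)^-1 <= expR (- (c * w)).
  have uw : u + w = m + 2^-1 by rewrite /u jE; ring.
  have [le_uw|lt_wu] := leP u w; [left|right]; apply: (le_trans key);
    rewrite ler_expR lerN2.
    rewrite -[leRHS]mulrA [leRHS]mulrCA; apply: ler_wpM2l; first exact: ltW.
    rewrite -[leLHS]mulr1 mulrCA -mulrA; apply: ler_wpM2l; first lra.
    rewrite mulrA ler_pdivlMr; lra.
  rewrite -[leRHS]mulrA [leRHS]mulrCA; apply: ler_wpM2l; first exact: ltW.
  rewrite -[leLHS]mulr1 [u * w]mulrC mulrCA -mulrA; apply: ler_wpM2l; first lra.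
  rewrite mulrA ler_pdivlMr; lra.
have r0 k : 0 <= rho ^+ k by rewrite exprn_ge0// expR_ge0.
split.
  by case: h => h; apply: (le_trans h); rewrite ler_expR lerN2 ler_wpM2l ?(ltW c0)//; lra.
case: h => h; apply: (le_trans h).
  apply: (@le_trans _ _ (rho ^+ j)); last by rewrite lerDl.
  rewrite -expRM_natl ler_expR mulrN lerN2 [_ * c]mulrC ler_wpM2l ?(ltW c0)//.
  by rewrite lerDl invr_ge0.
apply: (@le_trans _ _ (rho ^+ (n.-1 - j))); last by rewrite lerDr.
rewrite -expRM_natl ler_expR mulrN lerN2 [_ * c]mulrC ler_wpM2l ?(ltW c0)//.
by rewrite /w ler_nat leq_sub2r// leq_pred.
Qed.

End Radii.

Section ProductBounds.
Variables (R : realType) (a s : R).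
Hypotheses (a0 : 0 < a) (s0 : 0 < s).

Let y j x := coef_term a s j x.
Let E n x := expR (n%:R ^+ 2 * ln x - legendre a (n%:R ^+ 2 + s) + legendre a (0%:R ^+ 2 + s)).
Let tau := expR (- (1 + s)^-1).
Let kap := expR (s^-1 + 8).
Let c := (2 * (2 + s))^-1.
Let rho := expR (- c).
Let S1 := 2 * (1 - rho)^-1.
Let S2 := kap * (1 - tau)^-1.

Let c0 : 0 < c.
Proof. by rewrite invr_gt0 mulr_gt0// addr_gt0. Qed.

Let expRN_lt1 (u : R) : 0 < u -> expR (- u) < 1.
Proof. by move=> u0; rewrite -(expR0 R) ltr_expR oppr_lt0. Qed.

Let rho1 : rho < 1. Proof. exact: expRN_lt1. Qed.

Let tau1 : tau < 1. Proof. by apply: expRN_lt1; rewrite invr_gt0 addr_gt0. Qed.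

(** Selects the monomial of degree n^2 to be factored out at a x^2 = X. The lower bound is
    conditional because X may be below s when n = 0. *)
Lemma exists_index (X : R) : exists n : nat, X < n.+1%:R * n.+2%:R + s /\
  ((0 < n)%N -> n%:R * n.+1%:R + s <= X).
Proof.
have ex : exists m : nat, X < m.+1%:R * m.+2%:R + s.
  exists (Num.truncn X); apply: (lt_trans (truncnS_gt X)).
  by rewrite -[ltLHS]addr0 ler_ltD// ler_peMr// ler1n.
case: (ex_minnP ex) => m hm mmin; exists m; split=> // m0.
rewrite leNgt; apply/negP => hX.
have := mmin m.-1; rewrite prednK// => /(_ hX).
by rewrite leqNgt prednK// leqnn.
Qed.

Lemma sum_inv_term_le n x : 0 < x -> n%:R * n.+1%:R + s <= a * x ^+ 2 ->
  \sum_(j < n) (y j x)^-1 <= S1.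
Proof.
move=> x0 hX.
apply: (@le_trans _ _ (\sum_(j < n) (rho ^+ j + rho ^+ (n.-1 - j)))).
  by apply: ler_sum => j _; exact: (coef_term_down a0 s0 x0 (ltn_ord j) hX).2.
rewrite big_split /=.
have -> : \sum_(j < n) rho ^+ (n.-1 - j) = \sum_(j < n) rho ^+ j.
  rewrite (reindex_inj rev_ord_inj) /=; apply: eq_bigr => j _; congr (_ ^+ _).
  by case: n j {hX} => [[]//|n] j /=; rewrite subSS subKn// -ltnS.
rewrite /S1 mulr2n mulrDl mul1r.
by rewrite lerD// geometric_sum_le// expR_ge0.
Qed.

Lemma sum_term_le n N x : 0 < x -> a * x ^+ 2 < n.+1%:R * n.+2%:R + s ->
  \sum_(n <= j < N) y j x <= S2.
Proof.
move=> x0 hX.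
apply: (@le_trans _ _ (\sum_(n <= j < N) kap * tau ^+ (j - n))).
  by rewrite !big_nat; apply: ler_sum => j /andP[nj _]; exact: coef_term_up.
rewrite -mulr_sumr ler_wpM2l ?expR_ge0//.
rewrite -{1}[n]add0n big_addn big_mkord.
under eq_bigr do rewrite addnK.
by rewrite geometric_sum_le// expR_ge0.
Qed.

Lemma prod_term_le n N x : 0 < x -> a * x ^+ 2 < n.+1%:R * n.+2%:R + s ->
  ((0 < n)%N -> n%:R * n.+1%:R + s <= a * x ^+ 2) ->
  \prod_(j < N) (1 + y j x) <= E n x * expR (S1 + S2).
Proof.
move=> x0 h1 h2.
have y0 j : 0 < y j x by exact: coef_term_gt0.
have hexp I (r : seq I) (F : I -> R) : (forall i, 0 <= F i) ->
    \prod_(i <- r) (1 + F i) <= expR (\sum_(i <- r) F i).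
  move=> F0; rewrite expR_sum; apply: ler_prod => i _.
  by rewrite addr_ge0//= expR_ge1Dx.
rewrite -(big_mkord predT (fun j => 1 + y j x)).
(* Passing to [maxn N n] only adds factors at least 1 and makes the first n factors all present. *)
apply: (@le_trans _ _ (\prod_(0 <= j < maxn N n) (1 + y j x))).
  rewrite (@big_cat_nat _ _ _ N _ (maxn N n))//= ?leq_maxl//.
  rewrite ler_peMr ?prodr_ge0// => [j _|]; first by rewrite addr_ge0// ltW.
  elim/big_ind : _ => // [u v u1 v1|j _]; first by rewrite -[1]mulr1 ler_pM.
  by rewrite lerDl ltW.
rewrite (@big_cat_nat _ _ _ n _ (maxn N n))//= ?leq_maxr// big_mkord.
(* Factoring out y j for j < n extracts the dominant monomial; the terms left, (y j)^-1 below n and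
   y j from n on, have bounded sums. *)
have -> : \prod_(j < n) (1 + y j x) = E n x * \prod_(j < n) (1 + (y j x)^-1).
  rewrite /E -prod_coef_term// -big_split /=; apply: eq_bigr => j _.
  by rewrite mulrDr mulr1 mulfV ?gt_eqF// addrC.
rewrite -mulrA ler_wpM2l ?expR_ge0// expRD.
apply: ler_pM.
- by apply: prodr_ge0 => j _; rewrite addr_ge0// invr_ge0 ltW.
- by apply: prodr_ge0 => j _; rewrite addr_ge0// ltW.
- apply: (le_trans (hexp _ _ (fun j : 'I_n => (y j x)^-1) _)).
    by move=> j; rewrite invr_ge0 ltW.
  rewrite ler_expR; case: (posnP n) => [n0|n0]; last exact: sum_inv_term_le (h2 n0).
  rewrite n0 big_ord0 /S1 mulr_ge0// invr_ge0 subr_ge0 ltW//.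
- apply: (le_trans (hexp _ _ (fun j => y j x) _)); first by move=> j; exact: ltW.
  by rewrite ler_expR; exact: sum_term_le.
Qed.

Lemma prod_term_upper_bound : exists2 C : R, 0 < C & forall x N, 0 <= x ->
  \prod_(j < N) (1 + y j x) <= C * expR (a * x ^+ 2 / 2) * (1 + x) `^ (- s).
Proof.
pose K := expR (S1 + S2).
have K0 : 0 < K by exact: expR_gt0.
pose L := expR (legendre a (0%:R ^+ 2 + s)).
have L0 : 0 < L by exact: expR_gt0.
(* For x < x1 no n > 0 satisfies n (n + 1) + s <= a x^2, so the product is at most K; for x >= x1
   the powers of x and of 1 + x are comparable, which replaces x^(- s) by (1 + x)^(- s). *)
pose x1 := Num.sqrt ((2 + s) / a).
have x10 : 0 < x1 by rewrite sqrtr_gt0 divr_gt0// addr_gt0.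
have x1E : a * x1 ^+ 2 = 2 + s.
  by rewrite sqr_sqrtr ?divr_ge0 ?addr_ge0 ?ltW// mulrC divfK// gt_eqF.
pose C1 := K * (1 + x1) `^ s; pose C2 := K * L * (1 + x1^-1) `^ s.
have C10 : 0 < C1 by rewrite mulr_gt0// powR_gt0// addr_gt0.
have C20 : 0 < C2 by rewrite !mulr_gt0// powR_gt0// addr_gt0// invr_gt0.
exists (C1 + C2); first exact: addr_gt0.
have hsmall x N : 0 <= x -> x < x1 -> \prod_(j < N) (1 + y j x) <= K ->
    \prod_(j < N) (1 + y j x) <= (C1 + C2) * expR (a * x ^+ 2 / 2) * (1 + x) `^ (- s).
  move=> x0 xx1 hK; apply: (le_trans hK).
  have x1p : 0 < 1 + x by rewrite ltr_pwDl.
  rewrite powRN ler_pdivlMr ?powR_gt0//.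
  apply: (@le_trans _ _ C1).
    rewrite ler_wpM2l ?(ltW K0)//; apply: ge0_ler_powR; rewrite ?nnegrE ?ltW// ?addr_gt0//.
    by rewrite ltrD2l.
  rewrite -[leLHS]mulr1; apply: ler_pM; rewrite ?(ltW C10)// ?lerDl ?(ltW C20)//.
  by rewrite -(expR0 R) ler_expR divr_ge0// mulr_ge0 ?exprn_ge0// ltW.
move=> x N; rewrite le_eqVlt => /orP[/eqP <-|x0].
  apply: hsmall => //; rewrite big1 => [|j _]; last first.
    by rewrite /y /coef_term /mult exprS mul0r mulr0 addr0.
  rewrite -(expR0 R) ler_expR addr_ge0//; first by rewrite mulr_ge0// invr_ge0 subr_ge0 ltW.
  by rewrite mulr_ge0 ?expR_ge0// invr_ge0 subr_ge0 ltW.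
have [n [h1 h2]] := exists_index (a * x ^+ 2).
have hN := prod_term_le N x0 h1 h2.
have [xx1|xx1] := ltP x x1.
  apply: hsmall => //; first exact: ltW.
  have n0 : n = 0%N.
    apply/eqP; rewrite -leqn0 leqNgt; apply/negP => n0.
    have := h2 n0; apply/negP; rewrite -ltNge.
    apply: (@lt_le_trans _ _ (2 + s)).
      by rewrite -x1E ltr_pM2l// ltrXn2r// ?nnegrE ltW.
    by rewrite lerD2r -natrM ler_nat; case: (n) n0 => // m _; rewrite mulnS; lia.
  apply: (le_trans hN); rewrite n0 /E expr0n mul0r sub0r addNr expR0 mul1r; exact: lexx.
apply: (le_trans hN).
have hE : E n x <= L * expR (a * x ^+ 2 / 2) * x `^ (- s).
  rewrite /E expRD [leLHS]mulrC -mulrA ler_wpM2l ?(ltW L0)//.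
  rewrite /powR gt_eqF// -expRD ler_expR mulNr; exact: fenchel_le.
apply: (le_trans (ler_wpM2r (expR_ge0 _) hE)).
have hx : x `^ (- s) <= (1 + x1^-1) `^ s * (1 + x) `^ (- s).
  rewrite !powRN ler_pdivlMr ?powR_gt0 ?addr_gt0// mulrC ler_pdivrMr ?powR_gt0//.
  rewrite -powRM ?addr_ge0 ?invr_ge0 ?(ltW x10) ?(ltW x0)//.
  apply: ge0_ler_powR; rewrite ?nnegrE ?mulr_ge0 ?addr_ge0 ?invr_ge0 ?(ltW x10) ?(ltW x0) ?(ltW s0)//.
  have : 1 <= x / x1 by rewrite ler_pdivlMr// mul1r.
  lra.
apply: (@le_trans _ _ (C2 * expR (a * x ^+ 2 / 2) * (1 + x) `^ (- s))); last first.
  by rewrite ler_wpM2r ?powR_ge0// ler_wpM2r ?expR_ge0// lerDr ltW.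
rewrite /C2 -/K.
have -> : L * expR (a * x ^+ 2 / 2) * x `^ (- s) * K =
  K * L * expR (a * x ^+ 2 / 2) * x `^ (- s) by ring.
have -> : K * L * (1 + x1^-1) `^ s * expR (a * x ^+ 2 / 2) * (1 + x) `^ (- s) =
  K * L * expR (a * x ^+ 2 / 2) * ((1 + x1^-1) `^ s * (1 + x) `^ (- s)) by ring.
by rewrite ler_wpM2l// !mulr_ge0 ?expR_ge0.
Qed.

(** Each factor has modulus at least y j - 1 = y j (1 - (y j)^-1). The product of the y j is the
    monomial of degree n^2, close to the weight by [fenchel_ge]; the second factors are bounded
    below together, as the (y j)^-1 have bounded sum and stay below q < 1. *)
Lemma partial_prod_lower_bound : exists2 k : R, 0 < k & forall n (z : R[i]), (0 < n)%N ->
  n%:R * n.+1%:R + s <= a * cmod z ^+ 2 -> a * cmod z ^+ 2 <= n.+1%:R ^+ 2 + s ->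
  k * expR (a * cmod z ^+ 2 / 2) * cmod z `^ (- s) <=
    cmod (partial_prod (prod_coef a s) mult n z).
Proof.
pose q := expR (- (c / 2)).
have q1 : q < 1 by apply: expRN_lt1; rewrite divr_gt0.
pose L := expR (legendre a (0%:R ^+ 2 + s)).
exists (L * expR (- (9 / 2)) * expR (- (S1 / (1 - q)))).
  by rewrite !mulr_gt0// expR_gt0.
move=> n z n0; set x := cmod z => h1 h2.
have X0 : 0 < a * x ^+ 2 by apply: lt_le_trans h1; rewrite ltr_wpDl// mulr_ge0.
have x0 : 0 < x.
  rewrite lt_neqAle cmod_ge0 andbT; apply: contraPneq X0 => <-.
  by rewrite expr0n mulr0 ltxx.
have y0 j : 0 < y j x by exact: coef_term_gt0.
have hq (j : 'I_n) : (y j x)^-1 <= q.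
  by have [] := coef_term_down a0 s0 x0 (ltn_ord j) h1.
rewrite /partial_prod cmod_prod.
apply: (@le_trans _ _ (\prod_(j < n) (y j x * (1 - (y j x)^-1)))); last first.
  apply: ler_prod => j _; rewrite mulr_ge0 ?(ltW (y0 _))//=; last first.
    by rewrite subr_ge0 (le_trans (hq j))// ltW.
  rewrite mulrBr mulr1 mulfV ?gt_eqF//.
  have := cmod_leB ((prod_coef a s j)%:C * z ^+ mult j) 1.
  rewrite cmodB cmod1 cmodM cmodX cmodR ger0_norm//; exact: prod_coef_ge0.
rewrite big_split /= prod_coef_term//.
have hE : L * expR (- (9 / 2)) * expR (a * x ^+ 2 / 2) * x `^ (- s) <= E n x.
  rewrite /powR gt_eqF// /L -!expRD ler_expR.
  have := fenchel_ge a0 s0 n x0.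
  (* On this annulus 0 <= X - Y n <= 2 n + 1 <= 3 n and X >= n^2, whence the 9. *)
  have : (a * x ^+ 2 - (n%:R ^+ 2 + s)) ^+ 2 / (a * x ^+ 2) <= 9.
    rewrite ler_pdivrMr//.
    rewrite -natr1 in h1 h2; move: (a * x ^+ 2) X0 h1 h2 => X X0 h1 h2.
    have n1 : 1 <= n%:R :> R by rewrite ler1n.
    move: n%:R n1 h1 h2 => m m1 h1 h2.
    have k1 : 0 <= X - (m ^+ 2 + s) <= 3 * m by apply/andP; split; lra.
    have k2 : (X - (m ^+ 2 + s)) ^+ 2 <= (3 * m) ^+ 2.
      by case/andP: k1 => k1 k1'; rewrite lerXn2r ?nnegrE//; lra.
    apply: (le_trans k2); have s1 := ltW s0; lra.
  lra.
have hP : expR (- (S1 / (1 - q))) <= \prod_(j < n) (1 - (y j x)^-1).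
  have q10 : 0 < 1 - q by rewrite subr_gt0.
  (* For 0 < u <= q < 1 one has 1 - u >= expR (- u / (1 - q)), which converts the bound on the sum
     into one on the product. *)
  apply: (@le_trans _ _ (expR (\sum_(j < n) (- ((y j x)^-1 / (1 - q)))))).
    rewrite ler_expR sumrN lerN2 -mulr_suml ler_wpM2r ?invr_ge0 ?(ltW q10)//.
    exact: sum_inv_term_le.
  rewrite expR_sum; apply: ler_prod => j _; rewrite expR_ge0 /=.
  set u := (y j x)^-1.
  have u0 : 0 < u by rewrite invr_gt0.
  have u1 : 0 < 1 - u by rewrite subr_gt0 (le_lt_trans (hq j)).
  rewrite expRN -[leRHS]invrK lef_pV2 ?posrE ?expR_gt0 ?invr_gt0//.
  apply: le_trans (expR_ge1Dx _).
  have -> : (1 - u)^-1 = 1 + u / (1 - u) by field; rewrite gt_eqF.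
  by rewrite lerD2l ler_wpM2l ?(ltW u0)// lef_pV2 ?posrE// lerD2l lerN2 hq.
apply: le_trans (ler_pM _ _ hE hP); rewrite ?mulr_ge0 ?expR_ge0 ?powR_ge0//.
by rewrite le_eqVlt; apply/orP; left; apply/eqP; ring.
Qed.

End ProductBounds.

(** * The sequence of zeros *)

Section UnityRoots.
Variable R : realType.

(** An order m < N would give cos (2 pi m / N) = 1, hence sin (pi m / N) = 0, although pi m / N lies
    strictly between 0 and pi. *)
Lemma unity_root_prim N : (0 < N)%N -> N.-primitive_root (unity_root R N).
Proof.
move=> N0; have [m hm mN] := prim_order_exists N0 (unity_root_expr R N0).
have m0 := prim_order_gt0 hm.
suff Nm : N = m by rewrite {1}Nm.
apply/eqP; rewrite eqn_leq (dvdn_leq N0 mN) andbT leqNgt; apply/negP => mN'.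
have := prim_expr_order hm; rewrite /unity_root -cisMn => /eqP.
rewrite eq_complex /= => /andP[/eqP hc _]; move: hc.
have N0' : 0 < N%:R :> R by rewrite ltr0n.
have -> : m%:R * (2 * pi / N%:R) = (m%:R * pi / N%:R) *+ 2 :> R.
  by rewrite -mulr_natl; ring.
rewrite cos_mulr2n cos2sin2 => h.
have : 0 < sin (m%:R * pi / N%:R : R).
  apply: sin_gt0_pi; rewrite divr_gt0 ?mulr_gt0 ?pi_gt0 ?ltr0n//=.
  by rewrite ltr_pdivrMr// mulrC ltr_pM2l ?pi_gt0// ltr_nat.
move=> /(exprn_gt0 2); move: h; rewrite -mulr_natl; lra.
Qed.

End UnityRoots.

Section RingIndex.

Definition ring_index (n : nat) : nat := PeanoNat.Nat.sqrt n.

Lemma ring_indexP n : (ring_index n ^ 2 <= n < (ring_index n).+1 ^ 2)%N.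
Proof. have := PeanoNat.Nat.sqrt_spec n (PeanoNat.Nat.le_0_l n); rewrite /ring_index; nia. Qed.

Lemma ring_index_unique n j : (j ^ 2 <= n < j.+1 ^ 2)%N -> ring_index n = j.
Proof.
have := ring_indexP n; move: (ring_index n) => i /andP[h1 h2] /andP[h3 h4].
have : (i < j.+1)%N by rewrite -ltn_sqr; lia.
have : (j < i.+1)%N by rewrite -ltn_sqr; lia.
lia.
Qed.

Lemma ring_offset_lt n : (n - ring_index n ^ 2 < mult (ring_index n))%N.
Proof.
have := ring_indexP n; rewrite /mult; move: (ring_index n) => i.
by rewrite -!mulnn; nia.
Qed.

End RingIndex.

Section Zeros.
Variables (R : realType) (a s : R).
Hypotheses (a0 : 0 < a) (s0 : 0 < s).

Definition fock_prod : R[i]^o -> R[i]^o := canonical_prod (prod_coef a s) mult.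

Definition ring_point (j l : nat) : R[i] :=
  (ring_radius a s j)%:C * unity_root R (mult j) ^+ l.

(* The ring [j] has [2 j + 1] points and occupies the indices from [j ^ 2] to
   [(j + 1) ^ 2 - 1]. *)
Definition zero_seq (n : nat) : R[i] :=
  ring_point (ring_index n) (n - ring_index n ^ 2).

Lemma cmod_ring_point j l : cmod (ring_point j l) = ring_radius a s j.
Proof.
by rewrite /ring_point cmodM cmod_unity_root mulr1 cmodR gtr0_norm// ring_radius_gt0.
Qed.

Lemma ring_radius_inj i j : ring_radius a s i = ring_radius a s j -> i = j.
Proof.
move=> h; case: (ltngtP i j) => // ij; have := ring_radius_lt a0 s0 ij; by rewrite h ltxx.
Qed.

Lemma prod_coef_eq1 j (z : R[i]) : (prod_coef a s j)%:C * z ^+ mult j = 1 ->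
  exists2 l, (l < mult j)%N & z = ring_point j l.
Proof.
move=> h; pose r := ring_radius a s j; have r0 : r != 0 by rewrite gt_eqF// ring_radius_gt0.
have rC0 : r%:C != 0 :> R[i] by rewrite -(rmorph0 (real_complex R)) (inj_eq (@complexI R)).
have zr : (z / r%:C) ^+ mult j = 1.
  rewrite exprMn exprVn -rmorphXn -fmorphV -[RHS]h mulrC; congr (_ * _).
have [l hl] := prim_rootP (unity_root_prim R (ltn0Sn _)) zr.
by exists l => //; rewrite /ring_point -/(mult j) -hl mulrC divfK.
Qed.

Lemma ring_point_coef j l : (prod_coef a s j)%:C * ring_point j l ^+ mult j = 1.
Proof.
rewrite /ring_point exprMn exprAC unity_root_expr// expr1n mulr1.
rewrite -rmorphXn -rmorphM mulVf ?rmorph1// expf_neq0// gt_eqF// ring_radius_gt0//.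
Qed.

Lemma ring_point_inj j l j' l' : (l < mult j)%N -> (l' < mult j')%N ->
  ring_point j l = ring_point j' l' -> j = j' /\ l = l'.
Proof.
move=> lj lj' h.
have jj : j = j' by apply: ring_radius_inj; rewrite -(cmod_ring_point j l) h cmod_ring_point.
split=> //; subst j'; move: h; rewrite /ring_point.
have rC0 : (ring_radius a s j)%:C != 0 :> R[i].
  by rewrite -(rmorph0 (real_complex R)) (inj_eq (@complexI R)) gt_eqF// ring_radius_gt0.
move=> /(mulfI rC0)/eqP.
by rewrite (eq_prim_root_expr (unity_root_prim R (ltn0Sn _))) !modn_small// => /eqP.
Qed.

Lemma zero_seq_ring_point j l : (l < mult j)%N -> zero_seq (j ^ 2 + l) = ring_point j l.
Proof.
move=> lj; have hj : ring_index (j ^ 2 + l) = j.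
  by apply: ring_index_unique; move: lj; rewrite /mult -!mulnn; nia.
by rewrite /zero_seq hj addKn.
Qed.

Lemma zero_seq_eq n j l : (l < mult j)%N -> zero_seq n = ring_point j l ->
  n = (j ^ 2 + l)%N.
Proof.
move=> lj; rewrite /zero_seq => /(ring_point_inj (ring_offset_lt n) lj)[h1 h2].
by have /andP[h _] := ring_indexP n; rewrite -h2 -h1 subnKC.
Qed.

Lemma fock_prod_bounded : prod_bounded (prod_coef a s) mult.
Proof.
move=> x x0; have [C C0 hC] := prod_term_upper_bound a0 s0.
exists (C * expR (a * x ^+ 2 / 2) * (1 + x) `^ (- s)) => N; exact: hC.
Qed.

Let c0 := prod_coef_ge0 a s.

Lemma entire_fock_prod : entire fock_prod.
Proof. exact: (entire_canonical_prod c0 fock_prod_bounded). Qed.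

(** Distinct rings have distinct radii, so at a zero exactly one factor vanishes, and it does so to
    the first order. *)
Lemma fock_prod_zeros : zeros_are fock_prod zero_seq.
Proof.
move=> z.
have [[j hj]|hn] := pselect (exists j, (prod_coef a s j)%:C * z ^+ mult j = 1).
  have [l lj zl] := prod_coef_eq1 hj.
  exists 1%N.
    apply: (canonical_prod_zero_order1 c0 fock_prod_bounded (ltn0Sn _) hj) => i ij.
    apply: contra_neq ij => hi; have [l' _ zl'] := prod_coef_eq1 hi.
    by apply: ring_radius_inj; rewrite -(cmod_ring_point i l') -zl' zl cmod_ring_point.
  have -> : [set n | zero_seq n = z] = [set (j ^ 2 + l)%N].
    apply/seteqP; split => n /=; first by rewrite zl; exact: zero_seq_eq.
    by move=> ->; rewrite zl; exact: zero_seq_ring_point.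
  exact: card_set1.
exists 0%N.
  apply: zero_order0; first exact: entire_fock_prod.
  apply: (canonical_prod_neq0 c0 fock_prod_bounded) => j; apply/eqP => hj.
  by apply: hn; exists j.
rewrite II0 card_eq0; apply/eqP/seteqP; split => n //= hz.
by apply: hn; exists (ring_index n); rewrite -hz; exact: ring_point_coef.
Qed.

Lemma fock_prod0 : fock_prod 0 != 0.
Proof.
apply: (canonical_prod_neq0 c0 fock_prod_bounded) => j.
by rewrite /mult exprS mul0r mulr0 eq_sym oner_eq0.
Qed.

Lemma fock_prod_le : exists2 C : R, 0 < C & forall z,
  cmod (fock_prod z) <= C * expR (a * cmod z ^+ 2 / 2) * (1 + cmod z) `^ (- s).
Proof.
have [C C0 hC] := prod_term_upper_bound a0 s0; exists C => // z.
apply: (canonical_prod_le c0 fock_prod_bounded) => N; apply: hC; exact: cmod_ge0.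
Qed.

End Zeros.

(** * Lebesgue measure of the plane *)

Section LineMeasure.
Variable R : realType.
Local Notation leb := (@lebesgue_measure R).

Lemma lebesgue_measure_shift (b : R) (A : set R) : measurable A ->
  leb ((fun x => x + b) @^-1` A) = leb A.
Proof.
move=> mA.
have mf : measurable_fun [set: measurableTypeR R]
    ((fun x => x + b) : _ -> measurableTypeR R).
  by apply: measurable_funD.
suff -> : leb A = pushforward leb ((fun x => x + b) : _ -> measurableTypeR R) A by [].
apply: lebesgue_measure_unique => //= _ [[c d]] _ <-.
rewrite /pushforward.
have -> : (fun x : R => x + b) @^-1` `]c, d]%classic = `]c - b, d - b]%classic.
  by apply/seteqP; split => x /=; rewrite !in_itv /= ltrBlDr lerBrDr.
rewrite !lebesgue_measure_itv /= !lte_fin ltrD2r; case: ifP => // _.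
by rewrite -!EFinB opprB addrA subrK.
Qed.

Lemma lebesgue_measure_scale (k : R) (A : set R) : 0 < k -> measurable A ->
  leb ((fun x => k * x) @^-1` A) = (k^-1%:E * leb A)%E.
Proof.
move=> k0 mA.
have mf : measurable_fun [set: measurableTypeR R]
    ((fun x => k * x) : _ -> measurableTypeR R).
  by apply: measurable_funM.
have k0' : 0 <= k := ltW k0.
pose nu := mscale (NngNum k0')
  (pushforward leb ((fun x => k * x) : _ -> measurableTypeR R)).
suff h : leb A = nu mf A.
  rewrite h /nu /mscale /= muleA -EFinM mulVf ?gt_eqF// mul1e //.
apply: lebesgue_measure_unique => //= _ [[c d]] _ <-.
rewrite /nu /mscale /pushforward /=.
rewrite [X in (_ * leb X)%E](_ : _ = `](c / k), (d / k)]%classic); last first.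
  by apply/seteqP; split => x /=; rewrite !in_itv /= ltr_pdivrMr// ler_pdivlMr// ![k * _]mulrC.
rewrite !lebesgue_measure_itv /= !lte_fin ltr_pM2r ?invr_gt0//; case: ifP => // _.
  by rewrite -!EFinB -EFinM -mulrBl mulrC divfK// gt_eqF.
by rewrite mule0.
Qed.

End LineMeasure.

Section PlaneMeasure.
Variable R : realType.
Local Notation leb := (@lebesgue_measure R).
Local Notation plane := (measurableTypeR R * measurableTypeR R)%type.

Definition area : set plane -> \bar R := (leb \x leb)%E.
HB.instance Definition _ := Measure.on area.

Definition area_preserving (T : plane -> plane) :=
  measurable_fun setT T /\ forall A, measurable A -> area (T @^-1` A) = area A.

Lemma area_preserving_comp T U : area_preserving T -> area_preserving U ->
  area_preserving (T \o U).
Proof.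
move=> [mT hT] [mU hU]; split; first exact: measurableT_comp.
move=> A mA; rewrite comp_preimage hU ?hT//.
by rewrite -[X in measurable X]setTI; exact: mT.
Qed.

Lemma area_preserving_ext T U : T =1 U -> area_preserving T -> area_preserving U.
Proof. by move=> /funext ->. Qed.

Lemma area_preserving_shear (h : R -> R) : measurable_fun setT h ->
  area_preserving (fun p : plane => (p.1, p.2 + h p.1) : plane).
Proof.
move=> mh; split.
  apply: measurable_fun_pair; first exact: measurable_fst.
  apply: measurable_funD; first exact: measurable_snd.
  by apply: measurableT_comp => //; exact: measurable_fst.
move=> A mA; rewrite /area /product_measure1; apply: eq_integral => x _ /=.
rewrite -(lebesgue_measure_shift (h x) (measurable_xsection x mA)).
congr (leb _); apply/seteqP; split => y /=; by rewrite /xsection /= !inE.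
Qed.

Lemma area_preserving_swap : area_preserving (fun p : plane => (p.2, p.1) : plane).
Proof.
have ms : measurable_fun setT (fun p : plane => (p.2, p.1) : plane).
  by apply: measurable_fun_pair; [exact: measurable_snd|exact: measurable_fst].
split => // A mA; apply/esym.
rewrite -[RHS]/(pushforward area (fun p : plane => (p.2, p.1) : plane) A).
apply: product_measure_unique => // B C mB mC.
rewrite -[LHS]/(area ((fun p : plane => (p.2, p.1) : plane) @^-1` (B `*` C))).
rewrite [X in area X](_ : _ = C `*` B); last first.
  by apply/seteqP; split => -[x y] /= [].
by rewrite /area product_measure1E// muleC.
Qed.

Lemma area_preserving_shear1 (h : R -> R) : measurable_fun setT h ->
  area_preserving (fun p : plane => (p.1 + h p.2, p.2) : plane).
Proof.
move=> mh; have h1 := area_preserving_comp area_preserving_swap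
  (area_preserving_comp (area_preserving_shear mh) area_preserving_swap).
by apply: area_preserving_ext h1 => -[x y].
Qed.

Definition to_complex (p : plane) : R[i] := p.1 +i* p.2.
Definition of_complex (z : R[i]) : plane := (complex.Re z, complex.Im z).

Lemma to_complexK : cancel to_complex of_complex.
Proof. by case. Qed.

Lemma of_complexK : cancel of_complex to_complex.
Proof. by case. Qed.

Definition cmap (f : R[i] -> R[i]) (p : plane) : plane := of_complex (f (to_complex p)).

Lemma area_preserving_translate (w : R[i]) : area_preserving (cmap (fun z => z + w)).
Proof.
case: w => a b.
have h1 := area_preserving_comp (area_preserving_shear (measurable_cst b))
  (area_preserving_shear1 (measurable_cst a)).
by apply: area_preserving_ext h1 => -[x y].
Qed.

(** A rotation is a product of three shears: horizontal of slope a = - tan (t / 2), vertical of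
    slope sin t, and the first one again. The half turn is excluded by the tangent. *)
Let rotation_small t : cos t != -1 -> area_preserving (cmap (fun z => cis t * z)).
Proof.
move=> ct; have ct1 : 1 + cos t != 0 by rewrite addrC addr_eq0.
pose a := - sin t / (1 + cos t); pose b := sin t.
have m c : measurable_fun [set: R] (fun x => c * x) by exact: mulrl_measurable.
have h1 := area_preserving_comp (area_preserving_shear1 (m a))
  (area_preserving_comp (area_preserving_shear (m b)) (area_preserving_shear1 (m a))).
apply: area_preserving_ext h1 => -[x y]; rewrite /cmap /of_complex /to_complex /cis /=.
have e : sin t ^+ 2 = (1 - cos t) * (1 + cos t) by rewrite sin2cos2; ring.
have ab : a * b = - (1 - cos t).
  by rewrite /a /b !mulNr mulrAC -expr2 e mulfK.
have ab1 : 1 + a * b = cos t by rewrite ab; ring.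
have a1 : a * (1 + cos t) = - sin t by rewrite /a divfK.
congr pair.
  transitivity ((1 + a * b) * x + (a * (1 + (1 + a * b))) * y); first ring.
  by rewrite ab1 a1; ring.
transitivity (b * x + (1 + a * b) * y); first ring.
by rewrite ab1 /b; ring.
Qed.

Lemma area_preserving_cmulM (w v : R[i]) : area_preserving (cmap (fun z => w * z)) ->
  area_preserving (cmap (fun z => v * z)) -> area_preserving (cmap (fun z => w * v * z)).
Proof.
move=> hw hv; have := area_preserving_comp hw hv; apply: area_preserving_ext => p.
by rewrite /cmap /= of_complexK mulrA.
Qed.

Lemma area_preserving_rotation t : 0 <= t <= 2 * pi ->
  area_preserving (cmap (fun z => cis t * z)).
Proof.
(* A quarter of the angle lies in [0, pi / 2], away from the half turn. *)
move=> /andP[t0 t1]; pose u := t / 4.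
have hu : area_preserving (cmap (fun z => cis u * z)).
  apply: rotation_small; apply/eqP => cu.
  have : 0 <= cos u.
    apply: cos_ge0_pihalf; rewrite /u; apply/andP; split.
      have := @pi_ge0 R; lra.
    by move: t1; lra.
  by rewrite cu; lra.
have -> : cis t = cis u * cis u * (cis u * cis u).
  by rewrite -!cisD; congr cis; rewrite /u; field.
by apply: area_preserving_cmulM; apply: area_preserving_cmulM.
Qed.

Lemma area_preserving_unity_root N k : (0 < N)%N ->
  area_preserving (cmap (fun z => unity_root R N ^+ k * z)).
Proof.
move=> N0; elim: k => [|k IH].
  apply: (@area_preserving_ext id).
    by move=> p; rewrite /cmap expr0 mul1r to_complexK.
  by split => //; exact: measurable_id.
rewrite exprS; apply: area_preserving_cmulM IH.
apply: area_preserving_rotation; rewrite divr_ge0 ?mulr_ge0 ?pi_ge0//=.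
by rewrite ler_pdivrMr ?ltr0n// ler_peMr ?mulr_ge0 ?pi_ge0// ler1n.
Qed.

Lemma area_scale (k : R) (A : set plane) : 0 < k -> measurable A ->
  area (cmap (fun z => k%:C * z) @^-1` A) = ((k ^- 2)%:E * area A)%E.
Proof.
move=> k0 mA.
have m c : measurable_fun [set: R] (fun x => c * x) by exact: mulrl_measurable.
have k2 (B : set plane) : measurable B ->
    area ((fun p : plane => (p.1, k * p.2) : plane) @^-1` B) = (k^-1%:E * area B)%E.
  move=> mB; rewrite /area /product_measure1.
  rewrite -ge0_integralZl//; last 2 first.
  - exact: measurable_fun_xsection.
  - by rewrite lee_fin invr_ge0 ltW.
  apply: eq_integral => x _ /=.
  rewrite -(lebesgue_measure_scale k0 (measurable_xsection x mB)).
  congr (leb _); apply/seteqP; split => y /=; by rewrite /xsection /= !inE.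
have mk : measurable_fun setT (fun p : plane => (p.1, k * p.2) : plane).
  apply: measurable_fun_pair; first exact: measurable_fst.
  by apply: measurableT_comp => //; exact: measurable_snd.
pose S := fun p : plane => (p.1, k * p.2) : plane.
pose W := fun p : plane => (p.2, p.1) : plane.
have [mW hW] := area_preserving_swap.
have mS B : measurable B -> measurable (S @^-1` B).
  by move=> mB; rewrite -[X in measurable X]setTI; exact: mk.
have mWi B : measurable B -> measurable (W @^-1` B).
  by move=> mB; rewrite -[X in measurable X]setTI; exact: mW.
have -> : cmap (fun z => k%:C * z) @^-1` A = S @^-1` (W @^-1` (S @^-1` (W @^-1` A))).
  apply/seteqP; split => -[x y]; rewrite /cmap /= /of_complex /= !mul0r subr0 addr0; done.
rewrite k2; last exact: (mWi _ (mS _ (mWi _ mA))).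
rewrite hW; last exact: (mS _ (mWi _ mA)).
rewrite k2; last exact: (mWi _ mA).
by rewrite hW// muleA -EFinM -invfM -expr2.
Qed.

End PlaneMeasure.

Section Discs.
Variable R : realType.
Local Notation leb := (@lebesgue_measure R).
Local Notation plane := (measurableTypeR R * measurableTypeR R)%type.

Let rat_approx (x t : R) : 0 < t -> exists q : rat, ratr q - t < x < ratr q + t.
Proof.
move=> t0; have [|q] := @rat_in_itvoo R (x - t) (x + t); first lra.
by rewrite in_itv /= => /andP[q1 q2]; exists q; apply/andP; split; lra.
Qed.

Let interval_dist (x q u t d : R) : q - t < x < q + t -> q - t < u < q + t ->
  t < d / 4 -> `|u - x| < d / 2.
Proof.
by move=> /andP[? ?] /andP[? ?] ?; rewrite ltr_norml; apply/andP; split; lra.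
Qed.

(** The measurable sets of the plane come from the product of two lines, so the open set is written
    as the countable union of the rational boxes that it contains. *)
Lemma measurable_copen (U : set R[i]) :
  (forall z, U z -> exists2 d : R, 0 < d & forall w, cmod (w - z) < d -> U w) ->
  measurable (@to_complex R @^-1` U).
Proof.
move=> hU.
pose box (q : rat * rat * nat) : set plane :=
  `](ratr q.1.1 - q.2.+1%:R^-1), (ratr q.1.1 + q.2.+1%:R^-1)[%classic `*`
  `](ratr q.1.2 - q.2.+1%:R^-1), (ratr q.1.2 + q.2.+1%:R^-1)[%classic.
pose F q := if `[< box q `<=` @to_complex R @^-1` U >] then box q else set0.
have -> : @to_complex R @^-1` U = \bigcup_q F q.
  apply/seteqP; split => [[x y] Uxy|p [q _]]; last first.
    by rewrite /F; case: asboolP => // h /h.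
  have [d d0 hd] := hU _ Uxy.
  pose n := Num.truncn (4 / d).
  have hn : n.+1%:R^-1 < d / 4.
    rewrite -[ltRHS]invrK ltf_pV2 ?posrE ?invr_gt0 ?divr_gt0// invf_div.
    exact: truncnS_gt.
  have n0 : 0 < n.+1%:R^-1 :> R by rewrite invr_gt0.
  have [q1 hq1] := rat_approx x n0; have [q2 hq2] := rat_approx y n0.
  exists (q1, q2, n) => //; rewrite /F asboolT.
    by split; rewrite /= in_itv.
  move=> -[u v] [] /=; rewrite !in_itv /= => hu hv.
  apply: hd; apply: (le_lt_trans (cmod_le_ReIm _)) => /=.
  rewrite [ltRHS]splitr; apply: ltrD.
    exact: (interval_dist hq1 hu hn).
  exact: (interval_dist hq2 hv hn).
apply: countable_bigcupT_measurable; first exact: countableP.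
by move=> q; rewrite /F; case: ifP => // _; apply: measurableX; exact: measurable_itv.
Qed.

Lemma measurable_ccontinuous (g : R[i] -> R) :
  (forall z (e : R), 0 < e -> exists2 d : R, 0 < d &
     forall w, cmod (w - z) < d -> `|g w - g z| < e) ->
  measurable_fun setT (g \o @to_complex R).
Proof.
move=> hg; apply: (measurability _ (RGenOInfty.measurableE R)).
move=> /= _ [_ [x ->] <-]; rewrite setTI preimage_itvoy.
apply: (@measurable_copen [set z | x < g z]) => z /= hz.
have [d d0 hd] := hg z (g z - x) (ltac:(by rewrite subr_gt0)).
exists d => // w /hd; rewrite ltr_norml => /andP[h _]; lra.
Qed.

Lemma measurable_cmod_sub (z : R[i]) :
  measurable_fun setT (fun p : plane => cmod (to_complex p - z)).
Proof.
apply: (@measurable_ccontinuous (fun w => cmod (w - z))) => w e e0; exists e => // v hv.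
apply: le_lt_trans hv; apply: le_trans (cmod_distB _ _) _.
by rewrite le_eqVlt; apply/orP; left; apply/eqP; congr cmod; ring.
Qed.

Definition disc (z : R[i]) (r : R) : set plane := [set p | cmod (to_complex p - z) < r].

Lemma measurable_disc z r : measurable (disc z r).
Proof.
rewrite -[X in measurable X]setTI; have := @measurable_cmod_sub z.
move=> /(_ measurableT `]-oo, r[%classic (measurable_itv _)).
by rewrite preimage_itvNyo.
Qed.

Let disc0E r p : disc 0 r p = (cmod (to_complex p) < r) :> Prop.
Proof. by rewrite /disc /mkset subr0. Qed.

Let cmap_disc0E f r p :
  (cmap f @^-1` disc 0 r) p = (cmod (f (to_complex p)) < r) :> Prop.
Proof. by rewrite /preimage /mkset disc0E /cmap of_complexK. Qed.

(** Kept as a symbol: it appears on both sides when counts are compared with areas, and its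
    positivity lets it be cancelled. *)
Definition unit_area : R := fine (area (disc 0 1)).

Let box_area (r : R) : 0 < r ->
  area (`](- r), r[%classic `*` `](- r), r[%classic : set plane) = ((2 * r) ^+ 2)%:E.
Proof.
move=> r0; rewrite /area product_measure1E//; try exact: measurable_itv.
rewrite -[LHS]/(leb `](- r)%R, r%R[%classic * leb `](- r)%R, r%R[%classic)%E.
rewrite !lebesgue_measure_itv /= !lte_fin gtrN// -EFinB -EFinM; congr EFin; ring.
Qed.

Lemma area_unit_disc : area (disc 0 1) = unit_area%:E.
Proof.
rewrite fineK// ge0_fin_numE// (le_lt_trans _ (ltry ((2 * 1) ^+ 2)))//.
rewrite -box_area//; apply: le_measure; rewrite ?inE//; first exact: measurable_disc.
  by apply: measurableX; exact: measurable_itv.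
move=> -[x y]; rewrite disc0E => h.
have := le_lt_trans (Re_le_cmod _) h; have := le_lt_trans (Im_le_cmod _) h.
by rewrite /= !in_itv /= !ltr_norml.
Qed.

Lemma unit_area_gt0 : 0 < unit_area.
Proof.
rewrite -lte_fin -area_unit_disc.
apply: (@lt_le_trans _ _ ((2 * (1 / 4)) ^+ 2)%:E).
  by rewrite lte_fin exprn_gt0.
rewrite -box_area//; apply: le_measure; rewrite ?inE//; last first.
  move=> -[x y] [hx hy]; rewrite disc0E; apply: (le_lt_trans (cmod_le_ReIm _)).
  move: hx hy; rewrite /= !in_itv /= -!ltr_norml => hx hy.
  by apply: (lt_trans (ltrD hx hy)); lra.
  exact: measurable_disc.
by apply: measurableX; exact: measurable_itv.
Qed.

Lemma area_disc z r : 0 < r -> area (disc z r) = (unit_area * r ^+ 2)%:E.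
Proof.
move=> r0.
have -> : disc z r = cmap (fun w => w + - z) @^-1` disc 0 r.
  by apply/funext => p; rewrite cmap_disc0E.
rewrite (area_preserving_translate _).2; last exact: measurable_disc.
have -> : disc 0 r = cmap (fun w => (r^-1)%:C * w) @^-1` disc 0 1.
  have e p : (cmod ((r^-1)%:C * to_complex p) < 1) = (cmod (to_complex p) < r).
    by rewrite cmodM cmodR gtr0_norm ?invr_gt0// mulrC ltr_pdivrMr// mul1r.
  by apply/funext => p; rewrite cmap_disc0E disc0E e.
rewrite area_scale ?invr_gt0//; last exact: measurable_disc.
by rewrite area_unit_disc -EFinM exprVn invrK mulrC.
Qed.

Definition annulus (r1 r2 : R) : set plane :=
  [set p | r1 <= cmod (to_complex p) < r2].

Lemma annulusE r1 r2 : annulus r1 r2 = disc 0 r2 `\` disc 0 r1.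
Proof.
apply/seteqP; split => p; rewrite /annulus /setD /mkset !disc0E.
  by move=> /andP[h1 h2]; split => //; apply/negP; rewrite -leNgt.
by move=> [h2 /negP]; rewrite -leNgt => h1; rewrite h1.
Qed.

Lemma measurable_annulus r1 r2 : measurable (annulus r1 r2).
Proof. by rewrite annulusE; apply: measurableD; exact: measurable_disc. Qed.

Lemma area_annulus r1 r2 : 0 <= r1 -> r1 <= r2 -> 0 < r2 ->
  area (annulus r1 r2) = (unit_area * (r2 ^+ 2 - r1 ^+ 2))%:E.
Proof.
move=> r10 r12 r20; rewrite annulusE.
have h : disc 0 r1 `<=` disc 0 r2 by move=> p; rewrite !disc0E => /lt_le_trans; exact.
have e1 : area (disc 0 r1) = (unit_area * r1 ^+ 2)%:E.
  move: r10; rewrite le_eqVlt => /orP[/eqP <-|]; last exact: area_disc.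
  rewrite expr0n mulr0 [X in area X](_ : _ = set0) ?measure0//.
  apply/seteqP; split => p //; rewrite disc0E => h0.
  by have := le_lt_trans (cmod_ge0 _) h0; rewrite ltxx.
have -> : area (disc 0 r2 `\` disc 0 r1) =
    (area (disc 0%R r2) - area (disc 0%R r2 `&` disc 0%R r1))%E.
  apply: measureD; try exact: measurable_disc.
  by rewrite -[X in (X < _)%E]/(area (disc 0 r2)) area_disc// ltry.
by rewrite (setIidr h) area_disc// e1 -EFinB mulrBr.
Qed.

Lemma annulus_unity_root N k r1 r2 :
  cmap (fun z => unity_root R N ^+ k * z) @^-1` annulus r1 r2 = annulus r1 r2.
Proof.
by apply/funext => p; rewrite /preimage /annulus /mkset /cmap of_complexK cmodM
  cmod_unity_root mul1r.
Qed.

End Discs.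

(** * Counting zeros in discs *)

Section Averaging.
Variable R : realType.
Local Notation plane := (measurableTypeR R * measurableTypeR R)%type.
Local Notation w N := (unity_root R N).

Lemma exists_arg (z : R[i]) : exists2 t : R, 0 <= t & z = (cmod z)%:C * cis t.
Proof.
have [->|z0] := eqVneq z 0; first by exists 0 => //; rewrite cmod0 mul0r.
have n0 : 0 < cmod z by rewrite cmod_gt0.
have h := cmod_sqr z; move: h n0; case: z z0 => x y _; set n := cmod _ => /= h n0.
pose u := x / n; pose v := y / n.
have uv : u ^+ 2 + v ^+ 2 = 1.
  by rewrite /u /v !exprMn -mulrDl -h exprVn mulfV// expf_neq0// gt_eqF.
have u1 : -1 <= u <= 1.
  have : u ^+ 2 <= 1 by rewrite -uv lerDl sqr_ge0.
  rewrite -[X in _ <= X](expr1n _ 2) -real_normK ?num_real// ler_sqr ?nnegrE//.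
  by rewrite ler_norml.
have sa : sin (acos u) = `|v|.
  by rewrite sin_acos// -[1]uv addrAC subrr add0r sqrtr_sqr.
have hx : x = n * u by rewrite /u mulrC divfK// gt_eqF.
have hy : y = n * v by rewrite /v mulrC divfK// gt_eqF.
have [v0|v0] := leP 0 v.
  exists (acos u); first exact: acos_ge0.
  rewrite /cis acosK ?in_itv//= sa ger0_norm//.
  by apply/eqP; rewrite eq_complex /= hx hy !mul0r subr0 addr0 !eqxx.
exists (2 * pi - acos u).
  by have := acos_lepi u1; have := @pi_ge0 R; lra.
have -> : 2 * pi - acos u = - acos u + pi *+ 2 by rewrite mulr2n; ring.
rewrite /cis cosD2pi sinD2pi cosN sinN acosK ?in_itv//= sa ltr0_norm// opprK.
by apply/eqP; rewrite eq_complex /= hx hy !mul0r subr0 addr0 !eqxx.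
Qed.

(** Rotations by roots of unity preserve both the annulus and the area, so each rotate contributes
    the same integral. The pointwise sum counts the rotates that fall in D. *)
Let integral_rotates N (r1 r2 : R) (D : set plane) : (0 < N)%N -> measurable D ->
  (\int[@area R]_(p in annulus r1 r2)
    (\sum_(l < N) (\1_D (cmap (fun z => w N ^+ l * z) p))%:E))%E =
  (N%:R%:E * area (annulus r1 r2 `&` D))%E.
Proof.
move=> N0 mD; pose A := annulus r1 r2.
have mA : measurable A by exact: measurable_annulus.
have mT l := (area_preserving_unity_root R l N0).1.
have mTD l : measurable (cmap (fun z => w N ^+ l * z) @^-1` D).
  by rewrite -[X in measurable X]setTI; exact: mT.
rewrite ge0_integral_sum//; last first.
  move=> l; apply/measurable_EFinP; apply: measurable_funTS.
  exact: (measurableT_comp (measurable_indic mD) (mT l)).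
have hl (l : 'I_N) : (\int[@area R]_(p in A)
    (\1_D (cmap (fun z => w N ^+ l * z) p))%:E)%E = area (A `&` D).
  transitivity (area ((cmap (fun z => w N ^+ l * z) @^-1` D) `&` A)).
    by rewrite -(integral_indic (@area R) mA (mTD l)).
  have -> : cmap (fun z => w N ^+ l * z) @^-1` D `&` A =
      cmap (fun z => w N ^+ l * z) @^-1` (D `&` A).
    by rewrite preimage_setI annulus_unity_root.
  by rewrite (area_preserving_unity_root R l N0).2 1?setIC//; exact: measurableI.
under eq_bigr do rewrite hl.
rewrite sumr_const card_ord; exact: esym (mule_natl _ _).
Qed.

Lemma averaging_le N (r1 r2 c : R) (D : set plane) : (0 < N)%N -> measurable D -> 0 <= c ->
  (forall p, annulus r1 r2 p ->
     c <= \sum_(l < N) \1_D (cmap (fun z => w N ^+ l * z) p)) ->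
  (c%:E * area (annulus r1 r2) <= N%:R%:E * area (annulus r1 r2 `&` D))%E.
Proof.
move=> N0 mD c0 h; rewrite -integral_rotates//.
rewrite -integral_cst; last exact: measurable_annulus.
have mT l := (area_preserving_unity_root R l N0).1.
apply: ge0_le_integral => //.
- exact: measurable_annulus.
- under eq_fun do rewrite sumEFin.
  apply/measurable_EFinP; apply: measurable_sum => l; apply: measurable_funTS.
  exact: (measurableT_comp (measurable_indic mD) (mT l)).
- by move=> p Ap; rewrite sumEFin lee_fin; exact: h.
Qed.

Lemma averaging_ge N (r1 r2 c : R) (D : set plane) : (0 < N)%N -> measurable D -> 0 <= c ->
  (forall p, annulus r1 r2 p ->
     \sum_(l < N) \1_D (cmap (fun z => w N ^+ l * z) p) <= c) ->
  (N%:R%:E * area (annulus r1 r2 `&` D) <= c%:E * area (annulus r1 r2))%E.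
Proof.
move=> N0 mD c0 h; rewrite -integral_rotates//.
rewrite -integral_cst; last exact: measurable_annulus.
have mT l := (area_preserving_unity_root R l N0).1.
apply: ge0_le_integral => //.
- exact: measurable_annulus.
- by move=> p _; rewrite sume_ge0// => l _; rewrite lee_fin.
- under eq_fun do rewrite sumEFin.
  apply/measurable_EFinP; apply: measurable_sum => l; apply: measurable_funTS.
  exact: (measurableT_comp (measurable_indic mD) (mT l)).
- by move=> p Ap; rewrite sumEFin lee_fin; exact: h.
Qed.

End Averaging.

Section Counting.
Variables (R : realType) (a s : R).
Hypotheses (a0 : 0 < a) (s0 : 0 < s).
Local Notation plane := (measurableTypeR R * measurableTypeR R)%type.
Local Notation w j := (unity_root R (mult j)).
Let q := Num.sqrt a.
Let q0 : 0 < q. Proof. by rewrite sqrtr_gt0. Qed.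
Let qq : q ^+ 2 = a. Proof. by rewrite sqr_sqrtr// ltW. Qed.

(** The cell attached to ring j: its area is [mult j] times [unit_area] / a, so that every zero
    receives the same share of area. *)
Let ann (j : nat) : set plane := annulus (j%:R / q) (j.+1%:R / q).
(** Bounds the distance from a point of a cell to the nearest point of its ring: 4 pi / q for the
    angle, (1 + sqrt s) / q for the radius. *)
Let C : R := (4 * pi + 1 + Num.sqrt s) / q.

Let C0 : 0 <= C.
Proof. by rewrite divr_ge0 ?addr_ge0 ?mulr_ge0 ?pi_ge0 ?sqrtr_ge0 ?ltW. Qed.

Lemma ring_radius_bounds j :
  j%:R / q <= ring_radius a s j <= (j%:R + 1 + Num.sqrt s) / q.
Proof.
have r0 := ring_radius_gt0 a s j.
have h1 := ring_radius_sqr_gt a0 s0 j; have h2 := ring_radius_sqr_lt a0 s0 j.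
have sq0 := sqrtr_ge0 s; have sqE : Num.sqrt s ^+ 2 = s by rewrite sqr_sqrtr// ltW.
rewrite ler_pdivrMr// ler_pdivlMr//.
have e : (ring_radius a s j * q) ^+ 2 = a * ring_radius a s j ^+ 2.
  by rewrite exprMn qq mulrC.
have rq : 0 <= ring_radius a s j * q by rewrite mulr_ge0 ?ltW.
apply/andP; split.
  rewrite -ler_sqr ?nnegrE// e (le_trans _ (ltW h1))// lerDl ltW//.
rewrite -ler_sqr ?nnegrE ?addr_ge0// e (le_trans (ltW h2))// -natr1.
rewrite [leRHS]sqrrD sqE -addrA lerD2l lerDr mulrn_wge0// mulr_ge0// addr_ge0//.
Qed.

Lemma ring_point_near j p : ann j p ->
  exists m, cmod (to_complex p - (ring_radius a s j)%:C * w j ^+ m) <= C.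
Proof.
move=> /andP[h1 h2]; set z := to_complex p in h1 h2 *.
have [t t0 zE] := exists_arg z.
have [m [t' [tE t'0 t'1]]] := cis_factor (ltn0Sn _) t0 : exists m t', [/\ cis t = w j ^+ m * cis t', 0 <= t' & t' <= 2 * pi / (mult j)%:R].
exists m; rewrite zE tE; set r := ring_radius a s j.
have -> : (cmod z)%:C * (w j ^+ m * cis t') - r%:C * w j ^+ m =
  w j ^+ m * ((cmod z)%:C * (cis t' - 1) + (cmod z - r)%:C).
  by rewrite rmorphB /=; ring.
rewrite cmodM cmod_unity_root mul1r (le_trans (cmodD _ _))// cmodM !cmodR.
rewrite ger0_norm ?cmod_ge0//.
have /andP[r1 r2] := ring_radius_bounds j; rewrite -/r in r1 r2.
have j0 : 0 <= j%:R :> R by [].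
have qi : 0 < q^-1 by rewrite invr_gt0.
have b2 : `|cmod z - r| <= (1 + Num.sqrt s) / q.
  have sq0 : 0 <= Num.sqrt s / q by rewrite divr_ge0 ?sqrtr_ge0 ?ltW.
  rewrite -natr1 in h2; rewrite ler_norml; apply/andP; split; lra.
have b1 : cmod z * cmod (cis t' - 1) <= 4 * pi / q.
  apply: (@le_trans _ _ ((j.+1%:R / q) * (2 * (2 * pi / (mult j)%:R)))).
    apply: ler_pM; rewrite ?cmod_ge0//; first exact: ltW.
    by apply: (le_trans (cmod_cis_sub1 t'0)); rewrite ler_wpM2l.
  rewrite natr_mult -natr1.
  have D0 : 0 < 2 * j%:R + 1 :> R by rewrite ltr_wpDl// mulr_ge0.
  have -> : (j%:R + 1) / q * (2 * (2 * pi / (2 * j%:R + 1))) =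
    ((j%:R + 1) / (2 * j%:R + 1)) * (4 * pi / q) by field; rewrite !gt_eqF.
  rewrite ler_piMl ?divr_ge0 ?mulr_ge0 ?pi_ge0 ?(ltW q0)//.
  by rewrite ler_pdivrMr// mul1r lerD2r mulr2n mulrDl mul1r lerDl.
apply: (le_trans (lerD b1 b2)); rewrite /C -mulrDl addrA; exact: lexx.
Qed.

Let ind (z : R[i]) (rho : R) (v : R[i]) : R := (cmod (v - z) < rho)%R%:R.
Definition ring_count z rho j : R := \sum_(l < mult j) ind z rho (ring_point a s j l).

Let ind_indic z rho (p : plane) : \1_(disc z rho) p = ind z rho (to_complex p).
Proof.
rewrite indicE /ind; congr ((nat_of_bool _)%:R).
by apply/idP/idP; rewrite inE.
Qed.

Let cmap_to f (p : plane) : to_complex (cmap f p) = f (to_complex p).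
Proof. by rewrite /cmap of_complexK. Qed.

Let ring_count_shift z rho j m : ring_count z rho j =
  \sum_(l < mult j) ind z rho (w j ^+ l * ((ring_radius a s j)%:C * w j ^+ m)).
Proof.
rewrite /ring_count /ring_point.
under eq_bigr do rewrite mulrC.
rewrite -(sum_unity_root_shift m (fun u => ind z rho (u * (ring_radius a s j)%:C)) (ltn0Sn _)).
by apply: eq_bigr => l _; congr ind; ring.
Qed.

Let ind_le z rho rho' (u v : R[i]) : cmod (v - u) + rho <= rho' ->
  ind z rho u <= ind z rho' v.
Proof.
move=> h; rewrite /ind; case: (ltP (cmod (u - z)) rho) => // h1.
have -> : cmod (v - z) < rho' by have := cmod_dist_trans v u z; lra.
by [].
Qed.

Let ann_area j : area (ann j) = (unit_area R * (mult j)%:R / a)%:E.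
Proof.
have qi : 0 < q^-1 by rewrite invr_gt0.
rewrite area_annulus ?divr_ge0 ?divr_gt0 ?(ltW q0)//; last first.
  by rewrite ler_wpM2r ?(ltW qi)// ler_nat.
congr EFin; rewrite -mulrA; congr (_ * _).
rewrite !exprMn exprVn qq -mulrBl natr_mult -natr1; congr (_ * _); ring.
Qed.

Let ring_count_ge0 z rho j : 0 <= ring_count z rho j.
Proof. by apply: sumr_ge0. Qed.

Let finN (x y c : R) : 0 < c -> (x%:E * (unit_area R * c / a)%:E <= c%:E * y%:E)%E ->
  x * unit_area R / a <= y.
Proof.
move=> c0; rewrite -!EFinM lee_fin.
have -> : x * (unit_area R * c / a) = c * (x * unit_area R / a) by ring.
by rewrite ler_pM2l.
Qed.

Let area_cap_fin (D : set plane) j : measurable D ->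
  (area (ann j `&` D) \is a fin_num)%E.
Proof.
move=> mD; rewrite ge0_fin_numE//; apply: (@le_lt_trans _ _ (area (ann j))).
  apply: le_measure; rewrite ?inE//; last exact: measurable_annulus.
  by apply: measurableI => //; exact: measurable_annulus.
by rewrite ann_area ltry.
Qed.

(** For any p in the cell, its rotates are within C of the corresponding points of the ring, so the
    ring has at most as many points in the disc as p has rotates in the enlarged disc. Averaging
    over p turns this count into an area. [ring_count_ge] is the same argument with the shrunken
    disc. *)
Lemma ring_count_le z rho j :
  ((ring_count z rho j * unit_area R / a)%:E <= area (ann j `&` disc z (rho + C)))%E.
Proof.
have mD := measurable_disc z (rho + C).
rewrite -(fineK (area_cap_fin j mD)) lee_fin; apply: (@finN _ _ (mult j)%:R).
  by rewrite ltr0n.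
rewrite (fineK (area_cap_fin j mD)) -ann_area.
apply: averaging_le => // p /ring_point_near[m hm].
rewrite (ring_count_shift _ _ _ m); apply: ler_sum => l _.
rewrite ind_indic cmap_to; apply: ind_le.
by rewrite -mulrBr cmodM cmod_unity_root mul1r; lra.
Qed.

Lemma ring_count_ge z rho j :
  (area (ann j `&` disc z (rho - C)) <= (ring_count z rho j * unit_area R / a)%:E)%E.
Proof.
have mD := measurable_disc z (rho - C).
have h : ((mult j)%:R%:E * area (ann j `&` disc z (rho - C)) <=
   (ring_count z rho j)%:E * area (ann j))%E.
  apply: averaging_ge => // p /ring_point_near[m hm].
  rewrite (ring_count_shift _ _ _ m); apply: ler_sum => l _.
  rewrite ind_indic cmap_to; apply: ind_le.
  by rewrite -mulrBr cmodM cmod_unity_root mul1r cmodB; lra.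
move: h; rewrite -(fineK (area_cap_fin j mD)) ann_area -!EFinM !lee_fin.
have -> : ring_count z rho j * (unit_area R * (mult j)%:R / a) =
  (mult j)%:R * (ring_count z rho j * unit_area R / a) by ring.
by rewrite ler_pM2l ?ltr0n.
Qed.

Lemma area_disc_rings (D : set plane) J : measurable D ->
  (\sum_(j < J) area (ann j `&` D) = area (disc 0%R (J%:R / q)%R `&` D))%E.
Proof.
move=> mD; elim: J => [|J IH].
  rewrite big_ord0 mul0r [X in area X](_ : _ = set0) ?measure0//.
  apply/seteqP; split => p // [h _]; have := cmod_ge0 (to_complex p - 0).
  by rewrite leNgt; move/negP; apply; exact: h.
have mA := measurable_annulus (J%:R / q) (J.+1%:R / q).
have mJ := measurable_disc 0 (J%:R / q).
rewrite big_ord_recr /= IH -measureU; last 3 first.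
- exact: measurableI.
- exact: measurableI.
- apply/seteqP; split => p // [[h1 _] [/andP[h2 _] _]].
  by move: h1; rewrite /disc /mkset subr0 ltNge h2.
congr area; rewrite -setIUl; congr (_ `&` _).
have hq : J%:R / q <= J.+1%:R / q by rewrite ler_wpM2r ?invr_ge0 ?(ltW q0)// ler_nat.
apply/funext => p; rewrite /setU /ann /annulus /disc /mkset subr0.
apply/propext; split => [[h|/andP[_ //]]|h]; first exact: lt_le_trans hq.
by have [h'|h'] := ltP (cmod (to_complex p)) (J%:R / q); [left|right; rewrite h].
Qed.

End Counting.

Section Density.
Variables (R : realType) (a s : R).
Hypotheses (a0 : 0 < a) (s0 : 0 < s).
Let q := Num.sqrt a.
Let q0 : 0 < q. Proof. by rewrite sqrtr_gt0. Qed.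
Let C : R := (4 * pi + 1 + Num.sqrt s) / q.
Let C0 : 0 <= C.
Proof. by rewrite divr_ge0 ?addr_ge0 ?mulr_ge0 ?pi_ge0 ?sqrtr_ge0 ?ltW. Qed.
Let Lam := zero_seq a s.

Lemma counting_initial (A : set nat) M : A `<=` `I_M ->
  counting A = (\sum_(n < M) \1_A n)%:E :> \bar R.
Proof.
pose mu : {measure set nat -> \bar R} := counting.
elim: M A => [|M IH] A AM.
  have -> : A = set0 by apply/seteqP; split => // n /AM.
  by rewrite measure0 big_ord0.
have mA (B : set nat) : measurable B by [].
have AE : A = (A `&` `I_M) `|` (A `&` [set M]).
  apply/seteqP; split => [n An|n [[]|[]]//].
  by have := AM _ An; rewrite /= ltnS leq_eqVlt => /orP[/eqP nM|nM]; [right|left]; split.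
transitivity (mu A) => //.
have -> : mu A = (mu (A `&` `I_M) + mu (A `&` [set M]))%E.
  rewrite {1}AE; apply: measureU => //.
  by apply/seteqP; split => n // [[_ /= nM] [_ /= nM']]; move: nM; rewrite nM' ltnn.
have eI : mu (A `&` `I_M) = (\sum_(n < M) \1_(A `&` `I_M) n)%:E.
  by apply: IH => n [].
rewrite eI.
rewrite big_ord_recr /= EFinD; congr (_ + _)%E.
  congr EFin; apply: eq_bigr => n _; rewrite !indicE; congr ((nat_of_bool _)%:R).
  by apply/idP/idP; rewrite !inE => //; [case|split => //=].
have [AM'|AM'] := pselect (A M).
  have -> : A `&` [set M] = [set M] by apply/seteqP; split => n /= => [[]|->].
  rewrite indicE mem_set//= /mu /= /counting asboolT; last exact: finite_set1.
  by rewrite fset_set1 finmap.cardfs1.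
have -> : A `&` [set M] = set0.
  by apply/seteqP; split => n //= [An nM]; apply: AM'; rewrite -nM.
by rewrite measure0 indicE memNset.
Qed.

Lemma sum_rings (F : nat -> R) J :
  \sum_(n < J ^ 2) F n = \sum_(j < J) \sum_(l < mult j) F (j ^ 2 + l)%N.
Proof.
elim: J => [|J IH]; first by rewrite !big_ord0.
rewrite [RHS]big_ord_recr /= -IH.
have -> : (J.+1 ^ 2 = J ^ 2 + mult J)%N by rewrite /mult -!mulnn; lia.
by rewrite big_split_ord /=.
Qed.

Lemma disk_countE z rho J : cmod z + rho <= J%:R / q ->
  disk_count Lam z rho = (\sum_(j < J) ring_count a s z rho j)%:E.
Proof.
move=> hJ; rewrite /disk_count (@counting_initial _ (J ^ 2)).
  congr EFin; rewrite (sum_rings (fun n => \1_[set n | cmod (Lam n - z) < rho] n)).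
  apply: eq_bigr => j _; apply: eq_bigr => l _.
  rewrite indicE; congr ((nat_of_bool _)%:R).
  by rewrite -(zero_seq_ring_point a0 s0 (ltn_ord l)); apply/idP/idP; rewrite inE.
move=> n /= hn; have /andP[_ h] := ring_indexP n; apply: leq_trans h _.
rewrite leq_sqr -(ltr_nat R) -(ltr_pM2r (_ : 0 < q^-1)) ?invr_gt0//.
apply: lt_le_trans hJ.
(* A zero in the disc has modulus below J / q, while its ring has radius at least [ring_index n] /
   q: its ring comes before J. *)
have /andP[h1 _] := ring_radius_bounds a0 s0 (ring_index n).
apply: (le_lt_trans h1).
rewrite -(cmod_ring_point a s _ (n - ring_index n ^ 2)) -/(zero_seq a s n) -/Lam.
by have := cmod_leB (Lam n) z; lra.
Qed.

Lemma disk_count_bounds z rho : C < rho ->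
  exists2 N : R, disk_count Lam z rho = N%:E &
    a * (rho - C) ^+ 2 <= N <= a * (rho + C) ^+ 2.
Proof.
move=> Crho.
have [J hJ] : exists J : nat, cmod z + rho <= J%:R / q.
  exists (Num.truncn ((cmod z + rho) * q)).+1.
  by rewrite ler_pdivlMr// ltW// truncnS_gt.
pose N := \sum_(j < J) ring_count a s z rho j.
exists N; first exact: disk_countE.
have U0 := unit_area_gt0 R.
have NE : (\sum_(j < J) (ring_count a s z rho j * unit_area R / a)%:E)%E =
    (N * unit_area R / a)%:E.
  by rewrite sumEFin -!mulr_suml.
have rC0 : 0 < rho - C by rewrite subr_gt0.
have rC1 : 0 < rho + C by rewrite ltr_wpDr// (le_lt_trans C0).
apply/andP; split.
  have : (area (disc z (rho - C)) <= (N * unit_area R / a)%:E)%E.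
    rewrite -NE; apply: (@le_trans _ _ (area (disc 0%R (J%:R / q)%R `&` disc z (rho - C)))).
      apply: le_measure; rewrite ?inE; first exact: measurable_disc.
        by apply: measurableI; exact: measurable_disc.
      move=> p hp; split => //; move: hp; rewrite /disc /mkset subr0 => hp.
      have := cmod_leB (to_complex p) z; have := C0; lra.
    rewrite -area_disc_rings//; last exact: measurable_disc.
    by apply: lee_sum => j _; exact: ring_count_ge.
  rewrite area_disc// lee_fin ler_pdivlMr//.
  have -> : unit_area R * (rho - C) ^+ 2 * a = a * (rho - C) ^+ 2 * unit_area R by ring.
  by rewrite ler_pM2r.
have : ((N * unit_area R / a)%:E <= area (disc z (rho + C)))%E.
  rewrite -NE; apply: (@le_trans _ _ (area (disc 0%R (J%:R / q)%R `&` disc z (rho + C)))).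
    rewrite -area_disc_rings//; last exact: measurable_disc.
    by apply: lee_sum => j _; exact: ring_count_le.
  apply: le_measure; rewrite ?inE; last by move=> p [].
    by apply: measurableI; exact: measurable_disc.
  exact: measurable_disc.
rewrite area_disc// lee_fin ler_pdivrMr//.
have -> : unit_area R * (rho + C) ^+ 2 * a = a * (rho + C) ^+ 2 * unit_area R by ring.
by rewrite ler_pM2r.
Qed.

Lemma disk_density_near (e : R) : 0 < e -> exists M : R, forall rho z, M < rho ->
  ((a / pi - e)%:E <= disk_density Lam z rho <= (a / pi + e)%:E)%E.
Proof.
move=> e0.
(* Once rho > 1, replacing rho by rho + C or rho - C changes a rho^2 by at most a (2 C + C^2) rho,
   so the density is off by at most D / rho. *)
pose D := a * (2 * C + C ^+ 2) / pi.
have p0 := pi_gt0 R.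
have D0 : 0 <= D.
  rewrite divr_ge0 ?pi_ge0// mulr_ge0 ?(ltW a0)//.
  by have := C0; have := sqr_ge0 C; lra.
exists (Num.max (Num.max 1 C) (D / e)) => rho z.
rewrite !gt_max => /andP[/andP[r1 rC] rD].
have r0 : 0 < rho by rewrite (lt_trans ltr01).
have [N NE /andP[N1 N2]] := disk_count_bounds z rC.
rewrite /disk_density NE -EFinM !lee_fin.
have pr : 0 < pi * rho ^+ 2 by rewrite mulr_gt0// exprn_gt0.
have DE : D * rho <= e * rho ^+ 2.
  have De : D < rho * e by rewrite -ltr_pdivrMr.
  by rewrite expr2 mulrA ler_pM2r// [e * rho]mulrC ltW.
have De : D * pi = a * (2 * C + C ^+ 2) by rewrite /D divfK// gt_eqF.
have h : a * (2 * C + C ^+ 2) * rho <= e * (pi * rho ^+ 2).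
  have -> : a * (2 * C + C ^+ 2) * rho = (D * rho) * pi by rewrite -De; ring.
  by rewrite [pi * _]mulrC mulrA ler_pM2r.
have aC : 0 <= a * C ^+ 2 by rewrite mulr_ge0 ?sqr_ge0 ?(ltW a0).
have h2 : a * C ^+ 2 <= a * C ^+ 2 * rho by apply: ler_peMr => //; exact: ltW.
have ap : a / pi * (pi * rho ^+ 2) = a * rho ^+ 2 by rewrite mulrA divfK// gt_eqF.
apply/andP; split.
  rewrite ler_pdivlMr// mulrBl ap; apply: le_trans N1; lra.
rewrite ler_pdivrMr// mulrDl ap; apply: (le_trans N2); lra.
Qed.

End Density.

Section LimfPinfty.
Variable R : realType.

Lemma limf_esup_pinfty (g : R -> \bar R) (l : R) :
  (forall e, 0 < e -> exists M : R, forall rho, M < rho ->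
     ((l - e)%:E <= g rho <= (l + e)%:E)%E) ->
  limf_esup g (pinfty_nbhs R) = l%:E.
Proof.
move=> hg; apply/eqP; rewrite eq_le; apply/andP; split.
  apply/lee_addgt0Pr => e e0; have [M hM] := hg e e0.
  apply: ge_ereal_inf; exists (ereal_sup (g @` [set x | M < x])).
    by exists [set x | M < x] => //; exists M; split=> //; exact: num_real.
  by apply: ge_ereal_sup => _ [x Mx <-]; rewrite -EFinD; case/andP: (hM x Mx).
apply: le_ereal_inf_tmp => _ [V [M [_ hV]] <-].
apply/lee_addgt0Pr => e e0; have [M' hM'] := hg e e0.
pose x := Num.max M M' + 1.
have x1 : M < x by rewrite ltr_pwDr// le_max lexx.
have x2 : M' < x by rewrite ltr_pwDr// le_max lexx orbT.
have /andP[h _] := hM' x x2.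
rewrite -leeBlDr// -EFinB; apply: (le_trans h); apply: ereal_sup_ubound.
by exists x => //; exact: hV.
Qed.

Lemma limf_einf_pinfty (g : R -> \bar R) (l : R) :
  (forall e, 0 < e -> exists M : R, forall rho, M < rho ->
     ((l - e)%:E <= g rho <= (l + e)%:E)%E) ->
  limf_einf g (pinfty_nbhs R) = l%:E.
Proof.
move=> hg; rewrite /limf_einf (@limf_esup_pinfty _ (- l)) ?EFinN ?oppeK// => e e0.
have [M hM] := hg e e0; exists M => rho /hM /andP[h1 h2].
have -> : (- l - e)%R = (- (l + e))%R by ring.
have -> : (- l + e)%R = (- (l - e))%R by ring.
by rewrite !EFinN !leeN2 h1 h2.
Qed.

End LimfPinfty.

Section ZeroSeqDensity.
Variables (R : realType) (a s : R).
Hypotheses (a0 : 0 < a) (s0 : 0 < s).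

Lemma zero_seq_upper_density : upper_density (zero_seq a s) = (a / pi)%:E.
Proof.
apply: limf_esup_pinfty => e e0; have [M hM] := disk_density_near a0 s0 e0.
exists M => rho Mrho; apply/andP; split.
  apply: (@le_trans _ _ (disk_density (zero_seq a s) 0 rho)).
    by case/andP: (hM rho 0 Mrho).
  by apply: ereal_sup_ubound; exists 0.
by apply: ge_ereal_sup => _ [z _ <-]; case/andP: (hM rho z Mrho).
Qed.

Lemma zero_seq_lower_density : lower_density (zero_seq a s) = (a / pi)%:E.
Proof.
apply: limf_einf_pinfty => e e0; have [M hM] := disk_density_near a0 s0 e0.
exists M => rho Mrho; apply/andP; split.
  by apply: le_ereal_inf_tmp => _ [z _ <-]; case/andP: (hM rho z Mrho).
apply: (@le_trans _ _ (disk_density (zero_seq a s) 0 rho)).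
  by apply: ereal_inf_lbound; exists 0.
by case/andP: (hM rho 0 Mrho).
Qed.

End ZeroSeqDensity.

(** * Membership in the Fock space *)

Section PowerIntegral.
Variables (R : realType) (t : R).
Hypothesis t1 : 1 < t.
Local Notation leb := (@lebesgue_measure R).

Let f (x : R) : R := (1 + x) `^ (- t).
Let F (x : R) : R := (1 - t)^-1 * (1 + x) `^ (1 - t).

Let is_derive_shifted_powR (b x : R) : 0 <= x ->
  is_derive x 1 (fun y => (1 + y) `^ b) (b * (1 + x) `^ (b - 1)).
Proof.
move=> x0; have x1 : 0 < 1 + x by rewrite ltr_pwDl.
have h1 : is_derive x 1 (fun y : R => 1 + y) 1.
  have := is_deriveD (is_derive_cst (1 : R) x (1 : R)) (is_derive_id x (1 : R)).
  by rewrite add0r.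
have h2 := is_derive1_powR b x1.
have := @is_derive1_comp _ (@powR R ^~ b) (fun y : R => 1 + y) x _ _ h2 h1.
by rewrite mulr1.
Qed.

Let F_derive (x : R) : 0 <= x -> is_derive x 1 F (f x).
Proof.
move=> x0; have := is_deriveZ (1 - t)^-1 (is_derive_shifted_powR (1 - t) x0).
rewrite /GRing.scale /= mulrA mulVf ?mul1r; last by rewrite subr_eq0 lt_eqF.
by have -> : 1 - t - 1 = - t by ring.
Qed.

Let F_lim : F x @[x --> +oo%R] --> (0 : R).
Proof.
apply/cvgrPdist_le => e e0.
have t10 : 0 < t - 1 by rewrite subr_gt0.
pose M := ((t - 1) * e) `^ (- (t - 1)^-1).
exists (Num.max 0 M); split; first exact: num_real.
move=> x; rewrite gt_max => /andP[x0 xM].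
have te : 0 < (t - 1) * e by rewrite mulr_gt0.
have M0 : 0 < M by exact: powR_gt0.
have x1 : M <= 1 + x by rewrite (le_trans (ltW xM))// lerDr.
have h : (1 + x) `^ (1 - t) <= (t - 1) * e.
  have -> : (t - 1) * e = M `^ (1 - t).
    rewrite /M -powRrM -[X in X = _]powRr1 ?(ltW te)//; congr (_ `^ _).
    by rewrite -(opprB t 1) mulrNN mulVf// gt_eqF.
  rewrite -(opprB t 1) !powRN lef_pV2 ?posrE ?powR_gt0//; last by rewrite ltr_pwDl// ltW.
  by apply: ge0_ler_powR; rewrite ?nnegrE ?(ltW t10) ?(ltW M0) ?addr_ge0 ?(ltW x0).
rewrite sub0r normrN /F normrM (ger0_norm (powR_ge0 _ _)).
have -> : `|(1 - t)^-1| = (t - 1)^-1.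
  by rewrite normfV -opprB normrN gtr0_norm.
by rewrite ler_pdivrMl.
Qed.

Let half_integral : (\int[leb]_(x in `[0%R, +oo[) (f x)%:E = ((t - 1)^-1)%:E)%E.
Proof.
rewrite (@ge0_continuous_FTC2y R f F 0 0).
- by rewrite /F addr0 powR1 mulr1 sub0e -EFinN -invrN opprB.
- by move=> x _; exact: powR_ge0.
- apply: continuous_in_subspaceT => x /set_mem /=; rewrite in_itv /= andbT => x0.
  by apply/differentiable_continuous/derivable1_diffP; have [] := is_derive_shifted_powR (- t) x0.
- exact: F_lim.
- by move=> x x0; have [] := F_derive (ltW x0).
- apply: cvg_at_right_filter.
  by apply/differentiable_continuous/derivable1_diffP; have [] := F_derive (lexx 0).
- move=> x; rewrite in_itv /= andbT => x0; rewrite derive1E.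
  by have [_ ->] := F_derive (ltW x0).
Qed.

Definition decay (x : R) : R := (1 + `|x|) `^ (- t).

Lemma measurable_decay : measurable_fun setT decay.
Proof.
apply: (measurableT_comp (measurable_powR (- t))).
by apply: measurable_funD => //; exact: normr_measurable.
Qed.

Lemma decay_integral : (\int[leb]_x (decay x)%:E < +oo)%E.
Proof.
have mE : measurable_fun setT (EFin \o decay) by apply/measurable_EFinP; exact: measurable_decay.
have d0 x : (0 <= (decay x)%:E)%E by rewrite lee_fin powR_ge0.
have h1 : (\int[leb]_(x in `[0%R, +oo[) (decay x)%:E = ((t - 1)^-1)%:E)%E.
  rewrite -half_integral; apply: eq_integral => x /set_mem /=.
  by rewrite in_itv /= andbT => x0; rewrite /decay ger0_norm.
have h2 : (\int[leb]_(x in `]-oo, 0%R]) (decay x)%:E = ((t - 1)^-1)%:E)%E.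
  rewrite -h1 ge0_integration_by_substitution0//.
  by apply: eq_integral => x _; rewrite /decay normrN.
have -> : [set: R] = `]-oo, 0%R] `|` `]0%R, +oo[ :> set R.
  apply/seteqP; split => // x _ /=; rewrite !in_itv /= andbT.
  by have [?|?] := leP x 0; [left|right].
rewrite ge0_integral_setU//=; last 2 first.
- exact: measurable_funS mE.
- apply/disj_set2P/seteqP; split => x // [] /=; rewrite !in_itv /= andbT => h h'.
  by have := le_lt_trans h h'; rewrite ltxx.
rewrite h2; apply: (@le_lt_trans _ _ (((t - 1)^-1)%:E + ((t - 1)^-1)%:E)%E); last first.
  by rewrite -EFinD ltry.
rewrite leeD2l// -h1; apply: ge0_subset_integral => //=.
  exact: measurable_funS mE.
by move=> x /=; rewrite !in_itv /= !andbT; exact: ltW.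
Qed.

End PowerIntegral.

Section Membership.
Variables (R : realType) (a s p : R).
Hypotheses (a0 : 0 < a) (s0 : 0 < s) (p0 : 0 < p) (sp : 2 < s * p).
Local Notation leb := (@lebesgue_measure R).
Local Notation plane := (measurableTypeR R * measurableTypeR R)%type.

Definition fock_density (b k : R) (F : R[i]^o -> R[i]^o) (xy : plane) : R :=
  (cmod (F (xy.1 +i* xy.2))) `^ b * expR (- k * (cmod (xy.1 +i* xy.2)) ^+ 2).

Lemma fock_density_ge0 b k F xy : 0 <= fock_density b k F xy.
Proof. by rewrite mulr_ge0 ?powR_ge0 ?expR_ge0. Qed.

Lemma measurable_cmod_entire (F : R[i]^o -> R[i]^o) : entire F ->
  measurable_fun setT (fun xy : plane => cmod (F (to_complex xy))).
Proof.
move=> hF; apply: (@measurable_ccontinuous _ (fun z => cmod (F z))) => z e e0.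
have [d d0 hd] := entire_ccontinuous z hF e0; exists d => // v hv.
exact: le_lt_trans (cmod_distB _ _) (hd _ hv).
Qed.

Lemma measurable_fock_density b k F : entire F ->
  measurable_fun setT (fock_density b k F).
Proof.
move=> hF; apply: measurable_funM.
  exact: (measurableT_comp (measurable_powR b) (measurable_cmod_entire hF)).
apply: (measurableT_comp (@measurable_expR R)).
apply: measurable_funM => //; apply: measurable_funX.
have := @measurable_cmod_sub R 0; congr measurable_fun.
by apply/funext => xy; rewrite subr0.
Qed.

Let t := s * p / 2.
Let t1 : 1 < t. Proof. by rewrite /t ltr_pdivlMr// mul1r. Qed.

(** The exponent s p = t + t is split between the coordinates, each at most |z| in absolute value.
    The product form suits Tonelli's theorem, and each factor is integrable because t > 1. *)
Lemma decay_dominates (x y : R) :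
  (1 + cmod (x +i* y)) `^ (- (s * p)) <= decay t x * decay t y.
Proof.
set r := cmod _; have r0 : 0 <= r by exact: cmod_ge0.
have hx : 1 + `|x| <= 1 + r by rewrite lerD2l; exact: (Re_le_cmod (x +i* y)).
have hy : 1 + `|y| <= 1 + r by rewrite lerD2l; exact: (Im_le_cmod (x +i* y)).
have t0 : 0 <= t by rewrite ltW// (lt_trans ltr01).
have h (u : R) : 1 + `|u| <= 1 + r -> (1 + r) `^ (- t) <= decay t u.
  move=> hu; rewrite /decay !powRN lef_pV2 ?posrE ?powR_gt0 ?ltr_pwDl//.
  by apply: ge0_ler_powR; rewrite ?nnegrE ?addr_ge0.
have -> : - (s * p) = - t + - t by rewrite /t; field.
rewrite powRD; last first.
  by apply/implyP => _; rewrite gt_eqF// ltr_pwDl.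
by apply: ler_pM; rewrite ?powR_ge0// h.
Qed.

Lemma fock_prod_in_fock_space : fock_space a p (fock_prod a s).
Proof.
have hE := entire_fock_prod a0 s0; split => //.
have [C C0 hC] := fock_prod_le a0 s0.
rewrite /fock_norm_pow.
have c0 : 0 <= p * a / (2 * pi).
  by rewrite divr_ge0 ?mulr_ge0 ?pi_ge0// ltW.
apply: lte_mul_pinfty => //.
pose k := p * a / 2.
apply: (@le_lt_trans _ _ (\int[leb \x leb]_xy ((C `^ p)%:E * ((decay t xy.1)%:E * (decay t xy.2)%:E)))%E).
  apply: ge0_le_integral => //.
  - by move=> xy _; rewrite lee_fin; exact: (fock_density_ge0 p k (fock_prod a s) xy).
  - by apply/measurable_EFinP; exact: (@measurable_fock_density p k _ hE).
  - apply: emeasurable_funM => //; apply: emeasurable_funM; apply/measurable_EFinP.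
      exact: (measurableT_comp (measurable_decay t) measurable_fst).
    exact: (measurableT_comp (measurable_decay t) measurable_snd).
  - move=> [x y] _ /=; rewrite -!EFinM lee_fin.
    set z : R[i] := x +i* y; set r := cmod z.
    have r0 : 0 <= r by exact: cmod_ge0.
    have r1 : 0 <= 1 + r by rewrite addr_ge0.
    apply: (@le_trans _ _ (C `^ p * (1 + r) `^ (- (s * p)))); last first.
      by rewrite ler_wpM2l ?powR_ge0//; exact: decay_dominates.
    have hz : cmod (fock_prod a s z) `^ p <=
        C `^ p * expR (k * r ^+ 2) * (1 + r) `^ (- (s * p)).
      apply: (@le_trans _ _ ((C * expR (a * r ^+ 2 / 2) * (1 + r) `^ (- s)) `^ p)).
        apply: ge0_ler_powR; rewrite ?nnegrE ?(ltW p0) ?cmod_ge0//.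
        by rewrite !mulr_ge0 ?expR_ge0 ?powR_ge0 ?(ltW C0).
      rewrite !powRM ?mulr_ge0 ?expR_ge0 ?powR_ge0 ?(ltW C0)//.
      rewrite -powRrM mulNr -expRM.
      by have -> : a * r ^+ 2 / 2 * p = k * r ^+ 2 by rewrite /k; ring.
    apply: (le_trans (ler_wpM2r (expR_ge0 _) hz)).
    have -> : C `^ p * expR (k * r ^+ 2) * (1 + r) `^ (- (s * p)) * expR (- k * r ^+ 2) =
      C `^ p * (1 + r) `^ (- (s * p)) * (expR (k * r ^+ 2) * expR (- k * r ^+ 2)) by ring.
    by rewrite mulNr -expRD subrr expR0 mulr1.
have md : measurable_fun setT (EFin \o decay t).
  by apply/measurable_EFinP; exact: measurable_decay.
have d0 x : (0 <= (decay t x)%:E)%E by rewrite lee_fin powR_ge0.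
rewrite fubini_tonelli1//=; last 2 first.
- apply: emeasurable_funM => //; apply: emeasurable_funM; apply/measurable_EFinP.
    exact: (measurableT_comp (measurable_decay t) measurable_fst).
  exact: (measurableT_comp (measurable_decay t) measurable_snd).
- by move=> xy; rewrite !mule_ge0// lee_fin powR_ge0.
rewrite /fubini_F /=.
have I0 := decay_integral t1; set I := (\int[leb]_x (decay t x)%:E)%E in I0.
have I00 : (0 <= I)%E by exact: integral_ge0.
have -> : (\int[leb]_x \int[leb]_y ((C `^ p)%:E * ((decay t x)%:E * (decay t y)%:E)) =
   (C `^ p)%:E * (I * I))%E.
  under eq_integral => x _.
    under eq_integral do rewrite muleA.
    rewrite ge0_integralZl//; last by rewrite mule_ge0// lee_fin powR_ge0.
    rewrite -/I -muleA.
    over.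
  rewrite ge0_integralZl//; last 3 first.
  - by apply: emeasurable_funM.
  - by move=> x _; rewrite mule_ge0.
  - by rewrite lee_fin powR_ge0.
  by rewrite ge0_integralZr.
apply: lte_mul_pinfty; rewrite ?lee_fin ?powR_ge0//.
by apply: lte_mul_pinfty => //; rewrite ge0_fin_numE.
Qed.

End Membership.

(** * Non-membership *)

Section RemovableZeros.
Variable R : realType.
Implicit Types F P : R[i]^o -> R[i]^o.

(** Near a common simple zero F / P coincides with gF / gP, the quotient of the local cofactors; H
    takes its value there, which removes the singularity. *)
Lemma entire_quotient F P : entire F -> entire P ->
  (forall z, P z = 0 -> zero_order F z 1 /\ zero_order P z 1) ->
  exists2 H : R[i]^o -> R[i]^o, entire H & forall z, F z = H z * P z.
Proof.
move=> hF hP hz.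
pose loc z (gF gP : R[i]^o -> R[i]^o) :=
  [/\ derivable gF z 1, derivable gP z 1, gP z != 0 &
   exists2 d : R, 0 < d & forall w, cmod (w - z) < d ->
     F w = (w - z) * gF w /\ P w = (w - z) * gP w].
have locE z : P z = 0 -> exists gF gP, loc z gF gP.
  move=> /hz[[gF [dF _ eF]] [gP [dP gP0 eP]]]; exists gF, gP.
  move: dF dP eF eP => /near_complexP[d1 d10 h1] /near_complexP[d2 d20 h2]
    /near_complexP[d3 d30 h3] /near_complexP[d4 d40 h4]; split => //.
  - by apply: h1; rewrite subrr cmod0.
  - by apply: h2; rewrite subrr cmod0.
  - exists (Num.min d3 d4); first by rewrite lt_min d30.
    by move=> w; rewrite lt_min => /andP[/h3 -> /h4 ->]; rewrite expr1.
have /choice[H hH] : forall z, exists l, (P z != 0 /\ l = F z / P z) \/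
    (P z = 0 /\ exists gF gP, loc z gF gP /\ l = gF z / gP z).
  move=> z; have [Pz|Pz] := eqVneq (P z) 0; last by exists (F z / P z); left.
  have [gF [gP hl]] := locE z Pz; exists (gF z / gP z); right; split => //.
  by exists gF, gP.
have PH z : P z != 0 -> H z = F z / P z.
  by move=> Pz; case: (hH z) => [[]//|[Pz0]]; rewrite Pz0 eqxx in Pz.
have quot (f g : R[i]^o -> R[i]^o) z : derivable f z 1 -> derivable g z 1 -> g z != 0 ->
    derivable (fun w => f w / g w) z 1.
  by move=> df dg gz; exact: (derivableM df (derivableV gz dg)).
have nz (g : R[i]^o -> R[i]^o) z : derivable g z 1 -> g z != 0 ->
    exists2 d : R, 0 < d & forall w, cmod (w - z) < d -> g w != 0.
  move=> /derivable_cderiv[D /cderiv_ccontinuous hg] gz.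
  have [d d0 hd] := hg (cmod (g z)) (ltac:(by rewrite cmod_gt0)).
  exists d => // w /hd h; apply: contraTneq h => ->.
  by rewrite sub0r cmodN ltxx.
exists H => [z|z]; last first.
  have [Pz|Pz] := eqVneq (P z) 0; last by rewrite PH// divfK.
  have [gF [gP [_ _ _ [d d0 hd]]]] := locE z Pz.
  have [-> _] := hd z (ltac:(by rewrite subrr cmod0)).
  by rewrite Pz subrr mul0r mulr0.
case: (hH z) => [[Pz _]|[Pz [gF [gP [[dF dP gP0 [d d0 hd]] Hz]]]]].
  have [d d0 hd] := nz P z (hP z) Pz.
  apply: near_eq_derivable (quot F P z (hF z) (hP z) Pz).
  by apply/near_complexP; exists d => // w /hd/PH ->.
apply: near_eq_derivable (quot gF gP z dF dP gP0).
have [d' d'0 hd'] := nz gP z dP gP0.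
apply/near_complexP; exists (Num.min d d'); first by rewrite lt_min d0.
move=> w; rewrite lt_min => /andP[/hd[eF eP] /hd' gw].
have [->//|wz] := eqVneq w z.
have wz0 : w - z != 0 by rewrite subr_eq0.
rewrite PH; last by rewrite eP mulf_neq0.
by rewrite eF eP -mulf_div mulfV// mul1r.
Qed.

End RemovableZeros.

Section Factorization.
Variables (R : realType) (a s : R).
Hypotheses (a0 : 0 < a) (s0 : 0 < s).
Let c := prod_coef a s.
(** A partial product is the canonical product with coefficients cut off at n, so the results on
    entireness and simple zeros apply to it. *)
Let trunc_coef n j := if (j < n)%N then c j else 0.

Let c0 j : 0 <= c j. Proof. exact: prod_coef_ge0. Qed.
Let tc0 n j : 0 <= trunc_coef n j. Proof. by rewrite /trunc_coef; case: ifP. Qed.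

Let tcB n : prod_bounded (trunc_coef n) mult.
Proof.
move=> x x0; have [B hB] := fock_prod_bounded a0 s0 x0; exists B => N.
apply: le_trans (hB N); apply: ler_prod => j _.
rewrite addr_ge0 ?mulr_ge0 ?exprn_ge0//= lerD2l ler_wpM2r ?exprn_ge0//.
by rewrite /trunc_coef; case: ifP.
Qed.

Let canonical_prod_trunc n : canonical_prod (trunc_coef n) mult = partial_prod c mult n.
Proof.
apply/funext => z; apply: (clim_unique (clim_canonical_prod (tc0 n) (tcB n) z)).
move=> e e0; exists n => N nN.
suff -> : partial_prod (trunc_coef n) mult N z = partial_prod c mult n z.
  by rewrite subrr cmod0 ltW.
rewrite /partial_prod -(subnKC nN) big_split_ord /= [X in _ * X]big1 ?mulr1.
  by apply: eq_bigr => j _; rewrite /trunc_coef ltn_ord.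
by move=> j _; rewrite /trunc_coef ltnNge leq_addr /= rmorph0 mul0r subr0.
Qed.

Lemma entire_partial_prod n : entire (partial_prod c mult n).
Proof. by rewrite -canonical_prod_trunc; exact: (entire_canonical_prod (tc0 n) (tcB n)). Qed.

Lemma partial_prod_zero n (z : R[i]) : partial_prod c mult n z = 0 ->
  zero_order (partial_prod c mult n) z 1 /\ exists m, zero_seq a s m = z.
Proof.
move=> /eqP/prodf_eq0[[j jn] _ /=]; rewrite subr_eq0 eq_sym => /eqP hj.
have [l lj zl] := prod_coef_eq1 hj; split; last first.
  by exists (j ^ 2 + l)%N; rewrite zl; exact: zero_seq_ring_point.
rewrite -canonical_prod_trunc.
apply: (@canonical_prod_zero_order1 _ _ _ j z (tc0 n) (@tcB n) (ltn0Sn _)).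
  by rewrite /trunc_coef jn.
move=> i ij; rewrite /trunc_coef; case: ifP => _; last first.
  by rewrite rmorph0 mul0r eq_sym oner_eq0.
apply: contra_neq ij => hi; have [l' _ zl'] := prod_coef_eq1 hi.
by apply: (ring_radius_inj a0 s0); rewrite -(cmod_ring_point a s i l') -zl' zl cmod_ring_point.
Qed.

Lemma partial_prod0 n : partial_prod c mult n 0 = 1.
Proof.
rewrite /partial_prod big1// => j _.
by rewrite /mult exprS mul0r mulr0 subr0.
Qed.

Lemma zeros_are_neq0 F : zeros_are F (zero_seq a s) -> F 0 != 0.
Proof.
move=> /(_ 0)[m [g [_ g0 hg]]].
have -> : [set n | zero_seq a s n = 0] = set0.
  apply/seteqP; split => // n /= hn.
  have := cmod_ring_point a s (ring_index n) (n - ring_index n ^ 2).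
  rewrite -/(zero_seq a s n) hn cmod0 => /eqP.
  by rewrite lt_eqF// ring_radius_gt0.
rewrite -II0 => /card_eq_II m0.
by move: hg; rewrite -m0 => /near_complexP[d d0 /(_ 0)]; rewrite subrr cmod0
  expr0 mul1r => ->.
Qed.

Lemma zeros_are_quotient F n : entire F -> zeros_are F (zero_seq a s) ->
  exists H : R[i]^o -> R[i]^o, [/\ entire H, H 0 = F 0 &
    forall z, F z = H z * partial_prod c mult n z].
Proof.
move=> hF hz.
have [|H hH eH] := entire_quotient hF (@entire_partial_prod n).
  move=> z /partial_prod_zero[hP [m zm]]; split => //.
  have [m' hm' ] := hz z.
  have -> : [set k | zero_seq a s k = z] = [set m].
    apply/seteqP; split => k /=; last by move=> ->.
    rewrite -zm /zero_seq => h.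
    have [h1 h2] := ring_point_inj a0 s0 (ring_offset_lt k) (ring_offset_lt m) h.
    have /andP[k1 _] := ring_indexP k; have /andP[m1 _] := ring_indexP m.
    by rewrite -(subnKC k1) -(subnKC m1) h2 h1.
  rewrite (card_eql card_set1) => /card_eq_II m1.
  by rewrite m1.
exists H; split => //; by rewrite (eH 0) partial_prod0 mulr1.
Qed.

End Factorization.

Section NonMembership.
Variables (R : realType) (a q s : R).
Hypotheses (a0 : 0 < a) (q0 : 0 < q) (s0 : 0 < s) (sq : s * q = 2).
Local Notation plane := (measurableTypeR R * measurableTypeR R)%type.
Let U := unit_area R.
Let U0 : 0 < U := unit_area_gt0 R.

Lemma integral_annulus_rotate N k (r1 r2 : R) (g : plane -> \bar R) : (0 < N)%N ->
  measurable_fun setT g -> (forall p, 0 <= g p)%E ->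
  (\int[@area R]_(p in annulus r1 r2) g (cmap (fun z => (unity_root R N ^+ k * z)%R) p) =
   \int[@area R]_(p in annulus r1 r2) g p)%E.
Proof.
move=> N0 mg g0; have [mT hT] := area_preserving_unity_root R k N0.
have mgA : measurable_fun (annulus r1 r2) g by exact: measurable_funS mg.
have e := ge0_integral_pushforward mT (@area R) (measurable_annulus r1 r2) mgA
  (fun y _ => g0 y).
rewrite annulus_unity_root in e; apply: (etrans (esym e)).
by apply: eq_measure_integral => A mA _; exact: hT.
Qed.

(** Rotating by the N roots of unity and summing multiplies the integral by N, so the pointwise
    inequality [circle_mean_ge] can be integrated as it stands, in place of polar coordinates. *)
Lemma annulus_mean_ge (H : R[i]^o -> R[i]^o) (r1 r2 : R) : entire H -> H 0 != 0 ->
  0 <= r2 ->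
  ((cmod (H 0) `^ q / 2)%:E * area (annulus r1 r2) <=
   \int[@area R]_(p in annulus r1 r2) ((cmod (H (to_complex p))) `^ q)%:E)%E.
Proof.
move=> hH H0 r20; have [N N0 hN] := circle_mean_ge hH q0 r20 H0.
pose g p := ((cmod (H (to_complex p))) `^ q)%:E.
have mg : measurable_fun setT g.
  apply/measurable_EFinP.
  exact: (measurableT_comp (measurable_powR q) (measurable_cmod_entire hH)).
have g0 p : (0 <= g p)%E by rewrite lee_fin powR_ge0.
have mA := measurable_annulus r1 r2.
have mT k := (area_preserving_unity_root R k N0).1.
have e : (N%:R%:E * \int[@area R]_(p in annulus r1 r2) g p =
    \int[@area R]_(p in annulus r1 r2)
      \sum_(k < N) g (cmap (fun z => (unity_root R N ^+ k * z)%R) p))%E.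
  rewrite ge0_integral_sum//; last first.
    by move=> k; apply: measurable_funTS; exact: (measurableT_comp mg (mT k)).
  under eq_bigr do rewrite integral_annulus_rotate//.
  by rewrite sumr_const card_ord; exact: mule_natl.
have Nr : 0 < N%:R :> R by rewrite ltr0n.
rewrite -(@lee_pmul2l _ N%:R%:E) ?lte_fin// e muleA -EFinM.
rewrite -integral_cst//; apply: ge0_le_integral => //.
- by move=> p _; rewrite lee_fin mulr_ge0// divr_ge0// powR_ge0.
- apply: emeasurable_sum => k; apply: measurable_funTS; exact: (measurableT_comp mg (mT k)).
move=> p /andP[_ hp]; rewrite /g sumEFin lee_fin.
apply: (le_trans (hN _ (ltW hp))); rewrite le_eqVlt; apply/orP; left; apply/eqP.
by apply: eq_bigr => k _; rewrite /cmap of_complexK.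
Qed.

(** The radii between which [partial_prod_lower_bound] applies. The annuli are disjoint, as [rout n]
    <= [rin n.+1]. *)
Let rin (n : nat) : R := Num.sqrt ((n%:R * n.+1%:R + s) / a).
Let rout (n : nat) : R := Num.sqrt ((n.+1%:R ^+ 2 + s) / a).

Let rin_sqr n : a * rin n ^+ 2 = n%:R * n.+1%:R + s.
Proof.
rewrite sqr_sqrtr; first by rewrite mulrC divfK// gt_eqF.
by rewrite divr_ge0 ?(ltW a0)// addr_ge0 ?mulr_ge0// ltW.
Qed.

Let rout_sqr n : a * rout n ^+ 2 = n.+1%:R ^+ 2 + s.
Proof.
rewrite sqr_sqrtr; first by rewrite mulrC divfK// gt_eqF.
by rewrite divr_ge0 ?(ltW a0)// addr_ge0 ?exprn_ge0// ltW.
Qed.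

Let rin0 n : 0 <= rin n. Proof. exact: sqrtr_ge0. Qed.

Let rin_rout n : rin n <= rout n.
Proof.
apply: ler_wsqrtr; rewrite ler_wpM2r ?invr_ge0 ?(ltW a0)// lerD2r expr2 ler_wpM2r//.
by rewrite ler_nat.
Qed.

Let rout_rin n : rout n <= rin n.+1.
Proof.
apply: ler_wsqrtr; rewrite ler_wpM2r ?invr_ge0 ?(ltW a0)// lerD2r expr2 ler_wpM2l//.
by rewrite ler_nat.
Qed.

Lemma annulus_density_ge : exists2 k : R, 0 < k & forall (F : R[i]^o -> R[i]^o) n, entire F ->
  zeros_are F (zero_seq a s) -> (0 < n)%N ->
  ((k * cmod (F 0) `^ q / n.+1%:R)%:E <=
   \int[@area R]_(p in annulus (rin n) (rout n)) (fock_density q (q * a / 2) F p)%:E)%E.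
Proof.
have [k0 k00 hk0] := partial_prod_lower_bound a0 s0.
exists (k0 `^ q * U / (2 * (1 + s))).
  by rewrite !mulr_gt0 ?powR_gt0 ?invr_gt0 ?mulr_gt0 ?addr_gt0.
move=> F n hF hz n0; have [H [hH H0 eH]] := zeros_are_quotient a0 s0 n hF hz.
have F0 := zeros_are_neq0 hz.
pose A := annulus (rin n) (rout n); have mA : measurable A by exact: measurable_annulus.
have rn0 : 0 <= rout n by exact: le_trans (rin_rout n).
have D0 : 0 < n.+1%:R ^+ 2 + s by rewrite ltr_wpDl// exprn_ge0.
(* Lower bound for the weighted |P_n|^q on the annulus: since s q = 2, |z|^(- s q) = |z|^(- 2), and
   this is at least a / ((n + 1)^2 + s) there. *)
pose e := k0 `^ q * (a / (n.+1%:R ^+ 2 + s)).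
have e0 : 0 <= e by rewrite mulr_ge0 ?powR_ge0// divr_ge0 ?(ltW a0) ?(ltW D0).
have mg : measurable_fun setT (fun p : plane => ((cmod (H (to_complex p))) `^ q)%:E).
  apply/measurable_EFinP.
  exact: (measurableT_comp (measurable_powR q) (measurable_cmod_entire hH)).
have h1 : (e%:E * \int[@area R]_(p in A) ((cmod (H (to_complex p))) `^ q)%:E <=
   \int[@area R]_(p in A) (fock_density q (q * a / 2) F p)%:E)%E.
  rewrite -ge0_integralZl_EFin//; last 2 first.
  - by move=> p _; rewrite lee_fin powR_ge0.
  - exact: measurable_funS mg.
  apply: ge0_le_integral => //.
  - by move=> p _; rewrite -EFinM lee_fin mulr_ge0// powR_ge0.
  - by apply: emeasurable_funM => //; exact: measurable_funS mg.
  - by apply/measurable_EFinP; apply: measurable_funTS; exact: measurable_fock_density.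
  move=> p /andP[p1 p2]; rewrite -EFinM lee_fin /fock_density.
  rewrite -/(to_complex p); set z := to_complex p in p1 p2 *; set r := cmod z in p1 p2 *.
  have r0 : 0 <= r by exact: cmod_ge0.
  have b1 : n%:R * n.+1%:R + s <= a * r ^+ 2.
    by rewrite -rin_sqr ler_wpM2l ?(ltW a0)// lerXn2r ?nnegrE.
  have b2 : a * r ^+ 2 <= n.+1%:R ^+ 2 + s.
    by rewrite -rout_sqr ler_wpM2l ?(ltW a0)// lerXn2r ?nnegrE// ltW.
  have rp : 0 < r.
    rewrite lt_neqAle r0 andbT; apply: contraTneq b1 => <-.
    by rewrite expr0n mulr0 -ltNge ltr_wpDl// mulr_ge0.
  have hP := hk0 n z n0 b1 b2; rewrite -/r in hP.
  rewrite eH cmodM powRM ?cmod_ge0// [e * _]mulrC -mulrA ler_wpM2l ?powR_ge0//.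
  have hPq : (k0 * expR (a * r ^+ 2 / 2) * r `^ (- s)) `^ q <=
      cmod (partial_prod (prod_coef a s) mult n z) `^ q.
    apply: ge0_ler_powR; rewrite ?nnegrE ?(ltW q0) ?cmod_ge0//.
    by rewrite !mulr_ge0 ?expR_ge0 ?powR_ge0 ?(ltW k00).
  apply: le_trans (ler_wpM2r (expR_ge0 _) hPq).
  rewrite !powRM ?mulr_ge0 ?expR_ge0 ?powR_ge0 ?(ltW k00)//.
  rewrite -powRrM -expRM mulNr sq powRN powR_mulrn//.
  rewrite -!mulrA ler_wpM2l ?powR_ge0// mulrCA -expRD.
  rewrite [X in expR X](_ : _ = 0); last ring.
  rewrite expR0 mulr1 ler_pdivrMr// mulrC ler_pdivlMr ?exprn_gt0//.
apply: le_trans h1.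
have h2 := annulus_mean_ge (rin n) hH (_ : H 0 != 0) rn0.
rewrite H0 in h2; apply: le_trans (lee_wpmul2l _ (h2 F0)); last by rewrite lee_fin.
have ra : 0 < rout n by rewrite sqrtr_gt0 divr_gt0.
rewrite area_annulus// -!EFinM lee_fin -/U.
(* The area grows like n + 1 while [e] decays like its inverse square: the contribution is of order
   1 / (n + 1). The constant 1 + s comes from m^2 + s <= (1 + s) m^2 with m = n + 1. *)
have -> : rout n ^+ 2 - rin n ^+ 2 = n.+1%:R / a.
  apply: (@mulfI _ a); first by rewrite gt_eqF.
  by rewrite mulrBr rin_sqr rout_sqr mulrCA mulfV ?gt_eqF// mulr1 -natr1; ring.
have m1 : 1 <= n.+1%:R :> R by rewrite ler1n.
move: D0 m1; rewrite /e; move: (n.+1%:R : R) => m D0 m1.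
have m0 : 0 < m by exact: lt_le_trans m1.
have -> : k0 `^ q * (a / (m ^+ 2 + s)) * (cmod (F 0) `^ q / 2 * (U * (m / a))) =
  k0 `^ q * U * cmod (F 0) `^ q / 2 * (m / (m ^+ 2 + s)).
  by field; rewrite !gt_eqF.
have -> : k0 `^ q * U / (2 * (1 + s)) * cmod (F 0) `^ q / m =
  k0 `^ q * U * cmod (F 0) `^ q / 2 * (((1 + s) * m)^-1).
  by field; rewrite !gt_eqF// addr_gt0.
rewrite ler_wpM2l//.
  by rewrite divr_ge0// !mulr_ge0 ?powR_ge0// ltW.
rewrite ler_pdivlMr// ler_pdivrMl ?mulr_gt0 ?addr_gt0//.
have : 1 <= m ^+ 2 by rewrite expr_ge1// ltW.
have s00 := ltW s0.
move=> /(ler_wpM2l s00); lra.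
Qed.

(** The disjoint annuli are added up. They start at index 1, where the lower bound on P_n begins,
    and annulus n + 1 contributes 1 / (n + 2). *)
Lemma disc_density_ge : exists2 k : R, 0 < k & forall (F : R[i]^o -> R[i]^o) M, entire F ->
  zeros_are F (zero_seq a s) ->
  ((k * cmod (F 0) `^ q * \sum_(n < M) n.+2%:R^-1)%:E <=
   \int[@area R]_(p in disc 0%R (rin M.+1)) (fock_density q (q * a / 2) F p)%:E)%E.
Proof.
have [k k0 hk] := annulus_density_ge; exists k => // F M hF hz.
pose g p := (fock_density q (q * a / 2) F p)%:E.
have mg : measurable_fun setT g.
  by apply/measurable_EFinP; exact: measurable_fock_density.
have g0 p : (0 <= g p)%E by rewrite lee_fin fock_density_ge0.
have mD r := @measurable_disc R 0 r.
elim: M => [|M IH].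
  by rewrite big_ord0 mulr0; apply: integral_ge0 => p _; exact: g0.
rewrite big_ord_recr /= mulrDr EFinD.
have mA := measurable_annulus (rin M.+1) (rout M.+1).
have hA := hk F M.+1 hF hz (ltn0Sn _).
apply: (le_trans (leeD IH hA)).
rewrite -ge0_integral_setU//=; last 3 first.
- exact: measurable_funTS.
- by move=> p _; exact: g0.
- apply/disj_set2P/seteqP; split => p // [h1 /andP[h2 _]].
  by move: h1; rewrite /disc /mkset subr0 ltNge h2.
apply: ge0_subset_integral => //.
- exact: measurableU.
- exact: measurable_funTS.
- by move=> p _; exact: g0.
move=> p; rewrite /disc /mkset subr0; case; rewrite /disc /mkset ?subr0.
  by move=> /lt_le_trans; apply; apply: le_trans (rin_rout _) (rout_rin _).
by move=> /andP[_ /lt_le_trans]; apply; exact: rout_rin.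
Qed.

Lemma harmonic_tail_unbounded (B : R) : exists M, B < \sum_(n < M) n.+2%:R^-1.
Proof.
apply: contrapT => /forallNP h; apply: (@dvg_harmonic R).
apply: nondecreasing_is_cvgn.
  apply/nondecreasing_seqP => n.
  by rewrite /series /= big_nat_recr//= lerDl invr_ge0.
exists (1 + B) => _ [n _ <-]; rewrite /series /= big_mkord.
case: n => [|n].
  rewrite big_ord0; have /negP := h 0%N; rewrite -leNgt big_ord0 => B0; lra.
rewrite big_ord_recl /= invr1 lerD2l; have /negP := h n; by rewrite -leNgt.
Qed.

Lemma zero_seq_not_zero_set : ~ is_zero_set a q (zero_seq a s).
Proof.
move=> [F [[hF hfin] _] hz].
have F0 : 0 < cmod (F 0) `^ q.
  by apply: powR_gt0; rewrite cmod_gt0; exact: (zeros_are_neq0 hz).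
have [k k0 hk] := disc_density_ge.
pose I := (\int[@area R]_p (fock_density q (q * a / 2) F p)%:E)%E.
have I0 : (0 <= I)%E.
  by apply: integral_ge0 => p _; rewrite lee_fin fock_density_ge0.
have Ifin : (I < +oo)%E.
  have c0 : 0 < q * a / (2 * pi).
    by rewrite divr_gt0 ?mulr_gt0 ?pi_gt0.
  rewrite ltey; apply: contraTneq hfin => Iy.
  rewrite /fock_norm_pow -[X in (_ * X)%E]/I Iy gt0_muley ?lte_fin//.
have kF : 0 < k * cmod (F 0) `^ q by rewrite mulr_gt0.
have [M hM] := harmonic_tail_unbounded (fine I / (k * cmod (F 0) `^ q)).
have := hk F M hF hz; apply/negP; rewrite -ltNge.
apply: (@le_lt_trans _ _ I).
  apply: ge0_subset_integral => //.
  - exact: measurable_disc.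
  - by apply/measurable_EFinP; exact: measurable_fock_density.
  - by move=> p _; rewrite lee_fin fock_density_ge0.
rewrite -(fineK (_ : I \is a fin_num)) ?ge0_fin_numE// lte_fin.
by rewrite mulrC -ltr_pdivrMr.
Qed.

End NonMembership.

Theorem theorem1p1 (R : realType) (alpha p q : R)
    (alpha_gt0 : 0 < alpha) (p_gt0 : 0 < p) (q_gt0 : 0 < q) (q_lt_p : q < p) :
  exists Lambda : nat -> R[i],
    [/\ upper_density Lambda = (alpha / pi)%:E,
        lower_density Lambda = (alpha / pi)%:E,
        is_zero_set alpha p Lambda &
        ~ is_zero_set alpha q Lambda].
Proof.
have s0 : 0 < 2 / q by rewrite divr_gt0.
have sq : 2 / q * q = 2 by rewrite divfK// gt_eqF.
have sp : 2 < 2 / q * p by rewrite -[ltLHS]sq ltr_pM2l.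
exists (zero_seq alpha (2 / q)); split.
- exact: zero_seq_upper_density.
- exact: zero_seq_lower_density.
- exists (fock_prod alpha (2 / q)); last exact: fock_prod_zeros.
  split; first exact: fock_prod_in_fock_space.
  by move=> /(congr1 (@^~ 0)) /eqP; exact/negP/fock_prod0.
- exact: zero_seq_not_zero_set.
Qed.
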